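(* Let $N\subset M$, ${}_N\mathcal X_N$ be as in the context, with coupling matrix $Z$ and intermediate subfactors $M_\pm$. The entries of the type I coupling matrices $Z^\pm$ arising from $N\subset M_\pm$ can be written as $$Z^\pm_{\lambda,\mu}=\sum_{\tau\in{}_M\mathcal X_M^0}b^\pm_{\tau,\lambda}\,b^\pm_{\tau,\mu},\qquad \lambda,\mu\in{}_N\mathcal X_N,$$ with chiral branching coefficients $b^\pm_{\tau,\lambda}=\langle\tau,\alpha^\pm_\lambda\rangle$, $\tau\in{}_M\mathcal X_M^0$, $\lambda\in{}_N\mathcal X_N$. If the two intermediate subfactors are identical, $M_+=M_-$ (so that $Z^+=Z^-$), then the entries of the coupling matrix $Z$ arising from $N\subset M$ can be written as $$Z_{\lambda,\mu}=\sum_{\tau\in{}_M\mathcal X_M^0}b^+_{\tau,\lambda}\,b^+_{\omega(\tau),\mu},\qquad \lambda,\mu\in{}_N\mathcal X_N.$$ Here $\omega=\vartheta_+^{-1}\circ\vartheta_-$ is a permutation of ${}_M\mathcal X_M^0$ satisfying $\omega(0)=0$, and it realizes an automorphism of the ambichiral fusion rules, i.e. $\langle\omega(\tau''),\omega(\tau)\omega(\tau')\rangle=\langle\tau'',\tau\tau'\rangle$ for all $\tau,\tau',\tau''\in{}_M\mathcal X_M^0$.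
   Context: Morphisms. For type III von Neumann factors $A,B$, a $B$-$A$ morphism is a unital $*$-homomorphism $\rho:A\to B$; $d_\rho=[B:\rho(A)]^{1/2}$ is its statistical dimension (minimal index). For $B$-$A$ morphisms $\rho,\sigma$ of finite dimension, $\mathrm{Hom}(\rho,\sigma)=\{t\in B: t\rho(a)=\sigma(a)t\ \forall a\in A\}$ and $\langle\rho,\sigma\rangle=\dim\mathrm{Hom}(\rho,\sigma)$. The sector $[\rho]$ is the class of $\rho$ under $\rho\mapsto \mathrm{Ad}(u)\circ\rho$, $u\in B$ unitary; $[\rho]$ is a subsector of $[\sigma]$ if $\mathrm{Hom}(\rho,\sigma)$ contains an isometry. A conjugate of $\rho$ is an $A$-$B$ morphism $\bar\rho$ with isometries $r_\rho\in\mathrm{Hom}(\mathrm{id}_A,\bar\rho\rho)$, $\bar r_\rho\in\mathrm{Hom}(\mathrm{id}_B,\rho\bar\rho)$ such that $\rho(r_\rho)^*\bar r_\rho=d_\rho^{-1}\mathbf 1_B$, $\bar\rho(\bar r_\rho)^*r_\rho=d_\rho^{-1}\mathbf 1_A$. Standing assumption. $N\subset M$ is a type III subfactor and ${}_N\mathcal X_N\subset\mathrm{End}(N)$ a finite system of endomorphisms: irreducible, of finite statistical dimension, pairwise inequivalent, containing $\mathrm{id}$ (label $0$), containing for each $\lambda$ a representative $\bar\lambda$ of the conjugate sector, and closed under fusion, $[\lambda\mu]=\bigoplus_\nu N_{\lambda,\mu}^\nu[\nu]$. $\Sigma({}_N\mathcal X_N)$ is the set of endomorphisms of $N$ whose sectors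 are finite direct sums of sectors of elements of ${}_N\mathcal X_N$. The system is braided (possibly degenerately): there are unitaries $\varepsilon(\lambda,\mu)\in\mathrm{Hom}(\lambda\mu,\mu\lambda)$ with $\varepsilon(\mathrm{id},\mu)=\varepsilon(\lambda,\mathrm{id})=\mathbf 1$ and, for $t\in\mathrm{Hom}(\lambda,\mu\nu)$, $\rho(t)\varepsilon(\lambda,\rho)=\varepsilon(\mu,\rho)\mu(\varepsilon(\nu,\rho))t$ and $t\varepsilon(\rho,\lambda)=\mu(\varepsilon(\rho,\nu))\varepsilon(\rho,\mu)\rho(t)$. It is extended to $\Sigma({}_N\mathcal X_N)$: if $\lambda=\sum_i t_i\lambda_i(\cdot)t_i^*$, $\mu=\sum_j s_j\mu_j(\cdot)s_j^*$ with $t_i,s_j$ isometries, $\sum t_it_i^*=\sum s_js_j^*=\mathbf 1$, $\lambda_i,\mu_j\in{}_N\mathcal X_N$, then $\varepsilon(\lambda,\mu)=\sum_{i,j}s_j\mu_j(t_i)\varepsilon(\lambda_i,\mu_j)\lambda_i(s_j)^*t_i^*$. Put $\varepsilon^+=\varepsilon$, $\varepsilon^-(\lambda,\mu)=\varepsilon(\mu,\lambda)^*$. Let $\iota:N\hookrightarrow M$ be the injection, $\bar\iota$ a conjugate, $\theta=\bar\iota\iota\in\mathrm{End}(N)$; assume $\theta\in\Sigma({}_N\mathcal X_N)$. $\alpha$-induction and coupling matrix. For $\lambda\in\Sigma({}_N\mathcal X_N)$, $\alpha^\pm_\lambda=\bar\iota^{\,-1}\circ\mathrm{Ad}(\varepsilon^\pm(\lambda,\theta))\circ\lambda\circ\bar\iota\in\mathrm{End}(M)$,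 and $Z_{\lambda,\mu}=\langle\alpha^+_\lambda,\alpha^-_\mu\rangle$ for $\lambda,\mu\in{}_N\mathcal X_N$. Chiral systems. ${}_M\mathcal X_M\subset\mathrm{End}(M)$ is a choice of representatives, one for each irreducible subsector of the $[\iota\lambda\bar\iota]$, $\lambda\in{}_N\mathcal X_N$, with $\mathrm{id}_M$ (label $0$) for the trivial sector. ${}_M\mathcal X_M^\pm$ is the subset of those $\beta$ with $[\beta]$ a subsector of $[\alpha^\pm_\lambda]$ for some $\lambda\in{}_N\mathcal X_N$; ${}_M\mathcal X_M^0={}_M\mathcal X_M^+\cap{}_M\mathcal X_M^-$ (ambichiral system). Intermediate subfactors. For $\rho\in{}_N\mathcal X_N$ let $\mathcal K^\pm_\rho=\mathrm{Hom}(\mathrm{id}_M,\alpha^\pm_\rho)\subset M$, and $M_\pm=\sum_\rho N\mathcal K^\pm_\rho$ (finite sums of products); these are intermediate subfactors $N\subset M_\pm\subset M$. Let $\iota_\pm:N\hookrightarrow M_\pm$ be the injections and $\theta_\pm=\bar\iota_\pm\iota_\pm$; $\theta_\pm\in\Sigma({}_N\mathcal X_N)$. For $\delta\in\{+,-\}$, $\tilde\alpha^\pm_{\delta;\lambda}=\bar\iota_\delta^{\,-1}\circ\mathrm{Ad}(\varepsilon^\pm(\lambda,\theta_\delta))\circ\lambda\circ\bar\iota_\delta\in\mathrm{End}(M_\delta)$ and $Z^\delta_{\lambda,\mu}=\langle\tilde\alpha^+_{\delta;\lambda},\tilde\alpha^-_{\delta;\mu}\rangle$. A coupling matrix $(X_{\lambda,\mu})$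 is of type I if $X_{\lambda,\mu}=\sum_\tau b_{\tau,\lambda}b_{\tau,\mu}$ with non-negative integers satisfying $b_{\tau,0}=\delta_{\tau,0}$. Bijections $\vartheta_\pm$. In formulas with several $\pm$, take all upper or all lower signs. Let ${}_{M_\pm}\mathcal X_{M_\pm}^\pm\subset\mathrm{End}(M_\pm)$ be a choice of representatives (including $\mathrm{id}_{M_\pm}$) of the irreducible subsectors of the $[\tilde\alpha^\pm_{\pm;\lambda}]$, $\lambda\in{}_N\mathcal X_N$. For $\beta\in{}_M\mathcal X_M^\pm$, $\vartheta_\pm(\beta)$ is the unique $\tilde\beta\in{}_{M_\pm}\mathcal X_{M_\pm}^\pm$ for which there are $\lambda\in{}_N\mathcal X_N$ and isometries $t\in\mathrm{Hom}(\beta,\alpha^\pm_\lambda)$, $\tilde t\in\mathrm{Hom}(\tilde\beta,\tilde\alpha^\pm_{\pm;\lambda})$ with $tt^*=\tilde t\tilde t^*$. The maps $\vartheta_\pm:{}_M\mathcal X_M^\pm\to{}_{M_\pm}\mathcal X_{M_\pm}^\pm$ are bijections. They restrict to bijections of ${}_M\mathcal X_M^0$ onto ${}_{M_\pm}\mathcal X_{M_\pm}^0$, the subsystem of $\tau$ such that $[\tau]$ is a subsector of both some $[\tilde\alpha^+_{\pm;\lambda}]$ and some $[\tilde\alpha^-_{\pm;\mu}]$, represented by the same endomorphisms for both chiralities; when $M_+=M_-$ the same representatives are used for ${}_{M_+}\mathcal X_{M_+}^0={}_{M_-}\mathcal X_{M_-}^0$. *)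

(* Defs.v *)
From HB Require Import structures.
From mathcomp Require Import all_boot all_order all_algebra.
From mathcomp Require Import sesquilinear complex.
From mathcomp Require Import all_classical all_reals all_analysis.

Set Implicit Arguments.
Unset Strict Implicit.
Unset Printing Implicit Defensive.

Import Order.TTheory GRing.Theory Num.Theory.
Import numFieldNormedType.Exports.

Local Open Scope classical_set_scope.
Local Open Scope ring_scope.

Record hilbert (R : realType) := Hilbert {
  hsort :> completeNormedModType R[i];
  hdot : {dot hsort for Num.conj};
  hnormE : forall x : hsort, `|x| ^+ 2 = hdot x x
}.

Local Notation "''[' u , v ]" := (hdot _ u v) : ring_scope.

Definition bounded_linear (R : realType) (H : hilbert R) (f : H -> H) : Prop :=
  linear f /\ exists2 k, 0 <= k & forall x, `|f x| <= k * `|x|.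

(* B(H). An operator is stored together with its adjoint, which is uniquely
   determined and, H being complete, exists for every bounded f. *)
Record bop (R : realType) (H : hilbert R) := Bop {
  bfun :> H -> H;
  badj : H -> H;
  bfun_bl : bounded_linear bfun;
  badjP : forall x y : H, '[bfun x, y] = '[x, badj y]
}.

Section BopTheory.
Context {R : realType} {H : hilbert R}.
Implicit Types (f g : H -> H) (x y z : H) (S T U : bop H).
Local Notation C := R[i].

Lemma hdotDl x y z : '[x + y, z] = '[x, z] + '[y, z].
Proof. exact: linearDl. Qed.

Lemma hdotZl (c : C) x y : '[c *: x, y] = c * '[x, y].
Proof. exact: linearZl_LR. Qed.

Lemma hdotDr x y z : '[z, x + y] = '[z, x] + '[z, y].
Proof. exact: linearDr. Qed.

Lemma hdotZr (c : C) x y : '[x, c *: y] = c^* * '[x, y].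
Proof. by rewrite linearZr_LR. Qed.

Lemma hdotC x y : '[x, y] = ('[y, x])^*.
Proof. by rewrite (hermC (hdot H)) /= mul1r. Qed.

Lemma hdot_inj x y : (forall z, '[z, x] = '[z, y]) -> x = y.
Proof.
move=> h; apply/eqP; rewrite -subr_eq0 -normr_eq0 -sqrf_eq0 hnormE.
by rewrite hdotDr -scaleN1r hdotZr h rmorphN rmorph1 mulN1r subrr.
Qed.

Lemma bopP S T : bfun S =1 bfun T -> S = T.
Proof.
case: S => f f' fb fP; case: T => g g' gb gP /= /funext eqfg.
subst g; have eqfg' : f' = g'.
  by apply/funext => y; apply: hdot_inj => z; rewrite -fP -gP.
by subst g'; congr Bop; exact: Prop_irrelevance.
Qed.

Lemma bop_linear T : linear T. Proof. by case: (bfun_bl T). Qed.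

Lemma bounded_linear0 : bounded_linear (fun _ : H => 0 : H).
Proof.
split; first by move=> c x y; rewrite scaler0 addr0.
by exists 0 => // x; rewrite normr0 mul0r.
Qed.

Lemma bounded_linear1 : bounded_linear (@id H).
Proof. by split=> //; exists 1 => // x; rewrite mul1r. Qed.

Lemma bounded_linearD f g :
  bounded_linear f -> bounded_linear g -> bounded_linear (fun x => f x + g x).
Proof.
move=> [lf [k k0 fk]] [lg [l l0 gl]]; split.
  by move=> c x y; rewrite lf lg scalerDr addrACA.
exists (k + l) => [|x]; first exact: addr_ge0.
by rewrite mulrDl (le_trans (ler_normD _ _))// lerD.
Qed.

Lemma bounded_linearZ (c : C) f :
  bounded_linear f -> bounded_linear (fun x => c *: f x).
Proof.
move=> [lf [k k0 fk]]; split.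
  by move=> d x y; rewrite lf scalerDr !scalerA mulrC.
exists (`|c| * k) => [|x]; first exact: mulr_ge0.
by rewrite normrZ -mulrA ler_wpM2l.
Qed.

Lemma bounded_linear_comp f g :
  bounded_linear f -> bounded_linear g -> bounded_linear (f \o g).
Proof.
move=> [lf [k k0 fk]] [lg [l l0 gl]]; split.
  by move=> c x y /=; rewrite lg lf.
exists (k * l) => [|x]; first exact: mulr_ge0.
by rewrite -mulrA (le_trans (fk _))// ler_wpM2l.
Qed.

Lemma badj_bl T : bounded_linear (badj T).
Proof.
have aP := badjP T; have [_ [k k0 Tk]] := bfun_bl T; split.
  move=> c x y; apply: hdot_inj => z.
  by rewrite hdotDr hdotZr -!aP hdotDr hdotZr.
pose K := k + 1; have K0 : 0 < K by rewrite ltr_wpDl.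
have TK x : `|T x| <= K * `|x|.
  by rewrite (le_trans (Tk x))// ler_wpM2r// lerDl.
exists K => [|x]; first exact: ltW.
set y := badj T x.
pose c := K ^- 2; have c0 : 0 < c by rewrite invr_gt0 exprn_gt0.
have cN : (- c)^* = - c by apply/CrealP; rewrite rpredN ger0_real// ltW.
rewrite -?yE.
have yE : '[x, T y] = `|y| ^+ 2 by rewrite hdotC aP -/y -hdotC hnormE.
have yE' : '[T y, x] = `|y| ^+ 2 by rewrite aP -/y hnormE.
have : 0 <= `|x + (- c) *: T y| ^+ 2 by exact: exprn_ge0.
rewrite hnormE !(hdotDl, hdotDr, hdotZl, hdotZr) !cN yE yE' -!hnormE.
have Ty : `|T y| ^+ 2 <= K ^+ 2 * `|y| ^+ 2.
  by rewrite -exprMn lerXn2r ?nnegrE// mulr_ge0// ltW.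
have {}Ty : c * (c * `|T y| ^+ 2) <= c * `|y| ^+ 2.
  rewrite ler_wpM2l ?(ltW c0)// (le_trans (ler_wpM2l (ltW c0) Ty))//.
  by rewrite mulrA mulVf ?mul1r// expf_neq0// gt_eqF.
move=> h.
have Kne : K != 0 by rewrite gt_eqF.
suff : `|y| ^+ 2 <= (K * `|x|) ^+ 2.
  by rewrite ler_pXn2r ?nnegrE// mulr_ge0// ltW.
rewrite exprMn -ler_pdivrMl ?exprn_gt0// -/c -subr_ge0.
apply: le_trans h _; rewrite -!addrA lerD2l !mulNr mulrN opprK addrC.
by rewrite -addrA gerDl subr_le0.
Qed.

Lemma badjK T x y : '[badj T x, y] = '[x, T y].
Proof. by rewrite hdotC -badjP -hdotC. Qed.

Definition bop_zero := @Bop R H _ (fun _ => 0) bounded_linear0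
  (fun x y => etrans (linear0l _ _) (esym (linear0r _ _))).

Definition bop_one := @Bop R H id id bounded_linear1 (fun _ _ => erefl).

Definition bop_add S T : bop H.
Proof.
refine (@Bop R H _ (fun y => badj S y + badj T y)
          (bounded_linearD (bfun_bl S) (bfun_bl T)) _).
by move=> x y; rewrite hdotDl hdotDr !badjP.
Defined.

Definition bop_scale (c : C) T : bop H.
Proof.
refine (@Bop R H _ (fun y => c^* *: badj T y)
          (bounded_linearZ c (bfun_bl T)) _).
by move=> x y; rewrite hdotZl hdotZr conjCK badjP.
Defined.

Definition bop_opp T := bop_scale (-1) T.

Definition bop_mul S T : bop H.
Proof.
refine (@Bop R H _ (badj T \o badj S)
          (bounded_linear_comp (bfun_bl S) (bfun_bl T)) _).
by move=> x y /=; rewrite !badjP.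
Defined.

Definition bop_adj T : bop H := Bop (badj_bl T) (badjK T).

HB.instance Definition _ := gen_eqMixin (bop H).
HB.instance Definition _ := gen_choiceMixin (bop H).

Lemma bop_addA : associative bop_add.
Proof. by move=> S T U; apply: bopP => x /=; rewrite addrA. Qed.
Lemma bop_addC : commutative bop_add.
Proof. by move=> S T; apply: bopP => x /=; rewrite addrC. Qed.
Lemma bop_add0 : left_id bop_zero bop_add.
Proof. by move=> S; apply: bopP => x /=; rewrite add0r. Qed.
Lemma bop_addN : left_inverse bop_zero bop_opp bop_add.
Proof. by move=> S; apply: bopP => x /=; rewrite scaleN1r addNr. Qed.

HB.instance Definition _ :=
  GRing.isZmodule.Build (bop H) bop_addA bop_addC bop_add0 bop_addN.

Lemma bop_mulA : associative bop_mul.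
Proof. by move=> S T U; apply: bopP. Qed.
Lemma bop_mul1l : left_id bop_one bop_mul.
Proof. by move=> S; apply: bopP. Qed.
Lemma bop_mul1r : right_id bop_one bop_mul.
Proof. by move=> S; apply: bopP. Qed.
Lemma bop_mulDl : left_distributive bop_mul +%R.
Proof. by move=> S T U; apply: bopP. Qed.
Lemma bop_mulDr : right_distributive bop_mul +%R.
Proof.
move=> S T U; apply: bopP => x /=.
by rewrite -[T x]scale1r bop_linear !scale1r.
Qed.

HB.instance Definition _ := GRing.Zmodule_isPzRing.Build (bop H)
  bop_mulA bop_mul1l bop_mul1r bop_mulDl bop_mulDr.

Lemma bop_scaleA (c d : C) T :
  bop_scale c (bop_scale d T) = bop_scale (c * d) T.
Proof. by apply: bopP => x /=; rewrite scalerA. Qed.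
Lemma bop_scale1 : left_id 1 bop_scale.
Proof. by move=> T; apply: bopP => x /=; rewrite scale1r. Qed.
Lemma bop_scaleDr : right_distributive bop_scale +%R.
Proof. by move=> c S T; apply: bopP => x /=; rewrite scalerDr. Qed.
Lemma bop_scaleDl T : {morph bop_scale^~ T : c d / c + d}.
Proof. by move=> c d; apply: bopP => x /=; rewrite scalerDl. Qed.

HB.instance Definition _ := GRing.Zmodule_isLmodule.Build C (bop H)
  bop_scaleA bop_scale1 bop_scaleDr bop_scaleDl.

End BopTheory.

Notation "T ^†" := (bop_adj T) (at level 1, format "T ^†") : ring_scope.

Section VonNeumann.
Context {R : realType} {H : hilbert R}.
Local Notation C := R[i].
Local Notation B := (bop H).
Implicit Types (A M : set B) (rho sigma : B -> B) (e t u x y : B).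

Definition scalars : set B := [set x | exists c : C, x = c *: (1 : B)].

Definition commutant A : set B := [set x | forall a, A a -> x * a = a * x].

Definition von_neumann A : Prop :=
  (forall x, A x -> A (x^†)) /\ commutant (commutant A) = A.

Definition factor A : Prop :=
  [/\ von_neumann A, (1 : B) <> 0 & A `&` commutant A = scalars].

Definition projection e : Prop := e^† = e /\ e * e = e.

Definition finite_projection A e : Prop :=
  forall v, A v -> v^† * v = e -> e * (v * v^†) = v * v^† -> v * v^† = e.

Definition type_III_factor A : Prop :=
  factor A /\
  forall e, A e -> projection e -> finite_projection A e -> e = 0.

Definition isometry t : Prop := t^† * t = 1.

Definition unitary u : Prop := u^† * u = 1 /\ u * u^† = 1.

(* Maps between operator algebras are functions on all of B(H) whose values
   outside the source algebra are irrelevant. *)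
Definition eq_on A rho sigma : Prop := forall a, A a -> rho a = sigma a.

Record is_morphism A M rho : Prop := IsMorphism {
  morph_in : forall a, A a -> M (rho a);
  morph_add : forall a b, A a -> A b -> rho (a + b) = rho a + rho b;
  morph_scale : forall (c : C) a, A a -> rho (c *: a) = c *: rho a;
  morph_mul : forall a b, A a -> A b -> rho (a * b) = rho a * rho b;
  morph_adj : forall a, A a -> rho (a^†) = (rho a)^†;
  morph_one : rho 1 = 1
}.

Definition hom A M rho sigma : set B :=
  [set t | M t /\ forall a, A a -> t * rho a = sigma a * t].

Definition is_basis n (b : 'I_n -> B) (V : set B) : Prop :=
  V = [set x | exists c : 'I_n -> C, x = \sum_i c i *: b i] /\
  forall c : 'I_n -> C, \sum_i c i *: b i = 0 -> forall i, c i = 0.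

(* The dimension of a subspace, with value 0 for infinite-dimensional ones. *)
Definition dim (V : set B) : nat :=
  xget 0%N [set n | exists b : 'I_n -> B, is_basis b V].

Definition bracket A M rho sigma : nat := dim (hom A M rho sigma).

Definition irreducible A M rho : Prop := hom A M rho rho = scalars.

Definition equivalent A M rho sigma : Prop :=
  exists u, [/\ M u, unitary u & forall a, A a -> sigma a = u * rho a * u^†].

Definition subsector A M rho sigma : Prop :=
  exists2 t, hom A M rho sigma t & isometry t.

Definition positive x : Prop := forall xi : H, 0 <= hdot H (x xi) xi.

Definition op_le x y : Prop := positive (y - x).

Definition is_op_sup A (D : set B) x : Prop :=
  [/\ A x, forall d, D d -> op_le d x
    & forall y, A y -> (forall d, D d -> op_le d y) -> op_le x y].

Definition op_directed (D : set B) : Prop :=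
  D !=set0 /\
  forall d d', D d -> D d' -> exists d'', [/\ D d'', op_le d d'' & op_le d' d''].

Definition normal_map M A (E : B -> B) : Prop :=
  forall (D : set B) x, D `<=` M `&` positive -> op_directed D ->
    is_op_sup M D x -> is_op_sup A (E @` D) (E x).

Record is_cond_exp M A (E : B -> B) : Prop := IsCondExp {
  ce_in : forall x, M x -> A (E x);
  ce_id : forall a, A a -> E a = a;
  ce_add : forall x y, M x -> M y -> E (x + y) = E x + E y;
  ce_scale : forall (c : C) x, M x -> E (c *: x) = c *: E x;
  ce_pos : forall x, M x -> positive (E (x^† * x));
  ce_bimod : forall a b x, A a -> A b -> M x -> E (a * x * b) = a * E x * b;
  ce_normal : normal_map M A E
}.

(* The index of a normal conditional expectation E of an infinite factor M
   onto A is the best constant c in the Pimsner-Popa inequality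
   x^*x <= c E(x^*x); the minimal index [M : A] is its infimum over all E.
   It is finite iff the following set is nonempty. *)
Definition index_bounds M A : set R :=
  [set c | exists2 E, is_cond_exp M A E &
     forall x, M x -> op_le (x^† * x) (real_complex R c *: E (x^† * x))].

Definition minimal_index M A : R := inf (index_bounds M A).

Definition finite_dim A M rho : Prop := index_bounds M (rho @` A) !=set0.

Definition sdim A M rho : R := Num.sqrt (minimal_index M (rho @` A)).

Definition is_conjugate A M rho rhobar : Prop :=
  [/\ finite_dim A M rho, is_morphism M A rhobar
    & exists r rbar : B,
      [/\ hom A A id (rhobar \o rho) r /\ isometry r,
          hom M M id (rho \o rhobar) rbar /\ isometry rbar,
          (rho r)^† * rbar = real_complex R (sdim A M rho)^-1 *: (1 : B)
        & (rhobar rbar)^† * r = real_complex R (sdim A M rho)^-1 *: (1 : B)]].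

End VonNeumann.

Section Systems.
Context {R : realType} {H : hilbert R}.
Local Notation B := (bop H).
Implicit Types (N M : set B) (sigma rho : B -> B).

(* [sigma] = (+)_k [lambda_(nu k)], implemented by the isometries t k. *)
Definition is_direct_sum N (I : finType) (lam : I -> B -> B) sigma
    n (nu : 'I_n -> I) (t : 'I_n -> B) : Prop :=
  [/\ forall k, N (t k) /\ isometry (t k),
      \sum_k t k * (t k)^† = 1
    & forall x, N x -> sigma x = \sum_k t k * lam (nu k) x * (t k)^†].

Definition Sigma N (I : finType) (lam : I -> B -> B) : set (B -> B) :=
  [set sigma | is_morphism N N sigma /\
    exists n (nu : 'I_n -> I) (t : 'I_n -> B), is_direct_sum N lam sigma nu t].

Record is_system N (I : finType) (lam : I -> B -> B) (i0 : I) : Prop :=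
  IsSystem {
  sys_morph : forall i, is_morphism N N (lam i);
  sys_irr : forall i, irreducible N N (lam i);
  sys_dim : forall i, finite_dim N N (lam i);
  sys_inequiv : forall i j, equivalent N N (lam i) (lam j) -> i = j;
  sys_id : eq_on N (lam i0) id;
  sys_conj : forall i, exists j, is_conjugate N N (lam i) (lam j);
  sys_fusion : forall i j, Sigma N lam (lam i \o lam j)
}.

Record is_braiding N (I : finType) (lam : I -> B -> B) (i0 : I)
    (eps : I -> I -> B) : Prop := IsBraiding {
  br_hom : forall i j, hom N N (lam i \o lam j) (lam j \o lam i) (eps i j);
  br_unitary : forall i j, unitary (eps i j);
  br_idl : forall j, eps i0 j = 1;
  br_idr : forall i, eps i i0 = 1;
  br_natl : forall l m n r t, hom N N (lam l) (lam m \o lam n) t ->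
    lam r t * eps l r = eps m r * lam m (eps n r) * t;
  br_natr : forall l m n r t, hom N N (lam l) (lam m \o lam n) t ->
    t * eps r l = lam m (eps r n) * eps r m * lam r t
}.

End Systems.

Record braided_system (R : realType) (H : hilbert R) := BraidedSystem {
  algN : set (bop H);
  NN : finType;
  lam : NN -> bop H -> bop H;
  NN0 : NN;
  eps : NN -> NN -> bop H;
  algN_III : type_III_factor algN;
  lam_system : is_system algN lam NN0;
  eps_braiding : is_braiding algN lam NN0 eps
}.

(* The inclusion iota is the identity on elements, so the function iotabar,
   restricted to N, is also theta = iotabar o iota. *)
Record subfactor (R : realType) (H : hilbert R) (X : braided_system H) :=
  Subfactor {
  alg : set (bop H);
  iotabar : bop H -> bop H;
  alg_III : type_III_factor alg;
  alg_sub : algN X `<=` alg;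
  iotabar_conj : is_conjugate (algN X) alg id iotabar;
  theta_Sigma : Sigma (algN X) (lam (b := X)) iotabar
}.

Record sector_system (R : realType) (H : hilbert R) (M : set (bop H))
    (I : finType) (F : I -> bop H -> bop H) := SectorSystem {
  idx : finType;
  rep : idx -> bop H -> bop H;
  idx0 : idx;
  rep_morph : forall k, is_morphism M M (rep k);
  rep_irr : forall k, irreducible M M (rep k);
  rep_sub : forall k, exists i, subsector M M (rep k) (F i);
  rep_inequiv : forall k l, equivalent M M (rep k) (rep l) -> k = l;
  rep_all : forall rho i, is_morphism M M rho -> irreducible M M rho ->
    subsector M M rho (F i) -> exists k, equivalent M M (rep k) rho;
  rep_id : eq_on M (rep idx0) id
}.

(* Signs are encoded as booleans: true is +, false is -. *)
Section AlphaInduction.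
Context {R : realType} {H : hilbert R} {X : braided_system H}.
Local Notation B := (bop H).
Local Notation N := (algN X).
Local Notation lam := (lam (b := X)).
Implicit Types (S : subfactor X) (s : bool) (sigma rho : B -> B).

(* The extension of the braiding to Sigma(X); the value does not depend on the
   chosen decompositions. *)
Definition braid_ext sigma rho : B :=
  xget 0 [set e | exists n (nu : 'I_n -> NN X) (t : 'I_n -> B)
                         m (mu : 'I_m -> NN X) (s : 'I_m -> B),
    [/\ is_direct_sum N lam sigma nu t, is_direct_sum N lam rho mu s
      & e = \sum_i \sum_j s j * lam (mu j) (t i) * eps (nu i) (mu j) *
                          (lam (nu i) (s j))^† * (t i)^†]].

Definition braid s sigma rho : B :=
  if s then braid_ext sigma rho else (braid_ext rho sigma)^†.

Definition alpha S s rho : B -> B := fun x =>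
  let u := braid s rho (iotabar S) in
  xget 0 [set y | alg S y /\ iotabar S y = u * rho (iotabar S x) * u^†].

Definition coupling S (i j : NN X) : nat :=
  bracket (alg S) (alg S) (alpha S true (lam i)) (alpha S false (lam j)).

Definition type_I (Z : NN X -> NN X -> nat) : Prop :=
  exists (T : finType) (t0 : T) (b : T -> NN X -> nat),
    (forall i j, Z i j = \sum_(t : T) b t i * b t j)%N /\
    forall t, b t (NN0 X) = (t == t0).

(* M_s = sum_rho N K^s_rho. *)
Definition chiral_alg S s : set B :=
  [set x | exists n (i : 'I_n -> NN X) (a k : 'I_n -> B),
    (forall j, N (a j) /\
       hom (alg S) (alg S) id (alpha S s (lam (i j))) (k j)) /\
    x = \sum_j a j * k j].

Definition chiral S (K : finType) (beta : K -> B -> B) s : {set K} :=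
  [set k | `[< exists i,
     subsector (alg S) (alg S) (beta k) (alpha S s (lam i)) >]]%SET.

Definition ambichiral S (K : finType) (beta : K -> B -> B) : {set K} :=
  (chiral S beta true :&: chiral S beta false)%SET.

Definition full_system S :=
  sector_system (alg S) (fun i => lam i \o iotabar S).

Definition chiral_system S s :=
  sector_system (alg S) (fun i => alpha S s (lam i)).

Definition branching S (XM : full_system S) s (k : idx XM) (i : NN X) : nat :=
  bracket (alg S) (alg S) (rep k) (alpha S s (lam i)).

Definition vartheta_rel S (XM : full_system S) S' s (XM' : chiral_system S' s)
    (k : idx XM) (k' : idx XM') : Prop :=
  exists i t t',
    [/\ hom (alg S) (alg S) (rep k) (alpha S s (lam i)) t /\ isometry t,
        hom (alg S') (alg S') (rep k') (alpha S' s (lam i)) t' /\ isometry t'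
      & t * t^† = t' * t'^†].

Definition vartheta S (XM : full_system S) S' s (XM' : chiral_system S' s)
    (k : idx XM) : idx XM' :=
  odflt (idx0 XM') [pick k' | `[< vartheta_rel k k' >]].

(* vartheta_+^-1 o vartheta_-. When the algebras of Sd true and Sd false
   coincide, elements of the two systems over them are identified if they are
   the same endomorphism. *)
Definition omega S (XM : full_system S) (Sd : bool -> subfactor X)
    (XMd : forall s, chiral_system (Sd s) s) (k : idx XM) : idx XM :=
  odflt (idx0 XM) [pick l in chiral S (rep (s := XM)) true |
    `[< eq_on (alg (Sd true)) (rep (vartheta (XMd true) l))
                              (rep (vartheta (XMd false) k)) >]].

(* Meant for alg (Sd true) = alg (Sd false): the two ambichiral systems consist
   of the same endomorphisms. *)
Definition same_ambichiral (Sd : bool -> subfactor X)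
    (XMd : forall s, chiral_system (Sd s) s) : Prop :=
  forall s,
    {in ambichiral (Sd s) (rep (s := XMd s)), forall k,
     exists2 l, l \in ambichiral (Sd (~~ s)) (rep (s := XMd (~~ s))) &
       eq_on (alg (Sd s)) (rep k) (rep l)}.

End AlphaInduction.

(* Main.v *)
(* Every element of M is a sum of products of elements of N and intertwiners in
   Hom(iota, iota lambda_j), on which alpha^s_i acts through multiplication by a
   braiding operator.  Hence the induction for N in M_s is the restriction to M_s
   of the induction for N in M.  The intertwiners in Hom(iota, iota lambda_j) that
   lie in M_s are charged for alpha^s, and satisfy chiral locality; this yields
   Hom_M(alpha^s_i, alpha^s_j) = Hom_{M_s}(alpha^s_i, alpha^s_j).  Moreover
   Hom_{M_s}(alpha^+_i, alpha^-_j) consists of the intertwiners on whose support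
   alpha^+_i and alpha^-_i agree on M_s, and a subsector tau of alpha^s_i is
   ambichiral if and only if they agree on its range: if they do, averaging with the
   isometries of the conjugate equations gives a nonzero intertwiner from tau to some
   alpha^{-s}_j.  Counting matrix units gives Z^s.
   If t t^* = t' t'^* for isometries t in M and t' in M_s, then t'^* t is a unitary
   carrying a sector of M to an extension of a sector of M_s; this transports fusion
   rules along vartheta_s, and when M_+ = M_- it identifies Z and omega. *)

Require Import Defs.
From mathcomp Require Import all_boot all_order all_algebra.
From mathcomp Require Import complex.
From mathcomp Require Import all_classical all_reals all_analysis.
(* [isometry] is also a notion of [sesquilinear]; the one of [Defs] is meant. *)
Require Import Defs.

Set Implicit Arguments.
Unset Strict Implicit.
Unset Printing Implicit Defensive.

Import Order.TTheory GRing.Theory Num.Theory.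
Import numFieldNormedType.Exports.

Local Open Scope classical_set_scope.
Local Open Scope ring_scope.

(** * Bounded operators *)

Section OperatorAlgebra.
Context {R : realType} {H : hilbert R}.
Local Notation C := R[i].
Local Notation B := (bop H).
Implicit Types (S T x y z : B) (c : C).

(** Sectors must be split inside M and inside M_s alike. Intertwiner spaces are finite-dimensional,
    for the coefficients of their elements are intertwiners of N; so minimal projections come from
    polynomials in one self-adjoint element. The isometry of a conjugate equation, compressed by a
    projection, gives an isometry below it, and a Schroeder-Bernstein argument makes the range
    exact. M_s consists of arbitrary finite sums over N and charged intertwiners, so it is not
    immediate that an element of Hom(iota, iota lambda_j) in M_s is itself charged. It is projected
    orthogonally onto the charged intertwiners of label j in its expansion, for the inner product
    given by the expectation; the remainder is 0. The main obstacle is that the averages leading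
    from tau to alpha^{-s} might all vanish. Their squares are governed by a positive operator T, a
    sum over averages of sign -s. Exchanging the two labels of a braiding operator turns its matrix
    entries into products of averages of sign s; so T lies in M_s, where locality applies, and the
    sum of the squares is a nonzero scalar. *)

Lemma bop_apply0 S : S 0 = 0.
Proof.
have /eqP := bop_linear S 1 0 0.
by rewrite !scale1r addr0 -subr_eq0 opprD addNKr oppr_eq0 => /eqP.
Qed.

Lemma bop_scaleAl c S T : c *: S * T = c *: (S * T).
Proof. exact: bopP. Qed.

Lemma bop_scaleAr c S T : S * (c *: T) = c *: (S * T).
Proof.
apply: bopP => u /=; have := bop_linear S c (T u) 0.
by rewrite addr0 bop_apply0 addr0.
Qed.

Lemma adjK : involutive (@bop_adj R H). Proof. by move=> S; apply: bopP. Qed.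

Lemma adj_inj : injective (@bop_adj R H). Proof. exact: inv_inj adjK. Qed.

Lemma adj1 : (1 : B)^† = 1. Proof. exact: bopP. Qed.

Lemma adj0 : (0 : B)^† = 0. Proof. exact: bopP. Qed.

Lemma adjD S T : (S + T)^† = S^† + T^†. Proof. exact: bopP. Qed.

Lemma adjM S T : (S * T)^† = T^† * S^†. Proof. exact: bopP. Qed.

Lemma adjZ c S : (c *: S)^† = c^* *: S^†. Proof. exact: bopP. Qed.

Lemma adjN S : (- S)^† = - S^†.
Proof. by apply: bopP => u /=; rewrite rmorphN1. Qed.

Lemma adjB S T : (S - T)^† = S^† - T^†. Proof. by rewrite adjD adjN. Qed.

Lemma adj_sum (I : Type) (s : seq I) (Q : pred I) (F : I -> B) :
  (\sum_(i <- s | Q i) F i)^† = \sum_(i <- s | Q i) (F i)^†.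
Proof.
by elim/big_rec2: _ => [|i y z _ <-]; rewrite ?adj0 ?adjD.
Qed.

Lemma adjM_dot x (u : H) : hdot H ((x^† * x) u) u = `|x u| ^+ 2.
Proof. by rewrite hnormE /= badjK. Qed.

Lemma sum_adjM_eq0 (I : finType) (Q : pred I) (F : I -> B) :
  \sum_(i | Q i) (F i)^† * F i = 0 -> forall i, Q i -> F i = 0.
Proof.
move=> F0 i Qi; apply: bopP => u /=.
have : \sum_(j | Q j) `|F j u| ^+ 2 = 0.
  transitivity (hdot H ((\sum_(j | Q j) (F j)^† * F j) u) u).
    elim/big_rec2: _ => [|j y1 y2 _ ->] /=; first by rewrite linear0l.
    by rewrite hdotDl adjM_dot.
  by rewrite F0 /= linear0l.
move/psumr_eq0P => /(_ (fun j _ => exprn_ge0 2 (normr_ge0 _)) i Qi)/eqP.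
by rewrite sqrf_eq0 normr_eq0 => /eqP.
Qed.

Lemma adjM_eq0 x : x^† * x = 0 -> x = 0.
Proof.
move=> x0; apply: (@sum_adjM_eq0 unit xpredT (fun=> x) _ tt) => //.
by rewrite (big_pred1 tt)// => -[].
Qed.

Lemma scaler1_inj : (1 : B) <> 0 -> injective (fun c => c *: (1 : B)).
Proof.
move=> one0 c d /= /eqP; rewrite -subr_eq0 -scalerBl => cd.
apply/eqP; rewrite -subr_eq0; apply: contra_notT one0 => cd0.
by rewrite -[1]scale1r -(mulVf cd0) -scalerA (eqP cd) scaler0.
Qed.

Lemma mulrE (a b c z : B) : a * b = c -> z * a * b = z * c.
Proof. by move=> <-; rewrite mulrA. Qed.

(** Evaluation at a vector u with y u nonzero gives c = |y u|^2 / |u|^2 > 0, so y can be divided by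
    the square root of c. *)
Lemma scaled_isometry c y : y^† * y = c *: (1 : B) -> y <> 0 ->
  exists2 d : C, d != 0 & isometry (d *: y).
Proof.
move=> yc y0.
have [u yu] : exists u, y u <> 0.
  by apply/existsNP => h; apply: y0; apply: bopP.
have cE : c * `|u| ^+ 2 = `|y u| ^+ 2.
  by rewrite -adjM_dot yc /= hdotZl hnormE.
have yu0 : 0 < `|y u| ^+ 2 by rewrite exprn_gt0// normr_gt0; apply/eqP.
have c0 : 0 < c.
  rewrite -(@pmulr_lgt0 _ (`|u| ^+ 2)) ?cE//.
  rewrite exprn_gt0// normr_gt0; apply/eqP => u0; apply: yu.
  by rewrite u0 bop_apply0.
exists (sqrtC c)^-1; first by rewrite invr_eq0 sqrtC_eq0 gt_eqF.
rewrite /isometry adjZ bop_scaleAl bop_scaleAr yc !scalerA.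
have -> : ((sqrtC c)^-1)^* = (sqrtC c)^-1.
  by apply/CrealP; rewrite ger0_real// invr_ge0 sqrtC_ge0 ltW.
by rewrite -expr2 exprVn sqrtCK mulVf ?scale1r// gt_eqF.
Qed.

(** Compressing the resolution of 1 by [t l] writes 1 as a sum of positive terms in which the term
    of [l] alone is already 1. *)
Lemma isometry_orth n (t : 'I_n -> B) : (forall k, isometry (t k)) ->
  \sum_k t k * (t k)^† = 1 ->
  forall k l, (t k)^† * t l = if k == l then 1 else 0.
Proof.
move=> ti t1 k l; case: eqVneq => [->|kl]; first exact: ti.
have : \sum_(j | j != l) ((t j)^† * t l)^† * ((t j)^† * t l) = 0.
  have : (t l)^† * (\sum_j t j * (t j)^†) * t l = 1 by rewrite t1 mulr1 ti.
  rewrite mulr_sumr mulr_suml (bigD1 l)//= mulrA ti mul1r ti => /eqP.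
  rewrite -[X in _ == X]addr0 (inj_eq (addrI _)) => /eqP s0.
  by rewrite -[RHS]s0; apply: eq_bigr => j _; rewrite adjM adjK !mulrA.
by move/sum_adjM_eq0 => /(_ k kl).
Qed.

End OperatorAlgebra.

(** * Strong limits and infinite sums of orthogonal projections *)

Section StrongLimit.
Context {R : realType} {H : hilbert R}.
Local Notation C := R[i].
Local Notation B := (bop H).
Implicit Types (S T x y z : B) (c : C) (u w : H).

Lemma bopB_apply T u w : T (u - w) = T u - T w.
Proof.
by have := bop_linear T (-1) w u; rewrite !scaleN1r (addrC (- w)) (addrC (- T w)).
Qed.

Lemma bop_sum_apply (I : Type) (s : seq I) (Q : pred I) (F : I -> B) u :
  (\sum_(i <- s | Q i) F i) u = \sum_(i <- s | Q i) F i u.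
Proof. by elim/big_rec2: _ => [|i a b _ <-]. Qed.

(** Cauchy-Schwarz: [c *: w] is the projection of u on w, and u minus it has a nonnegative squared
    norm. *)
Lemma hdot_ler u w : `|hdot H u w| <= `|u| * `|w|.
Proof.
have [->|w0] := eqVneq w 0; first by rewrite linear0r !normr0 mulr0.
have w2 : 0 < `|w| ^+ 2 by rewrite exprn_gt0// normr_gt0.
have wR : (`|w| ^+ 2)^* = `|w| ^+ 2 by apply/CrealP; rewrite ger0_real// ltW.
set a := hdot H u w; set c := a / `|w| ^+ 2.
have : 0 <= `|u - c *: w| ^+ 2 by exact: exprn_ge0.
rewrite hnormE -scaleNr !(hdotDl, hdotDr, hdotZl, hdotZr) -!hnormE.
rewrite rmorphN (hdotC w u) -/a /=.
rewrite !mulNr !mulrN opprK mulrA -mulrA.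
have -> : c * (c^* * `|w| ^+ 2) = c * a^*.
  by rewrite /c rmorphM fmorphV /= wR mulfVK// gt_eqF.
have -> : c * a^* = `|a| ^+ 2 / `|w| ^+ 2 by rewrite /c mulrAC normCK.
have -> : c^* * a = `|a| ^+ 2 / `|w| ^+ 2.
  by rewrite /c rmorphM fmorphV /= wR mulrC mulrA normCK.
rewrite addNr addr0 subr_ge0 ler_pdivrMr// -exprMn => h.
by rewrite -(@ler_pXn2r _ 2)// ?nnegrE// mulr_ge0.
Qed.

Lemma bop_cvg T (f : nat -> H) u : f @ \oo --> u -> T \o f @ \oo --> T u.
Proof.
move=> fu; have [_ [k k0 Tk]] := bfun_bl T.
apply/cvgrPdist_lt => e e0.
have ek : 0 < e / (k + 1) by rewrite divr_gt0// ltr_wpDl.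
move/cvgrPdist_lt: fu => /(_ _ ek); apply: filterS => n /=.
rewrite ltr_pdivlMr ?ltr_wpDl// -bopB_apply; apply: le_lt_trans.
by rewrite (le_trans (Tk _))// mulrC ler_wpM2l// lerDl.
Qed.

Lemma hdot_cvgl (f : nat -> H) u w :
  f @ \oo --> u -> (fun n => hdot H (f n) w : C^o) @ \oo --> (hdot H u w : C^o).
Proof.
move=> fu; apply/cvgrPdist_lt => e e0.
have ek : 0 < e / (`|w| + 1) by rewrite divr_gt0// ltr_wpDl.
move/cvgrPdist_lt: fu => /(_ _ ek); apply: filterS => n /=.
rewrite ltr_pdivlMr ?ltr_wpDl// => lt_e.
have -> : hdot H u w - hdot H (f n) w = hdot H (u - f n) w.
  by rewrite -[in RHS]scaleN1r hdotDl hdotZl mulN1r.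
rewrite (le_lt_trans (hdot_ler _ _))// (le_lt_trans _ lt_e)//.
by rewrite ler_wpM2l// lerDl.
Qed.

Lemma hdot_cvgr (f : nat -> H) u w :
  f @ \oo --> u -> (fun n => hdot H w (f n) : C^o) @ \oo --> (hdot H w u : C^o).
Proof.
move=> fu; apply/cvgrPdist_lt => e e0.
have /cvgrPdist_lt /(_ _ e0) := @hdot_cvgl f u w fu; apply: filterS => n /=.
by rewrite (hdotC w u) (hdotC w (f n)) -rmorphB/= norm_conjC.
Qed.

(* The terms [(a i)^† * a i] are orthogonal projections, so the squared norms of
   their values at [u] form a convergent series. *)
Lemma orth_series_cvg (a : nat -> B) u :
  (forall i j, i != j -> a i * (a j)^† = 0) ->
  (forall i, a i * (a i)^† * a i = a i) ->
  cvgn (series (fun i => ((a i)^† * a i) u)).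
Proof.
move=> aij aii.
pose P m n := \sum_(m <= i < n) (a i)^† * a i.
have Pa m n i : (m <= i < n)%N -> a i * P m n = a i.
  move=> imn; rewrite /P mulr_sumr (bigD1_seq i) ?mem_index_iota ?iota_uniq//=.
  rewrite mulrA aii big1 ?addr0// => j ji.
  by rewrite mulrA aij ?mul0r// eq_sym.
have PP m n : (P m n)^† * P m n = P m n.
  have -> : (P m n)^† = P m n.
    by rewrite /P adj_sum; apply: eq_bigr => i _; rewrite adjM adjK.
  rewrite {1}/P mulr_suml [RHS]big_nat; rewrite big_nat.
  by apply: eq_bigr => i imn; rewrite -mulrA Pa.
have Pn m n : `|P m n u| ^+ 2 = \sum_(m <= i < n) `|a i u| ^+ 2.
  rewrite -adjM_dot PP /P; elim/big_rec2: _ => [|i x y _ <-] /=.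
    by rewrite linear0l.
  by rewrite hdotDl adjM_dot.
pose c i : R := complex.Re (`|a i u| ^+ 2).
have cE i : (c i)%:C%C = `|a i u| ^+ 2.
  by rewrite /c RRe_real// ger0_real// exprn_ge0.
have Pc m n : `|P m n u| ^+ 2 = (\sum_(m <= i < n) c i)%:C%C.
  by rewrite Pn rmorph_sum; apply: eq_bigr => i _; rewrite -cE.
have c0 i : 0 <= c i by rewrite -lecR cE exprn_ge0.
have Cc : cvgn (series c).
  apply: nondecreasing_is_cvgn.
    apply/nondecreasing_seqP => n; rewrite /series/= big_nat_recr//=.
    by rewrite lerDl.
  exists (complex.Re (`|u| ^+ 2)) => _ [n _ <-].
  rewrite -lecR RRe_real ?ger0_real ?exprn_ge0// -Pc.
  have : 0 <= `|u - P 0%N n u| ^+ 2 by rewrite exprn_ge0.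
  rewrite hnormE -scaleN1r !(hdotDl, hdotDr, hdotZl, hdotZr) -!hnormE.
  rewrite rmorphN1 !mulN1r opprK.
  have e1 : hdot H (P 0%N n u) u = `|P 0%N n u| ^+ 2 by rewrite -adjM_dot PP.
  have -> : hdot H u (P 0%N n u) = `|P 0%N n u| ^+ 2.
    rewrite hdotC e1; apply/CrealP.
    by rewrite ger0_real// exprn_ge0.
  by rewrite e1 addNr addr0 subr_ge0.
apply: cauchy_cvg; apply/cauchy_seriesP => e e0.
have eR : (complex.Re e)%:C%C = e by rewrite RRe_real// gtr0_real.
have e0R : 0 < complex.Re e by rewrite -ltcR eR.
move/cvg_cauchy: Cc => /cauchy_seriesP/(_ _ (exprn_gt0 2 e0R)).
apply: filterS => -[m n] /=.
have -> : \sum_(m <= k < n) (a k)^† (a k u) = P m n u.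
  by rewrite /P bop_sum_apply.
rewrite ger0_norm; last by apply: sumr_ge0.
move=> ltc; rewrite -(@ltr_pXn2r _ 2) ?nnegrE// ?ltW//.
by rewrite Pc -eR -rmorphXn/= ltcR.
Qed.

(** The partial sums are increasing self-adjoint projections; the limit inherits self-adjointness
    and idempotence, which in turn bound it by 1. *)
Lemma orth_series_sum (a : nat -> B) :
  (forall i j, i != j -> a i * (a j)^† = 0) ->
  (forall i, a i * (a i)^† * a i = a i) ->
  exists g : B, projection g /\
    forall u, series (fun i => ((a i)^† * a i) u) @ \oo --> g u.
Proof.
move=> aij aii.
pose p n := \sum_(0 <= i < n) (a i)^† * a i.
have pE u : series (fun i => ((a i)^† * a i) u) = fun n => p n u.
  by apply/funext => n; rewrite /p bop_sum_apply.
pose G u : H := limn (fun n => p n u).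
have Gcvg u : (fun n => p n u) @ \oo --> G u.
  by rewrite -pE /G -pE; exact: orth_series_cvg.
have lG : linear G.
  move=> c u w; apply: (cvg_unique _ (Gcvg _)) => //=.
  under eq_fun do rewrite bop_linear.
  by apply: cvgD => //; apply: cvgZr.
have uniq_lim (f : nat -> H) (u w : H) :
    f @ \oo --> u -> f @ \oo --> w -> u = w.
  exact: (@cvg_unique H (@norm_hausdorff _ H)).
have padj n : (p n)^† = p n.
  by rewrite /p adj_sum; apply: eq_bigr => i _; rewrite adjM adjK.
have pa n w : badj (p n) w = p n w by rewrite -[in RHS]padj.
have GP u w : hdot H (G u) w = hdot H u (G w).
  apply: (@cvg_unique C^o (@norm_hausdorff _ C^o) _ _ _ _ (@hdot_cvgl _ _ w (Gcvg u))).
  rewrite /= (_ : (fun n => _) = fun n => hdot H u (p n w)); last first.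
    by apply/funext => n; rewrite badjP pa.
  exact: hdot_cvgr.
have GG u : G (G u) = G u.
  apply: (cvg_unique _ (Gcvg (G u))) => //=.
  have pG n : p n (G u) = p n u.
    have h := @bop_cvg (p n) _ _ (Gcvg u).
    apply: (uniq_lim _ _ _ h); apply: cvg_near_cst.
    near=> m; have nm : (n <= m)%N by near: m; exact: nbhs_infty_ge.
    change ((p n * p m) u = p n u); congr (bfun _ u).
    rewrite /p mulr_suml [RHS]big_nat [LHS]big_nat.
    apply: eq_bigr => i /andP[_ i_n]; rewrite mulr_sumr.
    rewrite (bigD1_seq i) ?mem_index_iota ?iota_uniq//=; last first.
      exact: leq_trans nm.
    rewrite -mulrA (mulrA (a i)) aii big1 ?addr0// => j ji.
    by rewrite -mulrA (mulrA (a i)) aij ?mul0r ?mulr0// eq_sym.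
  under eq_fun do rewrite pG.
  exact: Gcvg.
have bG : bounded_linear G.
  split=> //; exists 1 => // u; rewrite mul1r.
  rewrite -(@ler_pXn2r _ 2)// ?nnegrE//.
  have : 0 <= `|u - G u| ^+ 2 by rewrite exprn_ge0.
  rewrite hnormE -scaleN1r !(hdotDl, hdotDr, hdotZl, hdotZr) -!hnormE.
  rewrite rmorphN1 !mulN1r opprK.
  have uGu : hdot H u (G u) = `|G u| ^+ 2 by rewrite hnormE GP GG.
  by rewrite GP uGu addNr addr0 subr_ge0.
exists (Bop bG GP); split; last by move=> u; rewrite pE; exact: Gcvg.
by split; apply: bopP => u //=.
Unshelve. all: by end_near. Qed.

End StrongLimit.

(** * Unital star-algebras and isometries with a prescribed range *)

Section StarAlgebra.
Context {R : realType} {H : hilbert R}.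
Local Notation C := R[i].
Local Notation B := (bop H).
Implicit Types (A M N : set B) (x y z e t : B) (c : C).

Record star_algebra A : Prop := StarAlgebra {
  sa_one : A 1;
  sa_add : forall x y, A x -> A y -> A (x + y);
  sa_mul : forall x y, A x -> A y -> A (x * y);
  sa_scale : forall c x, A x -> A (c *: x);
  sa_adj : forall x, A x -> A x^†
}.

Lemma sa_zero A : star_algebra A -> A 0.
Proof. by move=> hA; rewrite -(scale0r (1 : B)); exact: (sa_scale hA 0 (sa_one hA)). Qed.

Lemma sa_opp A x : star_algebra A -> A x -> A (- x).
Proof. by move=> hA Ax; rewrite -scaleN1r; exact: (sa_scale hA (-1) Ax). Qed.

Lemma sa_sum A : star_algebra A -> forall (I : Type) (s : seq I) (Q : pred I)
  (F : I -> B), (forall i, Q i -> A (F i)) -> A (\sum_(i <- s | Q i) F i).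
Proof.
move=> hA I s Q F AF; apply: big_ind => //; first exact: sa_zero.
exact: (sa_add hA).
Qed.

Lemma von_neumann_star A : von_neumann A -> star_algebra A.
Proof.
move=> [Aadj AE]; split=> //; rewrite -AE.
- by move=> a _; rewrite mul1r mulr1.
- by move=> x y Ax Ay a Aa; rewrite mulrDl mulrDr Ax ?Ay.
- by move=> x y Ax Ay a Aa; rewrite -mulrA Ay// !mulrA Ax.
- by move=> c x Ax a Aa; rewrite bop_scaleAl bop_scaleAr Ax.
Qed.

(** Commutation with a fixed operator passes to strong limits, and A is its own bicommutant. *)
Lemma von_neumann_slim A (s : nat -> B) (g : B) : von_neumann A ->
  (forall n, A (s n)) -> (forall u, (fun n => s n u) @ \oo --> g u) -> A g.
Proof.
move=> [_ AE] As sg; rewrite -AE => a Aa; apply: bopP => u /=.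
apply: (@cvg_unique H (@norm_hausdorff _ H) _ _ _ _ (sg (a u))).
have := @bop_cvg _ _ a _ _ (sg u); rewrite /= (_ : a \o _ = fun n => s n (a u))//.
apply/funext => n /=; change ((a * s n) u = (s n * a) u); congr (bfun _ u).
by rewrite Aa.
Qed.

Lemma adjX y n : (y ^+ n)^† = y^† ^+ n.
Proof. by elim: n => [|n IHn]; rewrite ?expr0 ?adj1// exprS exprSr adjM IHn. Qed.

Lemma isometryX y i j : isometry y ->
  y^† ^+ i * y ^+ j = if (i <= j)%N then y ^+ (j - i) else y^† ^+ (i - j).
Proof.
move=> yi; elim: i j => [|i IHi] [|j]; rewrite ?expr0 ?mul1r ?mulr1 ?subn0//.
by rewrite exprSr exprS -mulrA (mulrA y^†) yi mul1r IHi ltnS subSS.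
Qed.

Lemma bopB_fun x y u : (x - y) u = x u - y u.
Proof. by rewrite -[y u]scale1r -scaleNr. Qed.

(* Schroeder-Bernstein: with [f = 1 - e], the projection [g = \sum_n y^n f y^*n]
   commutes with [y] and [y g y^* = g - f], so [t = y g + (1 - g)] works. *)
Lemma isometry_onto A y e : von_neumann A -> A y -> isometry y ->
  A e -> projection e -> e * y = y ->
  exists t, [/\ A t, isometry t & t * t^† = e].
Proof.
move=> vnA Ay yi Ae [eS eI] ey; have hA := von_neumann_star vnA.
pose f : B := 1 - e.
have fy : f * y = 0 by rewrite /f mulrBl mul1r ey subrr.
have fS : f^† = f by rewrite /f adjB adj1 eS.
have yf : y^† * f = 0 by rewrite -fS -adjM fy adj0.
have ff : f * f = f by rewrite /f mulrBl mul1r mulrBr mulr1 eI subrr subr0.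
have Af : A f := sa_add hA (sa_one hA) (sa_opp hA Ae).
pose a i : B := f * y^† ^+ i.
have aS i : (a i)^† = y ^+ i * f by rewrite /a adjM adjX adjK fS.
have aa i : a i * (a i)^† = f.
  rewrite aS /a -mulrA (mulrA _ (y ^+ i)) isometryX// leqnn subnn expr0 mul1r.
  exact: ff.
have aij i j : i != j -> a i * (a j)^† = 0.
  rewrite aS /a -mulrA (mulrA _ (y ^+ j)) isometryX//; case: ltngtP => // ij _.
    by rewrite -[(j - i)%N]prednK ?subn_gt0// exprS !mulrA fy !mul0r.
  by rewrite -[(i - j)%N]prednK ?subn_gt0// exprSr -!mulrA yf !mulr0.
have aii i : a i * (a i)^† * a i = a i by rewrite aa /a mulrA ff.
have [g [[gS gI] sg]] := orth_series_sum aij aii.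
pose s n : B := \sum_(0 <= i < n) (a i)^† * a i.
have sE u : series (fun i => ((a i)^† * a i) u) = fun n => s n u.
  by apply/funext => n; rewrite /s bop_sum_apply.
have {}sg u : (fun n => s n u) @ \oo --> g u by rewrite -sE.
have Aa i : A (a i).
  apply: (sa_mul hA Af); elim: i => [|i]; first exact: sa_one.
  by rewrite exprS; apply: (sa_mul hA (sa_adj hA Ay)).
have Ag : A g.
  apply: (von_neumann_slim vnA _ sg) => n; rewrite /s; apply: (sa_sum hA) => i _.
  exact: (sa_mul hA (sa_adj hA (Aa i)) (Aa i)).
have sS n : s n.+1 = f + y * s n * y^†.
  rewrite /s big_nat_recl//= aS expr0 mul1r /a expr0 mulr1 ff.
  congr (_ + _); rewrite mulr_sumr mulr_suml; apply: eq_bigr => i _.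
  by rewrite !aS exprS exprSr !mulrA.
have ygy : y * g * y^† = g - f.
  apply: bopP => u; rewrite bopB_fun.
  have h := @bop_cvg _ _ y _ _ (sg (y^† u)).
  apply: (@cvg_unique H (@norm_hausdorff _ H) _ _ _ _ h) => {h}.
  have -> : y \o (fun n => s n (y^† u)) = fun n => s n.+1 u - f u.
    by apply/funext => n; rewrite sS /= addrC addKr.
  rewrite mksetE; apply: (@cvgB _ H); last exact: cvg_cst.
  by rewrite (cvg_shiftS (fun n => s n u)).
have yg : y * g = g * y.
  by rewrite -[LHS]mulr1 -yi mulrA ygy mulrBl fy subr0.
have gy : g * y^† = y^† * g.
  by have := congr1 (@bop_adj R H) yg; rewrite !adjM gS.
have g1 : g * (1 - g) = 0 by rewrite mulrBr mulr1 gI subrr.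
have g1' : (1 - g) * g = 0 by rewrite mulrBl mul1r gI subrr.
have g11 : (1 - g) * (1 - g) = 1 - g by rewrite mulrBl mul1r g1 subr0.
have Aq : A (1 - g) := sa_add hA (sa_one hA) (sa_opp hA Ag).
have eE : e = g - f + (1 - g) by rewrite addrC addrA subrK /f opprB addrC subrK.
have q1 : g + (1 - g) = 1 by rewrite addrC subrK.
have qS : (1 - g)^† = 1 - g by rewrite adjB adj1 gS.
move: (1 - g) g1 g1' g11 Aq eE q1 qS => q g1 g1' g11 Aq eE q1 qS.
have tS : (y * g + q)^† = g * y^† + q by rewrite adjD adjM gS qS.
exists (y * g + q); split.
- exact: (sa_add hA (sa_mul hA Ay Ag) Aq).
- rewrite /isometry tS mulrDl !mulrDr.
  rewrite mulrA -(mulrA g) yi mulr1 gI gy -(mulrA _ g) g1 mulr0 addr0.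
  by rewrite yg mulrA g1' mul0r add0r g11.
- rewrite tS mulrDl !mulrDr g11 (mulrA (y * g)) -(mulrA y) gI ygy.
  by rewrite -(mulrA y) g1 mulr0 addr0 mulrA g1' mul0r add0r.
Qed.

End StarAlgebra.

(** * Intertwiners and multiplicities *)

Section Intertwiners.
Context {R : realType} {H : hilbert R}.
Local Notation C := R[i].
Local Notation B := (bop H).
Implicit Types (A M N : set B) (rho sigma tau : B -> B) (x y z e t u : B) (c : C).

Lemma hom_eq_on A M rho rho' sigma sigma' :
  eq_on A rho rho' -> eq_on A sigma sigma' ->
  hom A M rho sigma = hom A M rho' sigma'.
Proof.
move=> er es; apply/seteqP; split=> t [Mt ht]; split=> // a Aa.
  by rewrite -er// -es// ht.
by rewrite er// es// ht.
Qed.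

Lemma eq_on_sym A rho sigma : eq_on A rho sigma -> eq_on A sigma rho.
Proof. by move=> h a Aa; rewrite h. Qed.

Lemma hom_adj A M rho sigma t : star_algebra A -> star_algebra M ->
  is_morphism A M rho -> is_morphism A M sigma ->
  hom A M rho sigma t -> hom A M sigma rho t^†.
Proof.
move=> hA hM mr ms [Mt ht]; split=> [|a Aa]; first exact: sa_adj.
have Aa' := sa_adj hA Aa.
by rewrite -[a]adjK (morph_adj mr)// (morph_adj ms)// -!adjM ht.
Qed.

Lemma hom_mul A M rho sigma tau t u : star_algebra M ->
  hom A M rho sigma t -> hom A M sigma tau u -> hom A M rho tau (u * t).
Proof.
move=> hM [Mt ht] [Mu hu]; split=> [|a Aa]; first exact: sa_mul.
by rewrite -mulrA ht// !mulrA hu.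
Qed.

Lemma hom_scale A M rho sigma c t : star_algebra M ->
  hom A M rho sigma t -> hom A M rho sigma (c *: t).
Proof.
move=> hM [Mt ht]; split=> [|a Aa]; first exact: sa_scale.
by rewrite bop_scaleAl bop_scaleAr ht.
Qed.

Lemma hom_sum A M rho sigma : star_algebra M ->
  forall (I : Type) (s : seq I) (Q : pred I) (F : I -> B),
  (forall i, Q i -> hom A M rho sigma (F i)) ->
  hom A M rho sigma (\sum_(i <- s | Q i) F i).
Proof.
move=> hM I s Q F hF; split=> [|a Aa].
  by apply: (sa_sum hM) => i Qi; have [] := hF i Qi.
rewrite mulr_suml mulr_sumr; apply: eq_bigr => i Qi.
by have [_ ->] := hF i Qi.
Qed.

Lemma hom_one A M rho : star_algebra M -> hom A M rho rho 1.
Proof.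
by move=> hM; split=> [|a Aa]; rewrite ?mul1r ?mulr1//; exact: sa_one.
Qed.

Lemma morphism_sum A M rho : is_morphism A M rho -> star_algebra A ->
  forall (I : Type) (s : seq I) (Q : pred I) (F : I -> B),
  (forall i, Q i -> A (F i)) ->
  rho (\sum_(i <- s | Q i) F i) = \sum_(i <- s | Q i) rho (F i).
Proof.
move=> mr hA I s Q F AF.
suff [] : A (\sum_(i <- s | Q i) F i) /\
  rho (\sum_(i <- s | Q i) F i) = \sum_(i <- s | Q i) rho (F i) by [].
elim/big_rec2: _ => [|i y z Qi [Ay <-]].
  split; first exact: sa_zero.
  by rewrite -(scale0r (1 : B)) (morph_scale mr) ?scale0r//; exact: sa_one.
by split; [apply: (sa_add hA) => //; exact: AF|rewrite (morph_add mr)//; exact: AF].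
Qed.

Lemma morphism_comp A M N rho sigma : is_morphism A M rho ->
  is_morphism M N sigma -> is_morphism A N (sigma \o rho).
Proof.
move=> mr ms; have rM := morph_in mr; split=> //=.
- by move=> a Aa; exact: (morph_in ms (rM _ Aa)).
- by move=> a b Aa Ab; rewrite (morph_add mr)// (morph_add ms)//; exact: rM.
- by move=> c a Aa; rewrite (morph_scale mr)// (morph_scale ms)//; exact: rM.
- by move=> a b Aa Ab; rewrite (morph_mul mr)// (morph_mul ms)//; exact: rM.
- by move=> a Aa; rewrite (morph_adj mr)// (morph_adj ms)//; exact: rM.
- by rewrite (morph_one mr) (morph_one ms).
Qed.

Lemma isometry_compression A M rho w : star_algebra A -> star_algebra M ->
  is_morphism A M rho -> M w -> isometry w ->
  (forall a, A a -> w * w^† * rho a = rho a * (w * w^†)) ->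
  is_morphism A M (fun x => w^† * rho x * w) /\
  hom A M (fun x => w^† * rho x * w) rho w.
Proof.
move=> hA hM mr Mw iw we; have rM := morph_in mr.
have ww a : A a -> w * (w^† * rho a * w) = rho a * w.
  by move=> Aa; rewrite !mulrA we// -!mulrA iw mulr1.
split; last by split.
split.
- by move=> a Aa; apply: (sa_mul hM) => //; apply: (sa_mul hM (sa_adj hM Mw)); exact: rM.
- by move=> a b Aa Ab; rewrite (morph_add mr)// mulrDr mulrDl.
- by move=> c a Aa; rewrite (morph_scale mr)// bop_scaleAr bop_scaleAl.
- move=> a b Aa Ab; rewrite (morph_mul mr)// -[RHS]mulrA ww//.
  by rewrite !mulrA.
- by move=> a Aa; rewrite (morph_adj mr)// !adjM adjK mulrA.
- by rewrite (morph_one mr) mulr1 iw.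
Qed.

Lemma irreducible_hom_scalar A M rho t : irreducible A M rho ->
  hom A M rho rho t -> exists c, t = c *: (1 : B).
Proof. by move=> ir; rewrite ir. Qed.

Lemma irreducible_isometry A M rho sigma t : star_algebra A -> star_algebra M ->
  is_morphism A M rho -> is_morphism A M sigma -> irreducible A M rho ->
  hom A M rho sigma t -> t <> 0 ->
  exists c, [/\ c != 0, hom A M rho sigma (c *: t) & isometry (c *: t)].
Proof.
move=> hA hM mr ms ir ht t0.
have [c tt] := irreducible_hom_scalar ir (hom_mul hM ht (hom_adj hA hM mr ms ht)).
have [d d0 di] := scaled_isometry tt t0.
by exists d; split=> //; exact: hom_scale.
Qed.

Lemma irreducible_equivalent A M rho sigma t :
  star_algebra A -> star_algebra M ->
  is_morphism A M rho -> is_morphism A M sigma ->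
  irreducible A M rho -> irreducible A M sigma ->
  hom A M rho sigma t -> t <> 0 -> equivalent A M rho sigma.
Proof.
move=> hA hM mr ms ir irs ht t0.
have [d [d0 hu iu]] := irreducible_isometry hA hM mr ms ir ht t0.
set u := d *: t in hu iu.
have hu' := hom_adj hA hM mr ms hu.
have [c uuc] := irreducible_hom_scalar irs (hom_mul hM hu' hu).
have uu : u * u^† = 1.
  (* From u = u u^† u = c u, either c = 1 or u = 0. *)
  have cu : u = c *: u by rewrite -[LHS]mulr1 -iu mulrA uuc bop_scaleAl mul1r.
  have [c1|c1] := eqVneq c 1; first by rewrite uuc c1 scale1r.
  suff : u = 0.
    move/eqP; rewrite scaler_eq0 (negPf d0)/= => /eqP /t0 [].
  apply/eqP; have /eqP := cu; rewrite -subr_eq0 -{1}[u]scale1r -scalerBl.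
  by rewrite scaler_eq0 subr_eq0 eq_sym (negPf c1).
exists u; split=> //; first by have [] := hu.
by move=> a Aa; have [_ ->] := hu; rewrite // -mulrA uu mulr1.
Qed.

Lemma equivalent_hom A M rho sigma u : M u -> unitary u ->
  (forall a, A a -> sigma a = u * rho a * u^†) -> hom A M rho sigma u.
Proof.
by move=> Mu [iu _] h; split=> // a Aa; rewrite h// -!mulrA iu mulr1.
Qed.

End Intertwiners.

(** * Dimensions of operator spaces *)

Section Dimension.
Context {R : realType} {H : hilbert R}.
Local Notation C := R[i].
Local Notation B := (bop H).
Implicit Types (V : set B) (a u : B).

(** If n > m, the n by m matrix of coordinates has a nonzero left kernel, that is, a dependence
    among the [b i]. *)
Lemma independent_leq n m (b : 'I_n -> B) (b' : 'I_m -> B) :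
  (forall c : 'I_n -> C, \sum_i c i *: b i = 0 -> forall i, c i = 0) ->
  (forall i, exists c : 'I_m -> C, b i = \sum_j c j *: b' j) -> (n <= m)%N.
Proof.
move=> ind /choice[c bc]; rewrite leqNgt; apply/negP => mn.
pose A : 'M[C]_(n, m) := \matrix_(i, j) c i j.
have /negP[] : kermx A != 0.
  by rewrite -mxrank_eq0 mxrank_ker subn_eq0 -ltnNge (leq_ltn_trans _ mn)// rank_leq_col.
apply/eqP/row_matrixP => i; rewrite row0; apply/rowP => j.
rewrite [RHS]mxE [LHS]mxE; apply: (ind (fun j => kermx A i j)).
under eq_bigr do rewrite bc scaler_sumr.
rewrite exchange_big big1//= => k _.
under eq_bigr do rewrite scalerA.
have Ac : \sum_l kermx A i l * c l k = 0.
  have /matrixP/(_ i k) := mulmx_ker A; rewrite [RHS]mxE mxE => h.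
  rewrite -[RHS]h; by apply: eq_bigr => l _; rewrite [A l k]mxE.
by rewrite -scaler_suml Ac scale0r.
Qed.

Lemma basis_span n (b : 'I_n -> B) V i : is_basis b V -> V (b i).
Proof.
move=> [-> _]; exists (fun j => (j == i)%:R); rewrite (bigD1 i)//= eqxx scale1r.
by rewrite big1 ?addr0// => j /negPf ->; rewrite scale0r.
Qed.

Lemma dimE n (b : 'I_n -> B) V : is_basis b V -> dim V = n.
Proof.
move=> bV; rewrite /dim; case: xgetP => [m _ [b' b'V]|]; last first.
  by move/(_ n); case; exists b.
have le p q (d : 'I_p -> B) (d' : 'I_q -> B) : is_basis d V -> is_basis d' V -> (p <= q)%N.
  move=> dV d'V; apply: (@independent_leq _ _ d d'); first by case: dV.
  by move=> i; have := basis_span i dV; case: d'V => ->.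
by apply/eqP; rewrite eqn_leq (le _ _ _ _ b'V bV) (le _ _ _ _ bV b'V).
Qed.

Lemma dim_fin (I : finType) (Q : pred I) (b : I -> B) V :
  V = [set x | exists c : I -> C, x = \sum_(i | Q i) c i *: b i] ->
  (forall c : I -> C, \sum_(i | Q i) c i *: b i = 0 ->
     forall i, Q i -> c i = 0) ->
  dim V = #|Q|.
Proof.
move=> VE ind.
pose ev (k : 'I_#|Q|) : I := enum_val k.
pose ext (c : 'I_#|Q| -> C) (i : I) : C := \sum_(k | ev k == i) c k.
have extE c k : ext c (ev k) = c k.
  by rewrite /ext (big_pred1 k)// => l; rewrite (inj_eq enum_val_inj).
have sE (F : I -> B) : \sum_(i | Q i) F i = \sum_k F (ev k).
  exact: (big_enum_val F).
apply: (@dimE _ (fun k => b (ev k))); split.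
  rewrite VE; apply/seteqP; split=> x [c ->].
    by exists (fun k => c (ev k)); rewrite sE.
  by exists (ext c); rewrite sE; apply: eq_bigr => k _; rewrite extE.
move=> c c0 k; rewrite -extE; apply: ind; last exact: enum_valP.
by rewrite sE -[RHS]c0; apply: eq_bigr => l _; rewrite extE.
Qed.

(** Bases correspond, so the two sets of admissible lengths are equal; this includes the value 0
    given to infinite dimension. *)
Lemma dim_unitary_mul a u V V' : unitary a -> unitary u ->
  (forall x, V x <-> V' (a * x * u)) -> dim V = dim V'.
Proof.
move=> [a1 a2] [u1 u2] VV'.
have inv x : a^† * (a * x * u) * u^† = x.
  by rewrite !mulrA a1 mul1r -mulrA u2 mulr1.
have inv' x : a * (a^† * x * u^†) * u = x.
  by rewrite !mulrA a2 mul1r -mulrA u1 mulr1.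
have sumE n (c : 'I_n -> C) (b : 'I_n -> B) y z :
    \sum_i c i *: (y * b i * z) = y * (\sum_i c i *: b i) * z.
  rewrite mulr_sumr mulr_suml; apply: eq_bigr => i _.
  by rewrite bop_scaleAr bop_scaleAl.
congr (xget _ _); apply/seteqP; split=> n [b [VE ind]].
  exists (fun i => a * b i * u); split.
    apply/seteqP; split=> x.
      rewrite -{1}(inv' x) => /VV'; rewrite VE => -[c xc].
      by exists c; rewrite sumE -xc inv'.
    by move=> [c ->]; rewrite sumE; apply/VV'; rewrite VE; exists c.
  by move=> c; rewrite sumE => h; apply: ind; rewrite -[LHS]inv h mulr0 mul0r.
exists (fun i => a^† * b i * u^†); split.
  apply/seteqP; split=> x.
    by move=> /VV'; rewrite VE => -[c xc]; exists c; rewrite sumE -xc inv.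
  by move=> [c ->]; rewrite sumE; apply/VV'; rewrite inv' VE; exists c.
by move=> c; rewrite sumE => h; apply: ind; rewrite -[LHS]inv' h mulr0 mul0r.
Qed.

End Dimension.

Section Multiplicity.
Context {R : realType} {H : hilbert R}.
Local Notation C := R[i].
Local Notation B := (bop H).
Variables (M : set B) (hM : star_algebra M) (M1 : (1 : B) <> 0).
Variables (K : finType) (tau : K -> B -> B).
Hypotheses (tauM : forall k, is_morphism M M (tau k))
  (tau_irr : forall k, irreducible M M (tau k))
  (tau_inequiv : forall k l, equivalent M M (tau k) (tau l) -> k = l).

Definition decomposition (sigma : B -> B) n (nu : 'I_n -> K) (w : 'I_n -> B) : Prop :=
  [/\ forall p, hom M M (tau (nu p)) sigma (w p),
      forall p q, (w p)^† * w q = if p == q then 1 else 0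
    & \sum_p w p * (w p)^† = 1].

Lemma tau_hom k l t : hom M M (tau k) (tau l) t ->
  exists c : C, t = (if k == l then c else 0) *: (1 : B).
Proof.
move=> ht; case: eqVneq => [kl|kl].
  by move: ht; rewrite kl; exact: irreducible_hom_scalar.
exists 0; rewrite scale0r; apply: contrapT => t0; case/eqP: kl.
exact/tau_inequiv/(irreducible_equivalent hM hM (tauM k) (tauM l) _ _ ht).
Qed.

(** By Schur's lemma the matrix units [w' q * (w p)^†] with equal labels form a basis. The set D
    keeps only some labels: taken as the ambichiral ones, it counts the coupling matrices both of M
    and of M_s. *)
Lemma dim_decomposition sigma sigma' n nu w m nu' w' (D : {set K}) :
  is_morphism M M sigma -> is_morphism M M sigma' ->
  @decomposition sigma n nu w -> @decomposition sigma' m nu' w' ->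
  dim [set t | hom M M sigma sigma' t /\
         forall p q, nu p \notin D -> (w' q)^† * t * w p = 0] =
  (\sum_(k in D) #|[set p | nu p == k]%SET| * #|[set q | nu' q == k]%SET|)%N.
Proof.
move=> ms ms' [wh wo w1] [wh' wo' w1'].
pose Q (x : 'I_n * 'I_m) := (nu x.1 == nu' x.2) && (nu x.1 \in D).
have coord (c : 'I_n * 'I_m -> C) p q : Q (p, q) ->
    (w' q)^† * (\sum_(x | Q x) c x *: (w' x.2 * (w x.1)^†)) * w p = c (p, q) *: (1 : B).
  move=> Qpq; rewrite mulr_sumr mulr_suml (bigD1 (p, q))//=.
  rewrite bop_scaleAr bop_scaleAl !mulrA wo' eqxx mul1r wo eqxx.
  rewrite big1 ?addr0// => -[p' q'] /andP[_]; rewrite xpair_eqE negb_and /= => pq.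
  rewrite bop_scaleAr bop_scaleAl !mulrA wo' -mulrA wo.
  by case: eqVneq pq => [_|]; case: eqVneq => // _ _; rewrite ?mulr0 ?mul0r scaler0.
rewrite (@dim_fin _ _ _ Q (fun x => w' x.2 * (w x.1)^†)); first last.
- move=> c c0 [p q] Qpq; apply: (scaler1_inj M1).
  by rewrite -coord// c0 mulr0 mul0r scale0r.
- apply/seteqP; split=> t.
    move=> [ht tD].
    have /choice[c cE] (x : 'I_n * 'I_m) :
        exists c : C, (w' x.2)^† * t * w x.1 = (if nu x.1 == nu' x.2 then c else 0) *: (1 : B).
      apply: tau_hom; apply: (hom_mul hM (wh _)); apply: (hom_mul hM ht).
      exact: hom_adj.
    exists c; transitivity ((\sum_q w' q * (w' q)^†) * t * (\sum_p w p * (w p)^†)).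
      by rewrite w1 w1' mul1r mulr1.
    rewrite mulr_suml mulr_suml.
    transitivity (\sum_(x : 'I_n * 'I_m)
        w' x.2 * (w' x.2)^† * t * (w x.1 * (w x.1)^†)).
      under eq_bigr do rewrite mulr_sumr.
      by rewrite exchange_big pair_big.
    rewrite [RHS]big_mkcond; apply: eq_bigr => -[p q] _ /=.
    have := cE (p, q); rewrite /Q /= => cpq.
    rewrite (_ : _ * _ = w' q * ((w' q)^† * t * w p) * (w p)^†); last first.
      by rewrite !mulrA.
    case: ifPn => [/andP[/eqP e D']|].
      by rewrite cpq e eqxx bop_scaleAr bop_scaleAl mulr1.
    rewrite negb_and => /orP[/negPf e|/tD ->]; last by rewrite mulr0 mul0r.
    by rewrite cpq e scale0r mulr0 mul0r.
  move=> [c ->]; split.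
    apply: (hom_sum hM) => -[p q] /andP[/= /eqP e _]; apply: hom_scale => //.
    apply: (hom_mul hM) (wh' q); rewrite -e; exact: hom_adj.
  move=> p q pD; rewrite mulr_sumr mulr_suml big1// => -[p' q'] /andP[/= _ p'D].
  rewrite bop_scaleAr bop_scaleAl -!mulrA wo; case: eqVneq p'D => [->|_ _].
    by rewrite (negPf pD).
  by rewrite !mulr0 scaler0.
- rewrite -sum1_card; under eq_bigl do rewrite unfold_in /= /Q.
  rewrite -(pair_big_dep xpredT (fun p q => (nu p == nu' q) && (nu p \in D))
     (fun _ _ => 1%N))/=.
  rewrite (partition_big nu xpredT)//= [RHS]big_mkcond; apply: eq_bigr => k _.
  case: ifPn => [kD|kD].
    rewrite -sum1_card big_distrl/=.
    apply: eq_big => [p|p /eqP e]; first by rewrite inE.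
    by rewrite mul1n -sum1_card; apply: eq_bigl => q; rewrite inE e kD andbT eq_sym.
  by rewrite big1// => p /eqP e; rewrite big1// => q; rewrite e (negPf kD) andbF.
Qed.

Lemma decomposition_irr k : @decomposition (tau k) 1 (fun=> k) (fun=> 1).
Proof.
split=> [p|p q|]; first exact: hom_one.
  by rewrite !ord1 eqxx adj1 mul1r.
by rewrite big_ord1 adj1 mul1r.
Qed.

Lemma card_ord1 (b : bool) : #|[set p : 'I_1 | b]%SET| = b.
Proof.
rewrite -sum1_card (eq_bigl (fun=> b)) => [|p]; last by rewrite inE.
by case: b; rewrite ?big_ord1 ?big_pred0.
Qed.

Lemma bracket_decomposition sigma n nu w k : is_morphism M M sigma ->
  @decomposition sigma n nu w ->
  bracket M M (tau k) sigma = #|[set p | nu p == k]%SET|.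
Proof.
move=> ms ds; have dk := decomposition_irr k.
rewrite /bracket; transitivity (dim [set t | hom M M (tau k) sigma t /\
    forall (p : 'I_1) q, k \notin [set: K]%SET -> (w q)^† * t * 1 = 0]).
  congr dim; apply/seteqP; split=> t; last by case.
  by split=> // p q; rewrite inE.
rewrite (dim_decomposition _ (tauM k) ms dk ds) (bigD1 k)//= card_ord1 eqxx mul1n.
rewrite big1 ?addn0// => l /andP[_ lk].
by rewrite card_ord1 eq_sym (negPf lk) mul0n.
Qed.

End Multiplicity.

(** * Minimal projections of finite-dimensional star-algebras *)

Section MinimalProjections.
Context {R : realType} {H : hilbert R}.
Local Notation C := R[i].
Local Notation B := (bop H).
Implicit Types (A : set B) (x y z e f h : B) (c a : C).

(** The [b j] may lie outside V, so every subset of a spanned set is spanned. *)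
Definition spanned m (b : 'I_m -> B) (V : set B) : Prop :=
  forall x, V x -> exists c : 'I_m -> C, x = \sum_j c j *: b j.

Lemma projection_orth n (e : 'I_n -> B) : (forall k, projection (e k)) ->
  \sum_k e k = 1 -> forall k l, k != l -> e k * e l = 0.
Proof.
move=> pe e1 k l kl.
have : \sum_(j | j != l) (e j * e l)^† * (e j * e l) = 0.
  have : e l * (\sum_j e j) * e l = e l by rewrite e1 mulr1 (proj2 (pe l)).
  rewrite mulr_sumr mulr_suml (bigD1 l)//= !(proj2 (pe l)) => /eqP.
  rewrite -[X in _ == X]addr0 (inj_eq (addrI _)) => /eqP s0.
  rewrite -[RHS]s0; apply: eq_bigr => j _.
  by rewrite adjM !(proj1 (pe _)) !mulrA (mulrE _ (proj2 (pe j))).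
by move/sum_adjM_eq0 => /(_ k kl).
Qed.

Section SpectralProjection.
Variables (e h : B) (e0 : e <> 0) (eP : projection e) (hS : h^† = h)
  (eh : e * h = h).
Implicit Types (p q : {poly C}).

(** The value of p at h in the corner of e, whose unit is e. *)
Let ev p : B := \sum_(i < size p) p`_i *: (e * h ^+ i).

Let evw p n : (size p <= n)%N -> ev p = \sum_(i < n) p`_i *: (e * h ^+ i).
Proof.
move=> pn; rewrite /ev (big_ord_widen n (fun i => p`_i *: (e * h ^+ i)) pn).
rewrite big_mkcond; apply: eq_bigr => i _; case: ltnP => // ip.
by rewrite nth_default// scale0r.
Qed.

Let evD p q : ev (p + q) = ev p + ev q.
Proof.
have [pn qn] := (leq_maxl (size p) (size q), leq_maxr (size p) (size q)).
rewrite (evw pn) (evw qn) (evw (size_polyD p q)) -big_split/=.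
by apply: eq_bigr => i _; rewrite coefD scalerDl.
Qed.

Let evC c : ev c%:P = c *: e.
Proof.
by rewrite (evw (size_polyC_leq1 c)) big_ord1 coefC expr0 mulr1.
Qed.

Let evMX p : ev (p * 'X) = h * ev p.
Proof.
have s1 : (size (p * 'X)%R <= (size p).+1)%N.
  by rewrite (leq_trans (size_polyMleq _ _))// size_polyX addn2.
rewrite (evw s1) big_ord_recl coefMX scale0r add0r mulr_sumr.
apply: eq_bigr => i _; rewrite coefMX/= bop_scaleAr exprS; congr (_ *: _).
by rewrite !mulrA eh -{1}[h]adjK hS -{1}eh adjM hS (proj1 eP).
Qed.

Let evZ c p : ev (c%:P * p) = c *: ev p.
Proof.
rewrite mul_polyC (evw (size_scale_leq c p)) scaler_sumr.
by apply: eq_bigr => i _; rewrite coefZ scalerA.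
Qed.

Let eev p : e * ev p = ev p.
Proof.
rewrite mulr_sumr; apply: eq_bigr => i _.
by rewrite bop_scaleAr mulrA (proj2 eP).
Qed.

(** The powers of h are dependent. For an annihilating polynomial p = q (X - a) of least degree, x =
    q(h) is nonzero and h x = a x. Hence y = x^† x is a multiple of x, so y y is a nonzero multiple
    of y, and y can be scaled to a projection. Were that projection e, h would be a e. *)
Lemma spectral_projection A m (b : 'I_m -> B) : star_algebra A -> A e -> A h ->
  spanned b A -> (forall c, h <> c *: e) ->
  exists f, [/\ A f, projection f, f <> 0, f <> e & e * f = f].
Proof.
move=> hA Ae Ah bA hc.
have he : h * e = h by rewrite -{1}hS -(proj1 eP) -adjM eh.
have Apw i : A (e * h ^+ i).
  apply: (sa_mul hA Ae); elim: i => [|i]; first exact: sa_one.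
  by rewrite exprS; exact: (sa_mul hA).
have Aev p : A (ev p).
  by apply: (sa_sum hA) => i _; exact: (sa_scale hA).
have [p0 p00 evp0] : exists2 p, p != 0 & ev p = 0.
  apply: contrapT => nex.
  suff : (m.+1 <= m)%N by rewrite ltnn.
  apply: (@independent_leq _ _ _ _ (fun i : 'I_m.+1 => e * h ^+ i) b).
    move=> c c0 i; apply: contrapT => /eqP ci.
    apply: nex; exists (\poly_(j < m.+1) c (inord j)).
      apply/eqP => /polyP/(_ i); rewrite coef_poly ltn_ord inord_val coef0.
      exact/eqP.
    rewrite (evw (size_poly _ _)) -[RHS]c0; apply: eq_bigr => j _.
    by rewrite coef_poly ltn_ord inord_val.
  by move=> i; apply: bA.
pose ann k := `[< exists p, [/\ p != 0, ev p = 0 & size p = k] >].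
have exk : exists k, ann k by exists (size p0); apply/asboolP; exists p0.
case: (ex_minnP exk) => k /asboolP[p [pn0 evp pk]] kmin.
have p1 : size p != 1%N.
  apply/negP => /size_poly1P[c c0 pc]; move: evp; rewrite pc evC => /eqP.
  by rewrite scaler_eq0 (negPf c0)/= => /eqP.
have [a /factor_theorem[q pq]] := closed_rootP _ p1.
have qn0 : q != 0 by apply: contraNneq pn0 => q0; rewrite pq q0 mul0r.
pose x := ev q.
have x0 : x <> 0.
  move=> evq; suff : (k <= size q)%N.
    rewrite -pk pq size_mul ?polyXsubC_eq0// size_XsubC addn2/= ltnn//.
  by apply: kmin; apply/asboolP; exists q.
have hx : h * x = a *: x.
  apply/eqP; rewrite -subr_eq0 -evMX -scaleNr -evZ -evD polyCN mulNr.
  by rewrite (mulrC _ q) -mulrBr -pq evp.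
have evx p' : ev p' * x = p'.[a] *: x.
  elim/poly_ind: p' => [|p' c IH].
    by rewrite horner0 scale0r /ev size_poly0 big_ord0 mul0r.
  rewrite evD mulrDl evMX evC -mulrA IH bop_scaleAr hx bop_scaleAl eev.
  by rewrite hornerMXaddC scalerDl scalerA.
have evS p' : (ev p')^† = ev (map_poly Num.conj p').
  rewrite adj_sum (evw (leq_trans (size_poly _ _) (leqnn _))).
  apply: eq_bigr => i _; rewrite adjZ adjM adjX hS (proj1 eP) coef_map/=.
  congr (_ *: _); case: (nat_of_ord i) => [|j]; first by rewrite expr0 mul1r mulr1.
  by rewrite {1}exprSr -mulrA he -exprSr exprS mulrA eh.
pose y := x^† * x; set b' := (map_poly Num.conj q).[a].
have yx : y = b' *: x by rewrite /y /x evS evx.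
have yS : y^† = y by rewrite /y adjM adjK.
have y0 : y <> 0 by move/adjM_eq0.
pose s := b' * q.[a].
have yy : y * y = s *: y.
  by rewrite {1 2}yx bop_scaleAl bop_scaleAr evx !scalerA /s yx scalerA mulrAC.
have s0 : s != 0.
  apply: contra_notN y0 => /eqP s0; apply: adjM_eq0.
  by rewrite yS yy s0 scale0r.
have sS : s^* = s.
  have /eqP := congr1 (@bop_adj R H) yy; rewrite adjM adjZ yS yy -subr_eq0.
  rewrite -scalerBl scaler_eq0 subr_eq0 eq_sym => /orP[/eqP//|/eqP /y0 //].
have hy : h * y = a *: y by rewrite yx bop_scaleAr hx !scalerA mulrC.
exists (s^-1 *: y); split.
- exact: (sa_scale hA _ (sa_mul hA (sa_adj hA (Aev q)) (Aev q))).
- split; first by rewrite adjZ fmorphV/= sS yS.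
  by rewrite bop_scaleAl bop_scaleAr yy !scalerA -mulrA mulVf ?mulr1.
- by move/eqP; rewrite scaler_eq0 invr_eq0 (negPf s0)/= => /eqP.
- move=> ye; apply: (hc a).
  by rewrite -[LHS]he -{1}ye bop_scaleAr hy scalerA mulrC -scalerA ye.
- by rewrite bop_scaleAr yx bop_scaleAr eev.
Qed.

End SpectralProjection.

(** If the real and imaginary parts of z = e x e were both multiples of e, so would z be; the part
    that is not has a proper spectral projection. *)
Lemma proper_projection A m (b : 'I_m -> B) e x :
  star_algebra A -> spanned b A -> A e -> projection e -> e <> 0 -> A x ->
  (forall c, e * x * e <> c *: e) ->
  exists f, [/\ A f, projection f, f <> 0, f <> e & e * f = f].
Proof.
move=> hA bA Ae eP e0 Ax hx.
pose z := e * x * e.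
have Az : A z := sa_mul hA (sa_mul hA Ae Ax) Ae.
have ez : e * z = z by rewrite /z !mulrA (proj2 eP).
have ezS : e * z^† = z^†.
  by rewrite /z !adjM (proj1 eP) !mulrA (proj2 eP).
have [[c cE]|nre] := pselect (exists c, z + z^† = c *: e); last first.
  apply: (@spectral_projection e (z + z^†) e0 eP _ _ A m b) => //.
  - by rewrite adjD adjK addrC.
  - by rewrite mulrDr ez ezS.
  - exact: (sa_add hA Az (sa_adj hA Az)).
  - by move=> c zc; apply: nre; exists c.
apply: (@spectral_projection _ ('i *: (z - z^†)) e0 eP _ _ A m b) => //.
- by rewrite adjZ adjB adjK conjCi scaleNr -scalerN opprB.
- by rewrite bop_scaleAr mulrBr ez ezS.
- exact: (sa_scale hA _ (sa_add hA Az (sa_opp hA (sa_adj hA Az)))).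
- move=> c' iz; apply: (hx ((c - 'i * c') / 2)).
  have {iz} : z - z^† = (- 'i * c') *: e.
    rewrite -scalerA -iz scalerA mulNr -expr2 sqrCi opprK scale1r//.
  move=> iz; rewrite mulrC -scalerA scalerBl -cE -scaleNr -mulNr -iz.
  have zz : z + z = (2 : C) *: z by rewrite -[2]/(1 + 1) scalerDl !scale1r.
  by rewrite addrACA subrr addr0 zz scalerA mulVf ?scale1r// pnatr_eq0.
Qed.

(** Nonzero projections with sum 1 are orthogonal, hence independent, so at most m in number. In a
    longest such family every corner is scalar, since otherwise one member could be split. *)
Lemma minimal_projections A m (b : 'I_m -> B) : (1 : B) <> 0 ->
  star_algebra A -> spanned b A ->
  exists n (e : 'I_n -> B),
    [/\ forall p, [/\ A (e p), projection (e p) & e p <> 0],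
        \sum_p e p = 1
      & forall p x, A x -> exists c, e p * x * e p = c *: e p].
Proof.
move=> one0 hA bA.
pose P n := `[< exists e : 'I_n -> B,
  (forall p, [/\ A (e p), projection (e p) & e p <> 0]) /\ \sum_p e p = 1 >].
have exP : exists n, P n.
  exists 1%N; apply/asboolP; exists (fun=> 1); rewrite big_ord1; split=> // p.
  by split=> //; [exact: sa_one|split; rewrite ?adj1 ?mulr1].
have leP n : P n -> (n <= m)%N.
  move=> /asboolP[e [eA e1]]; apply: (@independent_leq _ _ _ _ e b).
    have eo := projection_orth (fun p => let: And3 _ h _ := eA p in h) e1.
    move=> c c0 q; have : e q * (\sum_i c i *: e i) = 0 by rewrite c0 mulr0.
    rewrite mulr_sumr (bigD1 q)//= big1 => [|p pq]; last first.
      by rewrite bop_scaleAr eo ?scaler0// eq_sym.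
    have [_ [_ ee] e0] := eA q.
    by rewrite addr0 bop_scaleAr ee => /eqP; rewrite scaler_eq0 => /orP[/eqP//|/eqP].
  by move=> p; apply: bA; have [] := eA p.
case: (ex_maxnP exP leP) => n /asboolP[e [eA e1]] nmax.
exists n, e; split=> // p x Ax; apply: contrapT => hx.
have [Ae eP e0] := eA p.
have [f [Af fP f0 fe ef]] : exists f,
    [/\ A f, projection f, f <> 0, f <> e p & e p * f = f].
  by apply: (proper_projection hA bA Ae eP e0 Ax) => c cE; apply: hx; exists c.
have fe' : f * e p = f by rewrite -{1}(proj1 fP) -(proj1 eP) -adjM ef (proj1 fP).
suff : P n.+1 by move/nmax; rewrite ltnn.
(* The new index [ord0] receives f, and [e p] shrinks to [e p - f]. *)
apply/asboolP; exists (fun i => if unlift ord0 i is Some j then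
  if j == p then e p - f else e j else f); split=> [i|].
  case: unliftP => [j _|//]; case: eqVneq => // _; split.
  - exact: (sa_add hA Ae (sa_opp hA Af)).
  - split; first by rewrite adjB (proj1 eP) (proj1 fP).
    rewrite mulrBl !mulrBr (proj2 eP) (proj2 fP) ef fe'.
    by rewrite subrr subr0.
  - by move/eqP; rewrite subr_eq0 => /eqP /esym.
rewrite big_ord_recl unlift_none (bigD1 p)//= liftK eqxx addrA addrCA subrr addr0.
rewrite -[RHS]e1 [RHS](bigD1 p)//=; congr (_ + _); apply: eq_bigr => j /negPf jp.
by rewrite liftK jp.
Qed.

End MinimalProjections.

(** * Braidings *)

Section BraidedSystem.
Context {R : realType} {H : hilbert R} {X : braided_system H}.
Local Notation C := R[i].
Local Notation B := (bop H).
Local Notation N := (algN X).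
Local Notation lam := (lam (b := X)).
Local Notation i0 := (NN0 X).
Implicit Types (i j : NN X) (s : bool) (x y : B).

Lemma type_III_vn (A : set B) : type_III_factor A -> von_neumann A.
Proof. by case=> -[]. Qed.

Lemma type_III_star (A : set B) : type_III_factor A -> star_algebra A.
Proof. by move/type_III_vn/von_neumann_star. Qed.

Lemma algN_star : star_algebra N.
Proof. exact/type_III_star/algN_III. Qed.

Lemma bop_one_neq0 : (1 : B) <> 0.
Proof. by case: (algN_III X) => -[]. Qed.

Lemma lam_morph i : is_morphism N N (lam i).
Proof. exact: (sys_morph (lam_system X)). Qed.

Lemma lam_in i x : N x -> N (lam i x).
Proof. exact: (morph_in (lam_morph i)). Qed.

Lemma lam0 x : N x -> lam i0 x = x.
Proof. exact: (sys_id (lam_system X)). Qed.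

Lemma lam_hom i j t : hom N N (lam i) (lam j) t ->
  exists c : C, t = (if i == j then c else 0) *: (1 : B).
Proof.
exact: (tau_hom algN_star lam_morph (sys_irr (lam_system X))
          (sys_inequiv (lam_system X))).
Qed.

Lemma direct_sum_hom sigma n (nu : 'I_n -> NN X) (t : 'I_n -> B) :
  is_direct_sum N lam sigma nu t ->
  forall k x, N x -> (t k)^† * sigma x = lam (nu k) x * (t k)^†.
Proof.
move=> [tN t1 sE] k x Nx; have to := isometry_orth (fun k => proj2 (tN k)) t1.
rewrite sE// mulr_sumr (bigD1 k)//= big1 ?addr0 => [|l /negPf lk].
  by rewrite !mulrA to eqxx mul1r.
by rewrite !mulrA to eq_sym lk !mul0r.
Qed.

Lemma direct_sum_hom' sigma n (nu : 'I_n -> NN X) (t : 'I_n -> B) :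
  is_direct_sum N lam sigma nu t ->
  forall k x, N x -> sigma x * t k = t k * lam (nu k) x.
Proof.
move=> [tN t1 sE] k x Nx; have to := isometry_orth (fun k => proj2 (tN k)) t1.
rewrite sE// mulr_suml (bigD1 k)//= big1 ?addr0 => [|l /negPf lk].
  by rewrite -mulrA to eqxx mulr1.
by rewrite -mulrA to lk !mulr0.
Qed.

Definition signed_braiding s i j : B :=
  if s then eps i j else (eps j i)^†.

Local Notation be := signed_braiding.

Lemma signed_braiding_adj s i j : (be s i j)^† = be (~~ s) j i.
Proof. by case: s => //=; rewrite /be adjK. Qed.

Lemma comp_morph i j : is_morphism N N (lam i \o lam j).
Proof. exact: morphism_comp (lam_morph j) (lam_morph i). Qed.

Lemma signed_braiding_hom s i j :
  hom N N (lam i \o lam j) (lam j \o lam i) (be s i j).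
Proof.
case: s; first exact: (br_hom (eps_braiding X)).
apply: (hom_adj algN_star algN_star (comp_morph _ _) (comp_morph _ _)).
exact: (br_hom (eps_braiding X)).
Qed.

Lemma signed_braidingN s i j : N (be s i j).
Proof. by case: (signed_braiding_hom s i j). Qed.

Lemma signed_braidingE s i j x : N x ->
  be s i j * lam i (lam j x) = lam j (lam i x) * be s i j.
Proof. by case: (signed_braiding_hom s i j) => _; apply. Qed.

Lemma signed_braiding_unitary s i j : unitary (be s i j).
Proof.
have [h1 h2] := br_unitary (eps_braiding X) i j.
have [h3 h4] := br_unitary (eps_braiding X) j i.
by case: s; rewrite /unitary /be ?adjK.
Qed.

Lemma signed_braidingK s i j : be s i j * (be s i j)^† = 1.
Proof. by case: (signed_braiding_unitary s i j). Qed.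

Lemma signed_braidingVK s i j : (be s i j)^† * be s i j = 1.
Proof. by case: (signed_braiding_unitary s i j). Qed.

Lemma signed_braiding0l s j : be s i0 j = 1.
Proof.
by case: s; rewrite /be ?(br_idl (eps_braiding X)) ?(br_idr (eps_braiding X)) ?adj1.
Qed.

Lemma signed_braiding0r s j : be s j i0 = 1.
Proof.
by case: s; rewrite /be ?(br_idl (eps_braiding X)) ?(br_idr (eps_braiding X)) ?adj1.
Qed.

Lemma lam_unitary i t : N t -> unitary t -> unitary (lam i t).
Proof.
move=> Nt [t1 t2]; rewrite /unitary -(morph_adj (lam_morph i))//.
have Nt' := sa_adj algN_star Nt.
by rewrite -!(morph_mul (lam_morph i))// t1 t2 (morph_one (lam_morph i)).
Qed.

Lemma unitary_swap (a b u w : B) : unitary u -> unitary w ->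
  a * w = u * b -> b * w^† = u^† * a.
Proof.
move=> [u1 _] [_ w2] e.
by rewrite -[a]mulr1 -w2 (mulrA a) e !mulrA u1 mul1r.
Qed.

Lemma unitary_mul (u w : B) : unitary u -> unitary w -> unitary (u * w).
Proof.
move=> [u1 u2] [w1 w2]; rewrite /unitary adjM.
by split; [rewrite -mulrA (mulrA _ u) u1 mul1r|rewrite -mulrA (mulrA w) w2 mul1r].
Qed.

(** For the opposite braiding this is the other naturality of [eps], with its unitaries moved to the
    opposite sides. *)
Lemma signed_natl s (l m n r : NN X) t : hom N N (lam l) (lam m \o lam n) t ->
  lam r t * be s l r = be s m r * lam m (be s n r) * t.
Proof.
move=> ht; case: s; first exact: (br_natl (eps_braiding X)).
have U a b := br_unitary (eps_braiding X) a b.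
have Ne : N (eps r n) := signed_braidingN true r n.
rewrite (unitary_swap (b := lam r t) (a := t) (u := lam m (eps r n) * eps r m)).
- by rewrite adjM -(morph_adj (lam_morph m)).
- exact: unitary_mul (lam_unitary _ _ _) _.
- exact: U.
- exact: (br_natr (eps_braiding X)).
Qed.

Lemma signed_natr s (l m n r : NN X) t : hom N N (lam l) (lam m \o lam n) t ->
  t * be s r l = lam m (be s r n) * be s r m * lam r t.
Proof.
move=> ht; case: s; first exact: (br_natr (eps_braiding X)).
have U a b := br_unitary (eps_braiding X) a b.
have Ne : N (eps n r) := signed_braidingN true n r.
rewrite (unitary_swap (b := t) (a := lam r t) (u := eps m r * lam m (eps n r))).
- by rewrite adjM -(morph_adj (lam_morph m)).
- exact: unitary_mul _ (lam_unitary _ _ _).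
- exact: U.
- exact: (br_natl (eps_braiding X)).
Qed.

(** The adjoint of [signed_natr], solved for the form in which coefficients of an intertwiner meet
    the braiding in [alpha_intertwiner]. *)
Lemma signed_natr_adj s (l m n r : NN X) t : hom N N (lam l) (lam m \o lam n) t ->
  lam r t^† * (be s r m)^† = (be s r l)^† * t^† * lam m (be s r n).
Proof.
move=> ht; have [Nt _] := ht.
have := signed_natr s r ht => /(congr1 (@bop_adj R H)).
rewrite !adjM -(morph_adj (lam_morph m) (signed_braidingN s r n)).
rewrite -(morph_adj (lam_morph r) Nt) => ->.
rewrite -!mulrA -(morph_mul (lam_morph m)) ?signed_braidingVK.
- by rewrite (morph_one (lam_morph m)) mulr1.
- exact: (sa_adj algN_star (signed_braidingN _ _ _)).
- exact: signed_braidingN.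
Qed.

(* [braid_ext] is defined through an arbitrary decomposition of [sigma]; this gives
   its independence of that choice. *)
Lemma braid_sum_unique i (F : NN X -> B) sigma
    n (nu : 'I_n -> NN X) t n' (nu' : 'I_n' -> NN X) t' :
  is_direct_sum N lam sigma nu t -> is_direct_sum N lam sigma nu' t' ->
  \sum_k t k * F (nu k) * (lam i (t k))^† =
  \sum_k t' k * F (nu' k) * (lam i (t' k))^†.
Proof.
move=> d d'; have [tN t1 _] := d; have [tN' t1' _] := d'.
have Nt k : N (t k) by case: (tN k).
have Nt' k : N (t' k) by case: (tN' k).
have hN := algN_star.
transitivity (\sum_k \sum_l t' l * ((t' l)^† * t k * F (nu k)) * (lam i (t k))^†).
  apply: eq_bigr => k _; rewrite -[LHS]mul1r -t1' mulr_suml.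
  by apply: eq_bigr => l _; rewrite !mulrA.
rewrite exchange_big; apply: eq_bigr => l _.
have lt k : (t' l)^† * t k * F (nu k) = F (nu' l) * lam i ((t' l)^† * t k).
  have [|c ->] := @lam_hom (nu k) (nu' l) ((t' l)^† * t k).
    split=> [|x Nx]; first exact: (sa_mul hN (sa_adj hN (Nt' l)) (Nt k)).
    by rewrite -mulrA -(direct_sum_hom' d)// !mulrA (direct_sum_hom d').
  rewrite (morph_scale (lam_morph i)) ?(morph_one (lam_morph i)); last exact: sa_one.
  by case: eqVneq => [->|_]; rewrite bop_scaleAl bop_scaleAr mul1r mulr1// !scale0r.
transitivity (\sum_k t' l * F (nu' l) * lam i ((t' l)^† * t k * (t k)^†)).
  apply: eq_bigr => k _.
  have Ntt : N ((t' l)^† * t k) := sa_mul hN (sa_adj hN (Nt' l)) (Nt k).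
  rewrite lt -(morph_adj (lam_morph i) (Nt k)) -!mulrA.
  by rewrite -(morph_mul (lam_morph i) Ntt (sa_adj hN (Nt k))) !mulrA.
rewrite -mulr_sumr -(morphism_sum (lam_morph i) hN) => [|k _].
  under eq_bigr do rewrite -mulrA.
  rewrite -mulr_sumr t1 mulr1 (morph_adj (lam_morph i))//.
by apply: (sa_mul hN); [exact: (sa_mul hN (sa_adj hN (Nt' l)) (Nt k))|exact: (sa_adj hN)].
Qed.

(** Schur's lemma makes every isometry a scalar. The unit sum of squares is what removes this
    decomposition from the formula in [braidE]. *)
Lemma direct_sum_lam i n (nu : 'I_n -> NN X) t :
  is_direct_sum N lam (lam i) nu t ->
  exists c : 'I_n -> C, [/\ forall k, nu k = i, forall k, t k = c k *: (1 : B)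
    & \sum_k c k * (c k)^* = 1].
Proof.
move=> d; have [tN t1 _] := d.
have /choice[c tc] k : exists c : C, t k = c *: (1 : B) /\ nu k = i.
  have [|c] := @lam_hom (nu k) i (t k).
    by split=> [|x Nx]; [case: (tN k)|rewrite (direct_sum_hom' d)].
  case: eqVneq => [ki ->|_]; first by exists c.
  rewrite scale0r => tk0; have [_] := tN k.
  by rewrite /isometry tk0 mulr0 => /esym/bop_one_neq0.
exists c; split=> [k|k|]; [by case: (tc k)|by case: (tc k)|].
apply: (scaler1_inj bop_one_neq0); rewrite scale1r -[RHS]t1 scaler_suml.
apply: eq_bigr => k _; have [-> _] := tc k.
by rewrite adjZ adj1 bop_scaleAl mul1r scalerA.
Qed.

Lemma direct_sum_id i : is_direct_sum N lam (lam i) (fun _ : 'I_1 => i) (fun=> 1).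
Proof.
split=> [k||x Nx].
- by split; [exact: sa_one algN_star|rewrite /isometry adj1 mul1r].
- by rewrite big_ord1 adj1 mul1r.
- by rewrite big_ord1 adj1 mul1r mulr1.
Qed.

(** The value picked by [xget] comes from unknown decompositions: [braid_sum_unique] exchanges that
    of sigma, and that of [lam i] contributes a factor 1. The given decomposition excludes the
    default 0. *)
Lemma braidE s i sigma n (nu : 'I_n -> NN X) t :
  is_direct_sum N lam sigma nu t ->
  braid (X := X) s (lam i) sigma = \sum_k t k * be s i (nu k) * (lam i (t k))^†.
Proof.
move=> d; have hN := algN_star; case: s.
  rewrite /braid /braid_ext; case: xgetP => [e _|].
    move=> [n1 [nu1 [t1 [m [mu [u [d1 du ->]]]]]]].
    rewrite (braid_sum_unique i (be true i) d du).
    have [c [nuE tE c1]] := direct_sum_lam d1.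
    transitivity (\sum_k (c k * (c k)^*) *: \sum_j u j * be true i (mu j) * (lam i (u j))^†).
      apply: eq_bigr => k _; rewrite scaler_sumr; apply: eq_bigr => j _.
      rewrite tE nuE (morph_scale (lam_morph _)) ?(morph_one (lam_morph _)); last exact: sa_one.
      rewrite adjZ adj1 !(bop_scaleAr, bop_scaleAl) !mulr1 scalerA mulrC//.
    by rewrite -scaler_suml c1 scale1r.
  move=> /(_ (\sum_(i1 < 1) \sum_j t j * lam (nu j) 1 * eps i (nu j) *
     (lam i (t j))^† * 1^†)) [].
  by exists 1%N, (fun=> i), (fun=> 1), n, nu, t; split=> //; exact: direct_sum_id.
rewrite /braid /braid_ext; case: xgetP => [e _|].
  move=> [m [mu [u [n1 [nu1 [t1 [du d1 ->]]]]]]].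
  rewrite (braid_sum_unique i (be false i) d du) adj_sum.
  apply: eq_bigr => j _; rewrite adj_sum.
  have [c [nuE tE c1]] := direct_sum_lam d1.
  have [uN _ _] := du; have Nu : N (u j) by case: (uN j).
  transitivity (\sum_k (c k * (c k)^*) *: (u j * be false i (mu j) * (lam i (u j))^†)).
    apply: eq_bigr => k _.
    rewrite tE nuE (morph_scale (lam_morph _)) ?(morph_one (lam_morph _)); last exact: sa_one.
    rewrite !adjM !adjZ !adj1 !adjK !(bop_scaleAr, bop_scaleAl) ?mulr1 ?mul1r.
    by rewrite mulrA scalerA conjCK.
  by rewrite -scaler_suml c1 scale1r.
move=> /(_ (\sum_j \sum_(i1 < 1) 1 * lam i (t j) * eps (nu j) i *
     (lam (nu j) 1)^† * (t j)^†)) [].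
by exists n, nu, t, 1%N, (fun=> i), (fun=> 1); split=> //; exact: direct_sum_id.
Qed.

Lemma lam_fusion i j : exists n (nu : 'I_n -> NN X) (t : 'I_n -> B),
  is_direct_sum N lam (lam i \o lam j) nu t.
Proof. by have [] := sys_fusion (lam_system X) i j. Qed.

End BraidedSystem.

Section StatisticalDimension.
Context {R : realType} {H : hilbert R}.
Local Notation C := R[i].
Local Notation B := (bop H).

(** At x = 1 the Pimsner-Popa inequality forces every index bound to be at least 1. *)
Lemma sdim_neq0 (A M : set B) (rho : B -> B) : (1 : B) <> 0 -> A 1 -> M 1 ->
  rho 1 = 1 -> finite_dim A M rho -> sdim A M rho != 0.
Proof.
move=> one0 A1 M1 rho1 fd; rewrite /sdim sqrtr_eq0 -ltNge.
apply: (lt_le_trans ltr01); apply: lb_le_inf => // c [E Ece].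
move=> /(_ 1 M1); rewrite adj1 mul1r (ce_id Ece); last by exists 1.
have [u u0] : exists u : H, u <> 0.
  by apply/existsNP => h; apply: one0; apply: bopP => u /=; exact: h.
move/(_ u); rewrite bopB_fun /= hdotDl -scaleN1r !hdotZl mulN1r -[X in _ - X]mul1r.
rewrite -mulrBl -hnormE pmulr_lge0; last first.
  by rewrite exprn_gt0// normr_gt0; apply/eqP.
by rewrite subr_ge0 -(rmorph1 (real_complex R)) lecR.
Qed.

End StatisticalDimension.

(** * Alpha-induction *)

Section Frames.
Context {R : realType} {H : hilbert R} {X : braided_system H}.
Local Notation C := R[i].
Local Notation B := (bop H).
Local Notation N := (algN X).
Local Notation lam := (lam (b := X)).
Implicit Types (i j : NN X) (s : bool) (x y : B) (S : subfactor X).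

(* [v] and [r] are the isometries of the conjugate equations for [iota] and
   [iotabar], up to the factor [fc]; [gen k = t_k^* v]. *)
Record frame S : Type := Frame {
  fr : B;
  fv : B;
  fc : C;
  fn : nat;
  fnu : 'I_fn -> NN X;
  ft : 'I_fn -> B;
  frN : N fr;
  frE : forall a, N a -> fr * a = iotabar S a * fr;
  fvM : alg S fv;
  fvE : forall a, alg S a -> fv * a = iotabar S a * fv;
  fv_iso : fv^† * fv = 1;
  frv : fr^† * fv = fc *: (1 : B);
  fc0 : fc != 0;
  ftP : is_direct_sum N lam (iotabar S) fnu ft
}.

Lemma inhabited_frame S : inhabited (frame S).
Proof.
have [fd _ [r [v [[[Nr rE] _] [[Mv vE] iv] rv _]]]] := iotabar_conj S.
have [_ [n [nu [t d]]]] := theta_Sigma S.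
split; apply: (@Frame S r v (real_complex R (sdim (algN X) (alg S) id)^-1) n nu t) => //.
rewrite fmorph_eq0 invr_eq0; apply: sdim_neq0 => //.
- exact: bop_one_neq0.
- exact: sa_one algN_star.
- exact: (sa_one (type_III_star (alg_III S))).
Qed.

Definition the_frame S : frame S := projT1 (cid (let: inhabits F := inhabited_frame S in
  ex_intro (fun _ : frame S => True) F I)).

Record conjugate i : Type := Conjugate {
  cbar : NN X;
  cr : B;
  crb : B;
  cc : C;
  crN : N cr;
  crE : forall a, N a -> cr * a = lam cbar (lam i a) * cr;
  crbN : N crb;
  crbE : forall a, N a -> crb * a = lam i (lam cbar a) * crb;
  crb_iso : isometry crb;
  crrb : (lam i cr)^† * crb = cc *: (1 : B);
  cc0 : cc != 0
}.

Lemma inhabited_conjugate i : inhabited (conjugate i).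
Proof.
have [j [fd _ [r [rb [[[Nr rE] _] [[Nrb rbE] irb] rv _]]]]] := sys_conj (lam_system X) i.
split; apply: (@Conjugate i j r rb (real_complex R (sdim N N (lam i))^-1)) => //.
rewrite fmorph_eq0 invr_eq0; apply: sdim_neq0 => //.
- exact: bop_one_neq0.
- exact: sa_one algN_star.
- exact: sa_one algN_star.
- exact: (morph_one (lam_morph i)).
Qed.

Definition the_conjugate i : conjugate i :=
  projT1 (cid (let: inhabits F := inhabited_conjugate i in
    ex_intro (fun _ : conjugate i => True) F I)).

End Frames.

Section Alpha.
Context {R : realType} {H : hilbert R} {X : braided_system H}.
Local Notation C := R[i].
Local Notation B := (bop H).
Local Notation N := (algN X).
Local Notation lam := (lam (b := X)).
Local Notation i0 := (NN0 X).
Local Notation be := (signed_braiding (X := X)).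
Variable S : subfactor X.
Implicit Types (i j : NN X) (s : bool) (x y a : B).
Local Notation M := (alg S).
Local Notation g := (iotabar S).
Let F := the_frame S.
Local Notation r := (fr F).
Local Notation v := (fv F).
Local Notation c := (fc F).
Local Notation t := (ft (f := F)).
Local Notation nu := (fnu (f := F)).

Let hN : star_algebra N := algN_star.

Lemma alg_star : star_algebra M. Proof. exact: type_III_star (alg_III S). Qed.

Let hM := alg_star.

Lemma iotabar_morph : is_morphism M N g.
Proof. by case: (iotabar_conj S). Qed.

Let mg := iotabar_morph.

Lemma iotabarN x : M x -> N (g x). Proof. exact: (morph_in mg). Qed.

Lemma NM x : N x -> M x. Proof. exact: alg_sub. Qed.

Lemma ftN k : N (t k). Proof. by case: (ftP F) => h _ _; case: (h k). Qed.

Lemma ft1 : \sum_k t k * (t k)^† = 1. Proof. by case: (ftP F). Qed.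

Lemma ft_orth k l : (t k)^† * t l = if k == l then 1 else 0.
Proof. by case: (ftP F) => h t1 _; apply: isometry_orth => // p; case: (h p). Qed.

Lemma ftE k x : N x -> g x * t k = t k * lam (nu k) x.
Proof. exact: (direct_sum_hom' (ftP F)). Qed.

Lemma ftVE k x : N x -> (t k)^† * g x = lam (nu k) x * (t k)^†.
Proof. exact: (direct_sum_hom (ftP F)). Qed.

(* Locked, for rewriting with [mulrA] would unfold it. *)
Definition gen k : B := locked ((t k)^† * v).

Lemma gen_def k : gen k = (t k)^† * v. Proof. by rewrite /gen -lock. Qed.

(** Since r^† g(x) v = r^† v x = c x and v is the sum of the [t k * gen k], these are coefficients
    of x over the [gen k] with values in N. *)
Definition coef k x : B := c^-1 *: (r^† * g x * t k).

(** The space Hom(iota lambda_i, iota lambda_j). *)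
Definition intertwines i j x := M x /\ forall a, N a -> x * lam i a = lam j a * x.

Lemma genP k : intertwines i0 (nu k) (gen k).
Proof.
rewrite gen_def; split=> [|a Na].
  exact: (sa_mul hM (sa_adj hM (NM (ftN k))) (fvM F)).
rewrite lam0// -mulrA (fvE F); last exact: NM.
by rewrite mulrA ftVE// mulrA.
Qed.

Lemma genM k : M (gen k). Proof. by case: (genP k). Qed.

Lemma genE k a : N a -> gen k * a = lam (nu k) a * gen k.
Proof. by move=> Na; rewrite -(proj2 (genP k))// lam0. Qed.

Lemma sum_gen : \sum_k t k * gen k = v.
Proof. by under eq_bigr do rewrite gen_def mulrA; rewrite -mulr_suml ft1 mul1r. Qed.

Lemma coefN k x : M x -> N (coef k x).
Proof.
move=> Mx; apply: (sa_scale hN); apply: (sa_mul hN _ (ftN k)).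
exact: (sa_mul hN (sa_adj hN (frN F)) (iotabarN Mx)).
Qed.

Lemma rgv x : M x -> r^† * g x * v = c *: x.
Proof. by move=> Mx; rewrite -mulrA -(fvE F)// mulrA (frv F) bop_scaleAl mul1r. Qed.

Lemma coef_sum x : M x -> \sum_k coef k x * gen k = x.
Proof.
move=> Mx; under eq_bigr do rewrite bop_scaleAl -mulrA.
by rewrite -scaler_sumr -mulr_sumr sum_gen rgv// scalerA mulVf ?scale1r// (fc0 F).
Qed.

Lemma iotabar_inj x y : M x -> M y -> g x = g y -> x = y.
Proof. by move=> Mx My e; rewrite -(coef_sum Mx) -(coef_sum My) /coef e. Qed.

Lemma coefE i j x k b : intertwines i j x -> N b ->
  coef k x * lam (nu k) (lam i b) = lam j b * coef k x.
Proof.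
move=> [Mx hx] Nb.
have hr a : N a -> r^† * g a = a * r^†.
  move=> Na; apply: (@adj_inj R H); rewrite !adjM adjK.
  rewrite -(morph_adj mg) ?(frE F)//; first exact: (sa_adj hN).
  exact: NM.
rewrite /coef bop_scaleAl bop_scaleAr; congr (_ *: _).
rewrite -mulrA -ftE; last exact: lam_in.
rewrite mulrA -(mulrA r^†) -(morph_mul mg)//; last exact/NM/lam_in.
rewrite hx// (morph_mul mg)//; last exact/NM/lam_in.
by rewrite mulrA hr ?mulrA//; exact: lam_in.
Qed.

(** Coefficients turn an intertwiner of M into intertwiners of N, to which naturality of the
    braiding applies. *)
Lemma coef_intertwines i j x k : intertwines i j x ->
  hom N N (lam j) (lam (nu k) \o lam i) (coef k x)^†.
Proof.
move=> hx; have [Mx _] := hx.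
split=> [|a Na]; first exact: (sa_adj hN (coefN k Mx)).
have := coefE k hx (sa_adj hN Na) => /(congr1 (@bop_adj R H)).
rewrite !adjM -(morph_adj (lam_morph _)); last exact/lam_in/(sa_adj hN).
rewrite -!(morph_adj (lam_morph _)) ?adjK => [<-//| |]; exact: (sa_adj hN).
Qed.

(** By [braidE], the braiding operator of lambda_i with theta. *)
Definition theta_braiding s i : B := \sum_k t k * be s i (nu k) * (lam i (t k))^†.
Local Notation U := theta_braiding.

Lemma lam_ft_orth i k l : (lam i (t k))^† * lam i (t l) = if k == l then 1 else 0.
Proof.
rewrite -(morph_adj (lam_morph i)); last exact: ftN.
rewrite -(morph_mul (lam_morph i)) ?ft_orth; [|exact: (sa_adj hN (ftN k))|exact: ftN].
case: eqP => _; first exact: (morph_one (lam_morph i)).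
rewrite -(scale0r (1 : B)) (morph_scale (lam_morph i)) ?scale0r//.
exact: sa_one.
Qed.

Lemma lam_ft1 i : \sum_k lam i (t k) * (lam i (t k))^† = 1.
Proof.
rewrite -[RHS](morph_one (lam_morph i)) -ft1 (morphism_sum (lam_morph i) hN).
  apply: eq_bigr => k _; rewrite (morph_mul (lam_morph i)) ?(morph_adj (lam_morph i))//;
  by [exact: ftN|exact: (sa_adj hN (ftN k))].
by move=> k _; exact: (sa_mul hN (ftN k) (sa_adj hN (ftN k))).
Qed.

Lemma lam_ft_ext i x y :
  (forall k, x * lam i (t k) = y * lam i (t k)) -> x = y.
Proof.
move=> xy; rewrite -[LHS]mulr1 -[RHS]mulr1 -(lam_ft1 i) !mulr_sumr.
by apply: eq_bigr => k _; rewrite !mulrA xy.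
Qed.

Lemma ft_ext x y : (forall k, (t k)^† * x = (t k)^† * y) -> x = y.
Proof.
move=> xy; rewrite -[LHS]mul1r -[RHS]mul1r -ft1 !mulr_suml.
by apply: eq_bigr => k _; rewrite -!mulrA xy.
Qed.

Lemma theta_braidingN s i : N (U s i).
Proof.
apply: (sa_sum hN) => k _; apply: (sa_mul hN).
  exact: (sa_mul hN (ftN k) (signed_braidingN _ _ _)).
exact: (sa_adj hN (lam_in _ (ftN k))).
Qed.

Lemma theta_braiding_ft s i k : U s i * lam i (t k) = t k * be s i (nu k).
Proof.
rewrite /U mulr_suml (bigD1 k)//= big1 ?addr0 => [|l /negPf lk].
  by rewrite -mulrA lam_ft_orth eqxx mulr1.
by rewrite -mulrA lam_ft_orth lk mulr0.
Qed.

Lemma ft_theta_braiding s i k : (t k)^† * U s i = be s i (nu k) * (lam i (t k))^†.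
Proof.
rewrite /U mulr_sumr (bigD1 k)//= big1 ?addr0 => [|l /negPf lk].
  by rewrite !mulrA ft_orth eqxx mul1r.
by rewrite !mulrA ft_orth eq_sym lk !mul0r.
Qed.

Lemma theta_braiding_unitary s i : unitary (U s i).
Proof.
have US : (U s i)^† = \sum_k lam i (t k) * (be s i (nu k))^† * (t k)^†.
  by rewrite adj_sum; apply: eq_bigr => k _; rewrite !adjM adjK mulrA.
split; rewrite US.
  rewrite mulr_suml -(lam_ft1 i); apply: eq_bigr => k _.
  rewrite -mulrA ft_theta_braiding !mulrA -(mulrA (lam i _)) signed_braidingVK.
  by rewrite mulr1.
rewrite mulr_sumr -ft1; apply: eq_bigr => k _.
by rewrite !mulrA theta_braiding_ft -(mulrA (t k)) signed_braidingK mulr1.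
Qed.

Lemma theta_braiding_hom s i x : N x -> U s i * lam i (g x) = g (lam i x) * U s i.
Proof.
move=> Nx.
have Ng : N (g x) by exact/iotabarN/NM.
apply: (@lam_ft_ext i) => k; rewrite -[LHS]mulrA -(morph_mul (lam_morph i)) ?ftE//; last exact: ftN.
rewrite (morph_mul (lam_morph i)); [|exact: ftN|exact: lam_in].
rewrite mulrA theta_braiding_ft -mulrA signed_braidingE// mulrA -ftE; last exact: lam_in.
by rewrite -mulrA -theta_braiding_ft mulrA.
Qed.

(* [gen k] intertwines iota and iota lambda_k, so [g (gen k)] intertwines theta and
   theta lambda_k. *)
Lemma theta_braiding_natural s i k :
  g (be s i (nu k)) * U s i * lam i (g (gen k)) = g (gen k) * U s i.
Proof.
have Ng : N (g (gen k)) by exact/iotabarN/genM.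
have hg x : N x -> g (gen k) * g x = g (lam (nu k) x) * g (gen k).
  move=> Nx; rewrite -!(morph_mul mg) ?genE//;
  by [exact: genM|exact: NM|exact/NM/lam_in].
apply: ft_ext => l; apply: (@lam_ft_ext i) => p; rewrite !mulrA.
pose T := (t l)^† * g (gen k) * t p.
have NT : N T := sa_mul hN (sa_mul hN (sa_adj hN (ftN l)) Ng) (ftN p).
have hT : hom N N (lam (nu p)) (lam (nu l) \o lam (nu k)) T.
  split=> // x Nx; rewrite /T -mulrA -ftE// mulrA -(mulrA (t l)^†) hg//.
  by rewrite mulrA ftVE ?mulrA//; exact: lam_in.
have lamT : (lam i (t l))^† * lam i (g (gen k)) * lam i (t p) = lam i T.
  rewrite -(morph_adj (lam_morph i)); last exact: ftN.
  have Na := sa_adj hN (ftN l).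
  rewrite -(morph_mul (lam_morph i) Na Ng).
  by rewrite -(morph_mul (lam_morph i) (sa_mul hN Na Ng) (ftN p)).
transitivity (lam (nu l) (be s i (nu k)) * be s i (nu l) * lam i T).
  rewrite ftVE; last exact: signed_braidingN.
  by rewrite (mulrE _ (ft_theta_braiding s i l)) -lamT !mulrA.
by rewrite -(signed_natr s i hT) /T (mulrE _ (theta_braiding_ft s i p)) !mulrA.
Qed.

Local Notation al s i := (alpha S s (lam i)).

Lemma alphaP s i x : M x -> M (al s i x) /\ g (al s i x) = U s i * lam i (g x) * (U s i)^†.
Proof.
move=> Mx; rewrite /alpha (braidE s i (ftP F)) -/(U s i).
(* The witness that excludes the default is dictated by two rules proved below, [alphaN] and
   [alpha_gen]: the induction is lambda_i on N and multiplies [gen k] by a braiding operator. *)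
case: xgetP => [y _ [//]|/(_ (\sum_k lam i (coef k x) * ((be s i (nu k))^† * gen k)))[]].
have Mk k : M ((be s i (nu k))^† * gen k).
  exact: (sa_mul hM (NM (sa_adj hN (signed_braidingN _ _ _))) (genM k)).
have Nl k : N (lam i (coef k x)) := lam_in _ (coefN k Mx).
split; first by apply: (sa_sum hM) => k _; exact: (sa_mul hM (NM (Nl k))).
have [U1 U2] := theta_braiding_unitary s i.
rewrite (morphism_sum mg hM); last by move=> k _; exact: (sa_mul hM (NM (Nl k))).
rewrite -[in RHS](coef_sum Mx) (morphism_sum mg hM); last first.
  by move=> k _; exact: (sa_mul hM (NM (coefN _ Mx)) (genM k)).
have Ng k : N (g (gen k)) := iotabarN (genM k).
have Ngc k : N (g (coef k x)) := iotabarN (NM (coefN _ Mx)).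
rewrite (morphism_sum (lam_morph i) hN); last first.
  move=> k _; rewrite (morph_mul mg (NM (coefN _ Mx)) (genM k)).
  exact: (sa_mul hN (Ngc k) (Ng k)).
rewrite mulr_sumr mulr_suml; apply: eq_bigr => k _.
rewrite (morph_mul mg (NM (Nl k)) (Mk k)).
have Nb := signed_braidingN s i (nu k).
rewrite (morph_mul mg (NM (sa_adj hN Nb)) (genM k)).
rewrite (morph_mul mg (NM (coefN _ Mx)) (genM k)) (morph_mul (lam_morph i) (Ngc k) (Ng k)).
rewrite [in RHS]mulrA theta_braiding_hom; last exact: coefN.
rewrite -!mulrA; congr (_ * _).
have := theta_braiding_natural s i k => /(congr1 (fun z => g (be s i (nu k))^† * z * (U s i)^†)).
rewrite !mulrA -(morph_mul mg (NM (sa_adj hN Nb)) (NM Nb)) signed_braidingVK (morph_one mg) mul1r.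
by move=> ->; rewrite -!mulrA U2 mulr1.
Qed.

Lemma alphaM s i x : M x -> M (al s i x). Proof. by case/(alphaP s i). Qed.

Lemma iotabar_alpha s i x : M x -> g (al s i x) = U s i * lam i (g x) * (U s i)^†.
Proof. by case/(alphaP s i). Qed.

Lemma alpha_eq s i x y : M x -> M y ->
  g y = U s i * lam i (g x) * (U s i)^† -> al s i x = y.
Proof. by move=> Mx My e; apply: iotabar_inj => //; rewrite ?iotabar_alpha//; exact: alphaM. Qed.

Lemma alpha_morph s i : is_morphism M M (al s i).
Proof.
have ml := lam_morph i; have [U1 U2] := theta_braiding_unitary s i.
split.
- exact: alphaM.
- move=> x y Mx My; apply: alpha_eq.
  + exact: (sa_add hM).
  + exact: (sa_add hM (alphaM s i Mx) (alphaM s i My)).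
  + rewrite (morph_add mg) ?iotabar_alpha//; try exact: alphaM.
    by rewrite (morph_add mg)// (morph_add ml) ?mulrDr ?mulrDl//; exact: iotabarN.
- move=> d x Mx; apply: alpha_eq.
  + exact: (sa_scale hM).
  + exact: (sa_scale hM _ (alphaM s i Mx)).
  + rewrite (morph_scale mg) ?iotabar_alpha//; try exact: alphaM.
    by rewrite (morph_scale mg)// (morph_scale ml) ?bop_scaleAr ?bop_scaleAl//; exact: iotabarN.
- move=> x y Mx My; apply: alpha_eq.
  + exact: (sa_mul hM).
  + exact: (sa_mul hM (alphaM s i Mx) (alphaM s i My)).
  + rewrite (morph_mul mg) ?iotabar_alpha//; try exact: alphaM.
    rewrite (morph_mul mg)// (morph_mul ml); [|exact: iotabarN..].
    by rewrite !mulrA (mulrE _ U1) mulr1.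
- move=> x Mx; apply: alpha_eq.
  + exact: (sa_adj hM).
  + exact: (sa_adj hM (alphaM s i Mx)).
  + rewrite (morph_adj mg) ?iotabar_alpha//; try exact: alphaM.
    by rewrite (morph_adj mg)// (morph_adj ml) ?adjM ?adjK ?mulrA//; exact: iotabarN.
- apply: alpha_eq; [exact: sa_one|exact: sa_one|].
  by rewrite (morph_one mg) (morph_one ml) mulr1 U2.
Qed.

Lemma alphaN s i a : N a -> al s i a = lam i a.
Proof.
move=> Na; apply: alpha_eq; [exact: NM|exact/NM/lam_in|].
have [_ U2] := theta_braiding_unitary s i.
by rewrite theta_braiding_hom// -mulrA U2 mulr1.
Qed.

Lemma alpha_gen s i k : al s i (gen k) = (be s i (nu k))^† * gen k.
Proof.
have Nb := signed_braidingN s i (nu k).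
apply: alpha_eq; first exact: genM.
  exact: (sa_mul hM (NM (sa_adj hN Nb)) (genM k)).
have [_ U2] := theta_braiding_unitary s i.
have := theta_braiding_natural s i k => /(congr1 (fun z => g (be s i (nu k))^† * z * (U s i)^†)).
rewrite !mulrA -(morph_mul mg (NM (sa_adj hN Nb)) (NM Nb)) signed_braidingVK (morph_one mg) mul1r.
by move=> ->; rewrite -!mulrA U2 mulr1 (morph_mul mg (NM (sa_adj hN Nb)) (genM k)).
Qed.

(** The coefficients of x are intertwiners of N, across which naturality moves the braiding operator
    of each [gen l]. *)
Lemma alpha_intertwiner s i j k x : intertwines j k x ->
  al s i x = (be s i k)^† * x * be s i j.
Proof.
move=> hx; have [Mx xE] := hx; have ma := alpha_morph s i.
have Nb := signed_braidingN s i j.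
have NMc l : M (coef l x) := NM (coefN l Mx).
rewrite -{1}(coef_sum Mx) (morphism_sum ma hM); last first.
  by move=> l _; exact: (sa_mul hM (NMc l) (genM l)).
rewrite -{2}(coef_sum Mx) mulr_sumr mulr_suml; apply: eq_bigr => l _.
rewrite (morph_mul ma (NMc l) (genM l)) alphaN; last exact: coefN.
rewrite alpha_gen mulrA -[in LHS](adjK (coef l x)).
have Na := sa_adj hN (coefN l Mx).
rewrite (signed_natr_adj s i (coef_intertwines l hx)) adjK.
by rewrite -!mulrA (genE l Nb).
Qed.

Lemma alpha0 s x : M x -> al s i0 x = x.
Proof.
move=> Mx; have ma := alpha_morph s i0.
rewrite -[in LHS](coef_sum Mx) (morphism_sum ma hM); last first.
  by move=> l _; exact: (sa_mul hM (NM (coefN l Mx)) (genM l)).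
rewrite -[RHS](coef_sum Mx); apply: eq_bigr => l _.
rewrite (morph_mul ma (NM (coefN l Mx)) (genM l)) alphaN; last exact: coefN.
by rewrite alpha_gen signed_braiding0l adj1 mul1r lam0//; exact: coefN.
Qed.

Lemma hom_gen sigma rho x : is_morphism M M sigma -> is_morphism M M rho -> M x ->
  (forall a, N a -> x * sigma a = rho a * x) ->
  (forall k, x * sigma (gen k) = rho (gen k) * x) -> hom M M sigma rho x.
Proof.
move=> ms mr Mx hN' hg; split=> // y My.
have Mc l : M (coef l y) := NM (coefN l My).
have Mcg l : M (coef l y * gen l) := sa_mul hM (Mc l) (genM l).
rewrite -(coef_sum My) (morphism_sum ms hM)// (morphism_sum mr hM)//.
rewrite mulr_sumr mulr_suml.
apply: eq_bigr => l _; rewrite (morph_mul ms (Mc l) (genM l)) (morph_mul mr (Mc l) (genM l)).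
by rewrite mulrA hN' -?mulrA ?hg//; exact: coefN.
Qed.

Lemma alpha_comp_morph s i s' j : is_morphism M M (al s i \o al s' j).
Proof. exact: morphism_comp (alpha_morph s' j) (alpha_morph s i). Qed.

(** On N this is the hypothesis; on [gen k] both sides carry braiding operators, and the relation is
    naturality in the first argument. *)
Lemma alpha_fusion s l m n x : hom N N (lam l) (lam m \o lam n) x ->
  hom M M (al s l) (al s m \o al s n) x.
Proof.
move=> hx; have [Nx xE] := hx.
apply: hom_gen; [exact: alpha_morph|exact: alpha_comp_morph|exact: NM| |].
  by move=> a Na /=; rewrite !alphaN ?xE//; exact: lam_in.
move=> k /=; rewrite !alpha_gen.
have Nb i := signed_braidingN s i (nu k).
have ma := alpha_morph s m.
rewrite (morph_mul ma (NM (sa_adj hN (Nb n))) (genM k)) alphaN; last exact: (sa_adj hN).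
rewrite alpha_gen -[RHS]mulrA -(mulrA _ (gen k)) genE// !mulrA; congr (_ * _).
have sw := unitary_swap (unitary_mul (signed_braiding_unitary s m (nu k))
  (lam_unitary m (Nb n) (signed_braiding_unitary s n (nu k))))
  (signed_braiding_unitary s l (nu k)) (signed_natl s (nu k) hx).
by rewrite sw adjM -(morph_adj (lam_morph m) (Nb n)).
Qed.

End Alpha.

Section FiniteSpan.
Context {R : realType} {H : hilbert R}.
Local Notation C := R[i].
Local Notation B := (bop H).
Implicit Types (V W : set B).

Definition finitely_spanned V : Prop := exists m (b : 'I_m -> B), spanned b V.

Lemma finitely_spanned_sum n (V : 'I_n -> set B) :
  (forall k, finitely_spanned (V k)) ->
  finitely_spanned [set x | exists2 y : 'I_n -> B,
    forall k, V k (y k) & x = \sum_k y k].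
Proof.
elim: n V => [|n IHn] V hV.
  exists 0%N, (fun=> 0) => x [y _ ->]; exists (fun=> 0).
  by rewrite !big_ord0.
have [m1 [b1 h1]] := hV ord0.
have [m2 [b2 h2]] := IHn _ (fun k => hV (lift ord0 k)).
exists (m1 + m2)%N, (fun i => match fintype.split i with inl j => b1 j | inr j => b2 j end).
move=> x [y hy ->]; have [c1 e1] := h1 _ (hy ord0).
have [|c2 e2] := h2 (\sum_k y (lift ord0 k)).
  by exists (fun k => y (lift ord0 k)).
exists (fun i => match fintype.split i with inl j => c1 j | inr j => c2 j end).
rewrite big_ord_recl e1 e2 big_split_ord/=; congr (_ + _); apply: eq_bigr => k _.
  by rewrite (unsplitK (inl _ k)).
by rewrite (unsplitK (inr _ k)).
Qed.

End FiniteSpan.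

(** * Decomposition of the induced endomorphisms into irreducible sectors *)

Section AlphaDecomposition.
Context {R : realType} {H : hilbert R} {X : braided_system H}.
Local Notation C := R[i].
Local Notation B := (bop H).
Local Notation N := (algN X).
Local Notation lam := (lam (b := X)).
Local Notation i0 := (NN0 X).
Local Notation be := (signed_braiding (X := X)).
Variable S : subfactor X.
Implicit Types (i j : NN X) (s : bool) (x y a e u w : B).
Local Notation M := (alg S).
Local Notation g := (iotabar S).
Local Notation v := (fv (the_frame S)).
Local Notation al s i := (alpha S s (lam i)).

Let hN : star_algebra N := algN_star.
Let hM : star_algebra M := alg_star S.

Lemma factor_scalar x : M x -> (forall y, M y -> x * y = y * x) ->
  exists c : C, x = c *: (1 : B).
Proof.
move=> Mx hx; case: (alg_III S) => -[_ _ h] _.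
by have : scalars x by rewrite -h; split.
Qed.

Lemma hom_star s i : star_algebra (hom M M (al s i) (al s i)).
Proof.
split.
- exact: hom_one.
- move=> x y [Mx hx] [My hy]; split=> [|a Ma]; first exact: (sa_add hM).
  by rewrite mulrDl mulrDr hx ?hy.
- by move=> x y hx hy; exact: hom_mul hy hx.
- by move=> c x hx; exact: hom_scale.
- by move=> x; apply: hom_adj => //; exact: alpha_morph.
Qed.

Lemma hom_intertwines s s' i j x : hom M M (al s i) (al s' j) x -> intertwines S i j x.
Proof.
move=> [Mx hx]; split=> // a Na; have Ma := NM S Na.
by have := hx a Ma; rewrite !alphaN.
Qed.

(** The coefficients lie in spaces Hom(lambda_k lambda_i, lambda_j) of N, which fusion makes
    finite-dimensional. *)
Lemma intertwines_spanned i j : finitely_spanned [set x | intertwines S i j x].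
Proof.
pose V (k : 'I_(fn (the_frame S))) := [set y | exists2 a,
  N a /\ (forall b, N b -> a * lam (fnu k) (lam i b) = lam j b * a) & y = a * gen k].
have [|m [b hb]] := @finitely_spanned_sum R H _ V; last first.
  exists m, b => x hx; have [Mx _] := hx; apply: hb.
  exists (fun k => coef k x * gen k); last by rewrite coef_sum.
  move=> k; exists (coef k x) => //; split; first exact: coefN.
  by move=> b' Nb'; exact: coefE.
move=> k; have [n [mu [u d]]] := lam_fusion (fnu k) i.
exists n, (fun q => (u q)^† * gen k) => _ [a [Na ha'] ->].
have [uN u1 _] := d; have Nu q : N (u q) by case: (uN q).
have /choice[c cE] q : exists c : C, a * u q = c *: (1 : B).
  have [|c ->] := @lam_hom R H X (mu q) j (a * u q); last by eexists.
  split=> [|z Nz]; first exact: (sa_mul hN).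
  by rewrite -mulrA -(direct_sum_hom' d)// mulrA /= ha' ?mulrA.
exists c; rewrite -[a]mulr1 -u1 mulr_sumr mulr_suml; apply: eq_bigr => q _.
by rewrite mulrA cE bop_scaleAl mul1r bop_scaleAl.
Qed.

Lemma crb_hom s i (D := the_conjugate i) x : M x ->
  crb D * x = al s i (al s (cbar D) x) * crb D.
Proof.
move=> Mx; have [|_ h] := @alpha_fusion R H X S s i0 i (cbar D) (crb D).
  split=> [|a Na]; first exact: crbN.
  by rewrite lam0// (crbE D).
by rewrite -[X in _ * X](alpha0 s Mx) h.
Qed.

(** The element y = e [crb] intertwines id with the product of alpha_i and its conjugate, so y^† y
    is a scalar of the factor M; it is nonzero because the conjugate equation recovers e from y.
    Normalized, y is an isometry of P below e, and [isometry_onto] applies. Leaving P open covers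
    both M and M_s. *)
Lemma isometry_split P s i e : von_neumann P -> N `<=` P -> P e ->
  hom M M (al s i) (al s i) e -> projection e -> e <> 0 ->
  exists t, [/\ P t, isometry t & t * t^† = e].
Proof.
move=> vnP NP Pe [Me he] [eS eI] e0; have hP := von_neumann_star vnP.
pose D := the_conjugate i.
have NMc := NM S (crbN D).
pose y := e * crb D.
have hx x : M x -> e * crb D * x = al s i (al s (cbar D) x) * (e * crb D).
  move=> Mx; rewrite -mulrA (crb_hom s i Mx) mulrA he ?mulrA//.
  by do 2?apply: alphaM.
have yy : y^† * y = (crb D)^† * (e * crb D).
  by rewrite /y adjM eS -mulrA (mulrA e) eI.
have [c yyc] : exists c : C, y^† * y = c *: (1 : B).
  rewrite yy; apply: factor_scalar.
    exact: (sa_mul hM (sa_adj hM NMc) (sa_mul hM Me NMc)).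
  move=> x Mx; rewrite -mulrA hx// !mulrA; congr (_ * _ * _).
  apply: (@adj_inj R H); rewrite !adjM adjK.
  rewrite -!(morph_adj (alpha_morph S s _))//; last exact: alphaM.
  by rewrite (crb_hom s i (sa_adj hM Mx)).
have y0 : y <> 0.
  move=> y0; apply: e0; apply/eqP.
  have : (lam i (cr D))^† * y = cc D *: e.
    have Nc := sa_adj hN (crN D); have Mc := NM S Nc.
    rewrite /y mulrA -(morph_adj (lam_morph i)); last exact: crN.
    rewrite -(alphaN S s)// -he// alphaN// (morph_adj (lam_morph i)); last exact: crN.
    by rewrite -mulrA (crrb D) bop_scaleAr mulr1.
  by rewrite y0 mulr0 => /esym/eqP; rewrite scaler_eq0 (negPf (cc0 D)).
have [d d0 di] := scaled_isometry yyc y0.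
apply: (isometry_onto vnP _ di Pe) => //.
- exact: (sa_scale hP _ (sa_mul hP Pe (NP _ (crbN D)))).
- by rewrite bop_scaleAr /y mulrA eI.
Qed.

(** The image alpha_i(v) embeds alpha_i into iota lambda_i iotabar, since v embeds id into iota
    iotabar and alpha_i is lambda_i on N. *)
Lemma alpha_subsector s i rho w : isometry w -> hom M M rho (al s i) w ->
  subsector M M rho (lam i \o g).
Proof.
move=> iw [Mw hw]; have ma := alpha_morph S s i; have Mv := fvM (the_frame S).
exists (al s i v * w).
  split=> [|x Mx]; first exact: (sa_mul hM (alphaM s i Mv) Mw).
  have Ng : N (g x) := iotabarN Mx.
  rewrite -mulrA hw// mulrA -(morph_mul ma Mv Mx) (fvE (the_frame S))//.
  by rewrite (morph_mul ma (NM S Ng) Mv) alphaN ?mulrA.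
rewrite /isometry adjM -mulrA (mulrA _ _ w) -(morph_adj ma Mv).
rewrite -(morph_mul ma (sa_adj hM Mv) Mv) (fv_iso (the_frame S)).
by rewrite (morph_one ma) mul1r.
Qed.

Lemma compression_irreducible (P : set B) rho w (A := hom P P rho rho) :
  star_algebra P -> is_morphism P P rho -> isometry w -> P w ->
  (forall a, P a -> w * w^† * rho a = rho a * (w * w^†)) ->
  (forall x, A x -> exists c : C, w * w^† * x * (w * w^†) = c *: (w * w^†)) ->
  irreducible P P (fun x => w^† * rho x * w).
Proof.
move=> hP mr iw Pw we hx.
have [mt ht] := isometry_compression hP hP mr Pw iw we.
apply/seteqP; split=> u; last first.
  move=> [c ->]; split; first exact: (sa_scale hP _ (sa_one hP)).
  by move=> a _; rewrite bop_scaleAl bop_scaleAr mul1r mulr1.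
move=> hu; have ht' := hom_adj hP hP mt mr ht.
have [c] := hx _ (hom_mul hP ht' (hom_mul hP hu ht)).
move=> /(congr1 (fun z => w^† * z * w)) h; exists c.
have iwr z : z * w^† * w = z by rewrite -mulrA iw mulr1.
by move: h; rewrite bop_scaleAr bop_scaleAl !mulrA !(iwr, iw, mul1r).
Qed.

(** Each minimal projection among the self-intertwiners of alpha_i is the range of an isometry; the
    irreducible sector it cuts out is matched with its representative by a unitary. *)
Lemma alpha_decomposition (XM : full_system S) s i :
  exists n (nu : 'I_n -> idx XM) (w : 'I_n -> B),
    decomposition M (rep (s := XM)) (al s i) nu w.
Proof.
have [m [b hb]] := intertwines_spanned i i.
have [|||n [e [eA e1 emin]]] := @minimal_projections R H (hom M M (al s i) (al s i)) m b.
- exact: (@bop_one_neq0 R H X).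
- exact: hom_star.
- by move=> x /hom_intertwines; exact: hb.
have ma := alpha_morph S s i.
have /choice[f hf] p : exists f : idx XM * B,
    [/\ hom M M (rep f.1) (al s i) f.2, isometry f.2 & f.2 * f.2^† = e p].
  have [hep eP e0] := eA p; have [Me he] := hep.
  have [w [Mw iw ww]] := isometry_split (type_III_vn (alg_III S)) (@alg_sub _ _ _ S) Me hep eP e0.
  have we a : M a -> w * w^† * al s i a = al s i a * (w * w^†) by rewrite ww; exact: he.
  have [mt ht] := isometry_compression hM hM ma Mw iw we.
  have [||k [u [Mu [u1 u2] hu]]] := @rep_all _ _ _ _ _ XM _ i mt.
  - by apply: compression_irreducible => //; rewrite ww; exact: emin.
  - exact: alpha_subsector iw ht.
  exists (k, w * u); split.
  - apply: (hom_mul hM) ht; exact: (@equivalent_hom _ _ M M _ _ u).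
  - by rewrite /isometry adjM -mulrA (mulrA w^†) iw mul1r.
  - by rewrite /= adjM -mulrA (mulrA u) u2 mul1r.
have we1 : \sum_p (f p).2 * ((f p).2)^† = 1.
  by rewrite -e1; apply: eq_bigr => p _; have [_ _ ->] := hf p.
exists n, (fun p => (f p).1), (fun p => (f p).2); split=> //.
- by move=> p; case: (hf p).
- by apply: isometry_orth => // p; case: (hf p).
Qed.

(** The relation over N extends to M because v^† g(y) = y v^†: the factor rho(v)^† turns rho(g y)
    into rho(y). *)
Lemma average_hom rho x : is_morphism M M rho -> M x ->
  (forall a, N a -> x * a = rho a * x) ->
  hom M M g rho ((rho v)^† * x).
Proof.
move=> mr Mx hx; have Mv := fvM (the_frame S).
split=> [|y My]; first exact: (sa_mul hM (sa_adj hM (morph_in mr Mv)) Mx).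
have Ng : N (g y) := iotabarN My.
rewrite -mulrA hx// !mulrA; congr (_ * _).
rewrite -(morph_adj mr Mv) -!(morph_mul mr)//; try exact: (sa_adj hM Mv).
  congr (rho _); apply: (@adj_inj R H); rewrite !adjM adjK.
  rewrite (fvE (the_frame S)); last exact: (sa_adj hM).
  by rewrite (morph_adj (iotabar_morph S)).
exact: alg_sub.
Qed.

Lemma average_hom2 sigma rho x : is_morphism M M sigma -> is_morphism M M rho ->
  M x -> (forall a, N a -> x * sigma a = rho a * x) ->
  hom M M sigma rho ((rho v)^† * x * sigma v).
Proof.
move=> ms mr Mx hx; have Mv := fvM (the_frame S); have Msv := morph_in ms Mv.
split=> [|y My].
  exact: (sa_mul hM (sa_mul hM (sa_adj hM (morph_in mr Mv)) Mx) Msv).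
have Ng : N (g y) := iotabarN My.
rewrite -mulrA -(morph_mul ms Mv My) (fvE (the_frame S))// (morph_mul ms (NM S Ng) Mv).
rewrite mulrA -(mulrA _ x) hx// !mulrA; congr (_ * _ * _).
rewrite -(morph_adj mr Mv) -!(morph_mul mr)//; try exact: (sa_adj hM Mv).
  congr (rho _); apply: (@adj_inj R H); rewrite !adjM adjK.
  rewrite (fvE (the_frame S)); last exact: (sa_adj hM).
  by rewrite (morph_adj (iotabar_morph S)).
exact: alg_sub.
Qed.

End AlphaDecomposition.

(** * Charged intertwiners and intermediate subfactors *)

Section Intermediate.
Context {R : realType} {H : hilbert R} {X : braided_system H}.
Local Notation C := R[i].
Local Notation B := (bop H).
Local Notation N := (algN X).
Local Notation lam := (lam (b := X)).
Local Notation i0 := (NN0 X).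
Local Notation be := (signed_braiding (X := X)).
Variables (S Sd : subfactor X) (s : bool).
Hypothesis alg_Sd : alg Sd = chiral_alg S s.
Implicit Types (i j k : NN X) (x y a e u w : B).
Local Notation M := (alg S).
Local Notation P := (alg Sd).
Local Notation al s i := (alpha S s (lam i)).
Local Notation be_al s i := (alpha Sd s (lam i)).

Let hN : star_algebra N := algN_star.
Let hM : star_algebra M := alg_star S.
Let hP : star_algebra P := alg_star Sd.

Lemma intermediate_sub x : P x -> M x.
Proof.
rewrite alg_Sd => -[n [i [a [k [ak ->]]]]].
apply: (sa_sum hM) => j _; have [Na [Mk _]] := ak j.
exact: (sa_mul hM (NM S Na) Mk).
Qed.

Let PM := intermediate_sub.

Lemma intermediate_intertwines i j x : intertwines Sd i j x -> intertwines S i j x.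
Proof. by move=> [Px hx]; split=> //; exact: PM. Qed.

(** A generator of P over N is an intertwiner in M with the same labels, so both inductions multiply
    it by the same braiding operator. *)
Lemma alpha_restrict s' i : eq_on P (be_al s' i) (al s' i).
Proof.
move=> x Px; have mS := alpha_morph S s' i; have mP := alpha_morph Sd s' i.
have Pc l := NM Sd (coefN l Px); have Pg l := genM (S := Sd) l.
rewrite -(coef_sum Px) (morphism_sum mP hP) => [|l _]; last exact: (sa_mul hP).
rewrite (morphism_sum mS hM) => [|l _]; last exact: (sa_mul hM (PM (Pc l)) (PM (Pg l))).
apply: eq_bigr => l _; have Nc := coefN l Px.
rewrite (morph_mul mP (Pc l) (Pg l)) (morph_mul mS (PM (Pc l)) (PM (Pg l))).
rewrite (alphaN Sd s' i Nc) (alphaN S s' i Nc) alpha_gen.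
rewrite (alpha_intertwiner s' i (intermediate_intertwines (genP l))).
by rewrite signed_braiding0r mulr1.
Qed.

Lemma alpha_intermediate s' i x : P x -> P (al s' i x).
Proof. by move=> Px; rewrite -alpha_restrict//; exact: alphaM. Qed.

Lemma hom_id_intermediate j x : hom M M id (al s j) x -> P x.
Proof.
move=> hx; rewrite alg_Sd; exists 1%N, (fun=> j), (fun=> 1), (fun=> x).
split; last by rewrite big_ord1 mul1r.
by move=> _; split=> //; exact: (sa_one hN).
Qed.

Lemma fusion_expand i j : exists n (mu : 'I_n -> NN X) (u : 'I_n -> B),
  [/\ forall p, hom N N (lam (mu p)) (lam i \o lam j) (u p),
      forall p, hom M M (al s (mu p)) (al s i \o al s j) (u p)
    & \sum_p u p * (u p)^† = 1].
Proof.
have [n [mu [u d]]] := lam_fusion i j; have [uN u1 _] := d.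
have hu p : hom N N (lam (mu p)) (lam i \o lam j) (u p).
  split=> [|x Nx]; first by case: (uN p).
  by rewrite (direct_sum_hom' d).
by exists n, mu, u; split=> // p; exact: alpha_fusion.
Qed.

Lemma hom_id2_intermediate i j x : hom M M id (al s i \o al s j) x -> P x.
Proof.
move=> hx; have [n [mu [u [uN uM u1]]]] := fusion_expand i j.
rewrite -[x]mul1r -u1 mulr_suml; apply: (sa_sum hP) => p _.
have [Nu _] := uN p; rewrite -mulrA; apply: (sa_mul hP (NM Sd Nu)).
apply: (@hom_id_intermediate (mu p)); apply: (hom_mul hM hx).
by apply: hom_adj => //; [exact: alpha_morph|exact: alpha_comp_morph].
Qed.

(** Frobenius reciprocity: [x * crb D] intertwines id with the product of alpha_j and the conjugate
    of alpha_i; fusion expands it over the charged intertwiners generating P, and the conjugate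
    equation returns x. *)
Lemma hom_intermediate i j x : hom M M (al s i) (al s j) x -> P x.
Proof.
move=> hx; have [Mx xE] := hx; pose D := the_conjugate i.
have Nc := sa_adj hN (crN D).
have e1 : (cc D)^-1 *: (lam j (cr D)^† * (x * crb D)) = x.
  rewrite -(alphaN S s j Nc) mulrA -xE; last exact: NM.
  rewrite alphaN// (morph_adj (lam_morph i) (crN D)) -mulrA (crrb D) bop_scaleAr.
  by rewrite mulr1 scalerA mulVf ?scale1r// (cc0 D).
rewrite -e1; apply: (sa_scale hP); apply: (sa_mul hP).
  exact/(NM Sd)/lam_in.
apply: (@hom_id2_intermediate j (cbar D)).
split=> [|y My]; first exact: (sa_mul hM Mx (NM S (crbN D))).
by rewrite -mulrA (crb_hom s i My) mulrA xE ?mulrA//; exact: alphaM.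
Qed.

Lemma hom2_intermediate i j k x : hom M M (al s i) (al s j \o al s k) x -> P x.
Proof.
move=> hx; have [n [mu [u [uN uM u1]]]] := fusion_expand j k.
rewrite -[x]mul1r -u1 mulr_suml; apply: (sa_sum hP) => p _.
have [Nu _] := uN p; rewrite -mulrA; apply: (sa_mul hP (NM Sd Nu)).
apply: (@hom_intermediate i (mu p)); apply: (hom_mul hM hx).
by apply: hom_adj => //; [exact: alpha_morph|exact: alpha_comp_morph].
Qed.

(* [E x = r^* iotabar(x) r] is, up to normalization, a faithful conditional
   expectation of M onto N; it maps [x y^*] to a scalar for charged
   intertwiners [x], [y], which makes it an inner product. *)
Section Expectation.
Local Notation r := (fr (the_frame S)).
Local Notation g := (iotabar S).
Let mg := iotabar_morph S.
Let E x : B := r^† * g x * r.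

Let rN a : N a -> r^† * g a = a * r^†.
Proof.
move=> Na; apply: (@adj_inj R H); rewrite !adjM adjK -(morph_adj mg (NM S Na)).
by rewrite -(frE (the_frame S))//; exact: (sa_adj hN).
Qed.

Let ED x y : M x -> M y -> E (x + y) = E x + E y.
Proof. by move=> Mx My; rewrite /E (morph_add mg)// mulrDr mulrDl. Qed.

Let EZ c x : M x -> E (c *: x) = c *: E x.
Proof. by move=> Mx; rewrite /E (morph_scale mg)// bop_scaleAr bop_scaleAl. Qed.

Let Esum n (f : 'I_n -> B) : (forall l, M (f l)) -> E (\sum_l f l) = \sum_l E (f l).
Proof.
move=> Mf; rewrite /E (morphism_sum mg hM) => [|l _//].
by rewrite mulr_sumr mulr_suml.
Qed.

Let EM x a : M x -> N a -> E (x * a) = E x * a.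
Proof.
move=> Mx Na; rewrite /E (morph_mul mg Mx (NM S Na)).
by rewrite -!mulrA (frE (the_frame S)).
Qed.

Let E_eq0 x : M x -> E (x * x^†) = 0 -> x = 0.
Proof.
move=> Mx; have Mx' := sa_adj hM Mx.
rewrite /E (morph_mul mg Mx Mx') (morph_adj mg Mx) => e.
have gx0 : (g x)^† * r = 0.
  by apply: adjM_eq0; rewrite adjM adjK -e !mulrA.
apply: (@adj_inj R H); rewrite adj0; apply/eqP.
have := rgv Mx => /(congr1 (@bop_adj R H)).
rewrite !adjM adjK gx0 mulr0 adjZ => /esym/eqP.
by rewrite scaler_eq0 conjC_eq0 (negPf (fc0 _)).
Qed.

Let Eschur j k x y : intertwines S i0 j x -> intertwines S i0 k y ->
  exists c : C, E (x * y^†) = (if k == j then c else 0) *: (1 : B).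
Proof.
move=> [Mx hx] [My hy]; have My' := sa_adj hM My; have Mxy := sa_mul hM Mx My'.
apply: lam_hom; split=> [|a Na].
  exact: (sa_mul hN (sa_mul hN (sa_adj hN (frN _)) (iotabarN Mxy)) (frN _)).
have Na' := sa_adj hN Na.
have e : x * y^† * lam k a = lam j a * (x * y^†).
  have := hy _ Na' => /(congr1 (@bop_adj R H)).
  rewrite !adjM -!(morph_adj (lam_morph _) Na') adjK -mulrA => <-.
  by rewrite mulrA hx ?mulrA.
rewrite /E -mulrA (frE (the_frame S)); last exact: lam_in.
rewrite mulrA -(mulrA r^†) -(morph_mul mg Mxy); last exact/(NM S)/lam_in.
rewrite e (morph_mul mg) => //; last exact/(NM S)/lam_in.
by rewrite mulrA rN ?mulrA//; exact: lam_in.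
Qed.

(** For the inner product E(x y^†), x equals its projection y onto the span of the charged [k l] of
    label j, and y is charged. *)
Lemma charged_intertwiner j x : P x -> intertwines S i0 j x -> hom M M id (al s j) x.
Proof.
rewrite alg_Sd => -[n [nu [a [k [ak xE]]]]] hx.
have Na l : N (a l) by case: (ak l).
have hk l : hom M M id (al s (nu l)) (k l) by case: (ak l).
have ik l : intertwines S i0 (nu l) (k l).
  split=> [|b Nb]; first by case: (hk l).
  by have [_ ->] := hk l; rewrite ?lam0 ?alphaN//; exact: NM.
have Mk l : M (k l) by case: (hk l).
(* Intertwiners of different labels are orthogonal by Schur's lemma, so those of label other than j
   are replaced by 0. *)
pose k' l : B := if nu l == j then k l else 0.
have hk' l : hom M M id (al s j) (k' l).
  rewrite /k'; case: eqVneq => [<-//|_]; split=> [|b Mb]; first exact: (sa_zero hM).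
  by rewrite mul0r mulr0.
have ik' l : intertwines S i0 j (k' l).
  split=> [|b Nb]; first by case: (hk' l).
  by have [_ ->] := hk' l; rewrite ?lam0 ?alphaN//; exact: NM.
have Mk' l : M (k' l) by case: (hk' l).
have Mx : M x by case: hx.
have /choice[b bE] l : exists c : C, E (x * (k' l)^†) = c *: (1 : B).
  by have [c ->] := Eschur hx (ik' l); rewrite eqxx; exists c.
have /choice[G0 GE] (lm : 'I_n * 'I_n) : exists c : C, E (k' lm.1 * (k' lm.2)^†) = c *: (1 : B).
  by have [c ->] := Eschur (ik' lm.1) (ik' lm.2); rewrite eqxx; exists c.
pose G : 'M[C]_n := \matrix_(l, m) G0 (l, m).
pose bv : 'rV[C]_n := \row_l b l.
have one0 := @bop_one_neq0 R H X.
(* The Gram matrix G may be singular, so solvability is checked against its cokernel: a cokernel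
   vector z gives a combination y of the [k' l] of norm 0, hence y = 0, and x is orthogonal to
   it. *)
have : (bv <= G)%MS.
  rewrite submxE; apply/eqP/rowP => q; rewrite [RHS]mxE mxE.
  pose z l := cokermx G l q.
  have Gz l : \sum_m G0 (l, m) * z m = 0.
    have /matrixP/(_ l q) := mulmx_coker G; rewrite [RHS]mxE mxE => h.
    by rewrite -[RHS]h; apply: eq_bigr => m _; rewrite [G l m]mxE.
  pose y := \sum_l (z l)^* *: k' l.
  have My : M y by apply: (sa_sum hM) => l _; exact: (sa_scale hM).
  have Ey u : M u -> E (u * y^†) = \sum_l z l *: E (u * (k' l)^†).
    move=> Mu; rewrite /y adj_sum mulr_sumr Esum => [|l].
      apply: eq_bigr => l _; rewrite adjZ conjCK bop_scaleAr EZ//.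
      exact: (sa_mul hM Mu (sa_adj hM (Mk' l))).
    exact: (sa_mul hM Mu (sa_adj hM (sa_scale hM _ (Mk' l)))).
  have y0 : y = 0.
    apply: E_eq0 => //; rewrite Ey// /y.
    under eq_bigr => l _.
      rewrite mulr_suml Esum => [|m]; last first.
        exact: (sa_mul hM (sa_scale hM _ (Mk' m)) (sa_adj hM (Mk' l))).
      under eq_bigr => m _.
        rewrite bop_scaleAl EZ; last exact: (sa_mul hM (Mk' m) (sa_adj hM (Mk' l))).
        rewrite (GE (m, l)) scalerA.
        over.
      rewrite -scaler_suml scalerA mulr_sumr.
      over.
    rewrite -scaler_suml exchange_big/= big1 ?scale0r// => m _.
    under eq_bigr do rewrite mulrC -mulrA.
    by rewrite -mulr_sumr Gz mulr0.
  apply: (scaler1_inj one0); rewrite scale0r scaler_suml.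
  have := Ey _ Mx; rewrite y0 adj0 mulr0.
  have -> : E 0 = 0 by rewrite -(scale0r (1 : B)) EZ ?scale0r//; exact: (sa_one hM).
  move=> h; rewrite [RHS]h; apply: eq_bigr => l _.
  by rewrite bE scalerA mxE mulrC.
move=> /submxP[cv /rowP bvE].
pose y := \sum_l cv 0 l *: k' l.
have hy : hom M M id (al s j) y.
  by apply: (hom_sum hM) => l _; exact: hom_scale.
suff -> : x = y by [].
have My : M y by case: hy.
have Mxy : M (x - y) := sa_add hM Mx (sa_opp hM My).
have ixy : intertwines S i0 j (x - y).
  split=> // d Nd; have [_ yE] := hy; have [_ xE'] := hx.
  rewrite mulrBl mulrBr xE'// lam0// yE; last exact: NM.
  by rewrite alphaN.
have Ek l : E ((x - y) * (k l)^†) = 0.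
  have [nuj|nuj] := eqVneq (nu l) j; last first.
    by have [c ->] := Eschur ixy (ik l); rewrite (negPf nuj) scale0r.
  have -> : k l = k' l by rewrite /k' nuj eqxx.
  rewrite mulrBl -scaleN1r ED; [|exact: (sa_mul hM Mx (sa_adj hM (Mk' l)))|]; last first.
    exact: (sa_scale hM _ (sa_mul hM My (sa_adj hM (Mk' l)))).
  rewrite EZ; last exact: (sa_mul hM My (sa_adj hM (Mk' l))).
  rewrite bE /y mulr_suml Esum => [|m]; last first.
    exact: (sa_mul hM (sa_scale hM _ (Mk' m)) (sa_adj hM (Mk' l))).
  have := bvE l; rewrite !mxE => ->.
  rewrite scaleN1r; apply/eqP; rewrite subr_eq0 scaler_suml; apply/eqP.
  apply: eq_bigr => m _; rewrite bop_scaleAl EZ; last first.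
    exact: (sa_mul hM (Mk' m) (sa_adj hM (Mk' l))).
  by rewrite (GE (m, l)) scalerA mxE.
(* The difference x - y is still a combination of the [k l] over N and is orthogonal to each of
   them, so its own square has expectation 0. *)
pose a' l : B := a l - if nu l == j then cv 0 l *: (1 : B) else 0.
have Na' l : N (a' l).
  apply: (sa_add hN (Na l)); apply: (sa_opp hN).
  case: ifP => _; [exact: (sa_scale hN _ (sa_one hN))|exact: (sa_zero hN)].
have xyE : x - y = \sum_l a' l * k l.
  rewrite xE /y -sumrB; apply: eq_bigr => l _; rewrite /a' mulrBl /k'.
  by case: ifP => _; rewrite ?scaler0 ?mul0r// bop_scaleAl mul1r.
apply/eqP; rewrite -subr_eq0; apply/eqP/E_eq0 => //.
rewrite {2}xyE adj_sum mulr_sumr Esum => [|l]; last first.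
  exact: (sa_mul hM Mxy (sa_adj hM (sa_mul hM (NM S (Na' l)) (Mk l)))).
rewrite big1// => l _; rewrite adjM mulrA EM ?Ek ?mul0r//.
  exact: (sa_mul hM Mxy (sa_adj hM (Mk l))).
exact: (sa_adj hN).
Qed.

End Expectation.

End Intermediate.

(** * Chiral locality, and local sectors as ambichiral ones *)

Section Locality.
Context {R : realType} {H : hilbert R} {X : braided_system H}.
Local Notation C := R[i].
Local Notation B := (bop H).
Local Notation N := (algN X).
Local Notation lam := (lam (b := X)).
Local Notation i0 := (NN0 X).
Local Notation be := (signed_braiding (X := X)).
Variables (S Sd : subfactor X) (s : bool).
Hypothesis alg_Sd : alg Sd = chiral_alg S s.
Implicit Types (i j : NN X) (x y a e u w : B).
Local Notation M := (alg S).
Local Notation P := (alg Sd).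
Local Notation al s i := (alpha S s (lam i)).
Local Notation ald s i := (alpha Sd s (lam i)).

Let hN : star_algebra N := algN_star.
Let hM : star_algebra M := alg_star S.
Let hP : star_algebra P := alg_star Sd.
Let PM x : P x -> M x. Proof. exact: (intermediate_sub alg_Sd). Qed.

Lemma charged_sum_hom (T T0 : subfactor X) s' i j n (nu : 'I_n -> NN X) (a y : 'I_n -> B) :
  (forall l, hom N N (lam j) (lam (nu l) \o lam i) (a l)^†) ->
  (forall l, hom (alg T) (alg T) id (alpha T s' (lam (nu l))) (y l)) ->
  hom (alg T) (alg T) (alpha T s' (lam i)) (alpha T s' (lam j)) (\sum_l a l * y l).
Proof.
move=> ha hy; have hT := alg_star T; apply: (hom_sum hT) => l _.
have := alpha_fusion T s' (ha l).
move/(hom_adj hT hT (alpha_morph _ _ _) (alpha_comp_morph _ _ _ _ _)).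
rewrite adjK => hal; apply: (hom_mul hT) hal.
have [Ty yE] := hy l; split=> // x Tx /=.
by rewrite yE//; exact: alphaM.
Qed.

(* In the expansion of [x] in the [gen l] the coefficients are intertwiners in N,
   to which [alpha_fusion] applies, and the [gen l] of M_s are charged for [s]. *)
Lemma intermediate_hom i j x : P x -> intertwines S i j x -> hom M M (al s i) (al s j) x.
Proof.
move=> Px [Mx hx]; have ix : intertwines Sd i j x by split.
rewrite -(coef_sum Px); apply: (charged_sum_hom Sd) => l.
  exact: coef_intertwines.
apply: (charged_intertwiner alg_Sd); first exact: genM.
exact: (intermediate_intertwines alg_Sd (genP l)).
Qed.

Lemma intermediate_hom2 i j k x : P x ->
  (forall a, N a -> x * lam i a = lam j (lam k a) * x) ->
  hom M M (al s i) (al s j \o al s k) x.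
Proof.
move=> Px hx; have [n [mu [u [uN uM u1]]]] := fusion_expand S s j k.
rewrite -[x]mul1r -u1 mulr_suml; apply: (hom_sum hM) => p _.
rewrite -mulrA; apply: (hom_mul hM) (uM p).
have [Nu uE] := uN p; have Pu := NM Sd (sa_adj hN Nu).
have Pux := sa_mul hP Pu Px.
apply: intermediate_hom => //; split=> [|a Na]; first exact: PM.
rewrite -mulrA hx// !mulrA; congr (_ * _).
have := uE _ (sa_adj hN Na) => /(congr1 (@bop_adj R H)).
rewrite !adjM /= -!(morph_adj (lam_morph _)) ?adjK => [->//|||];
  do ?apply: lam_in; exact: (sa_adj hN).
Qed.

(** [gen l] is charged as well: moving x through it gives gen_l x = eps^s(l, j)^† x gen_l, and this
    solved for x gen_l is the rule of the opposite sign for x. *)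
Lemma charged_signs s' j x : P x -> intertwines S i0 j x -> hom P P id (ald s' j) x.
Proof.
move=> Px ix; have [Mx hx] := charged_intertwiner alg_Sd Px ix.
have xN a : N a -> x * a = lam j a * x.
  by move=> Na; rewrite hx ?alphaN//; exact: NM.
have mid : is_morphism P P id by split.
have xg l : x * gen (S := Sd) l = al s j (gen l) * x by apply/hx/PM/genM.
apply: hom_gen => //; first exact: alpha_morph.
  by move=> a Na; rewrite alphaN// xN.
move=> l; rewrite alpha_gen.
have ig := intermediate_intertwines alg_Sd (@genP _ _ _ Sd l).
have [Mg hg] := charged_intertwiner alg_Sd (genM l) ig.
have [->|] := eqVneq s' s.
  rewrite /= xg (alpha_intertwiner _ _ ig) signed_braiding0r mulr1//.
move=> ss; have -> : s' = ~~ s by case: (s') (s) ss => -[].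
have := hg _ Mx; rewrite (alpha_intertwiner _ _ ix) signed_braiding0r mulr1 /= => e.
rewrite signed_braiding_adj negbK -mulrA e !mulrA signed_braidingK mul1r//.
Qed.

Lemma intermediate_hom_signs s' i j x : P x -> intertwines S i j x ->
  hom P P (ald s' i) (ald s' j) x.
Proof.
move=> Px [Mx hx]; have ix : intertwines Sd i j x by split.
rewrite -(coef_sum Px); apply: (charged_sum_hom Sd) => l.
  exact: coef_intertwines.
apply: charged_signs; first exact: genM.
exact: (intermediate_intertwines alg_Sd (genP l)).
Qed.

Lemma hom_chiralE i j : hom M M (al s i) (al s j) = hom P P (ald s i) (ald s j).
Proof.
apply/seteqP; split=> x hx.
  apply: intermediate_hom_signs; last exact: (hom_intertwines hx).
  exact: (hom_intermediate alg_Sd hx).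
have [Px xE] := hx; apply: intermediate_hom => //.
by have [_ h] := hom_intertwines hx; split=> //; exact: PM.
Qed.

Definition local_at i w : Prop := forall x, P x -> al true i x * w = al false i x * w.

Lemma local_atE i w : local_at i w <->
  forall x, P x -> al s i x * w = al (~~ s) i x * w.
Proof. by case: s; split=> h x Px /=; rewrite h. Qed.

Lemma local_at_gen i w :
  (forall j x, P x -> intertwines S i0 j x -> al s i x * w = al (~~ s) i x * w) ->
  local_at i w.
Proof.
move=> h; apply/local_atE => x Px.
have Pc l := NM Sd (coefN l Px).
have Pg l := genM (S := Sd) l.
rewrite -(coef_sum Px) !(morphism_sum (alpha_morph S _ i) hM); first last.
- by move=> l _; exact: (sa_mul hM (PM (Pc l)) (PM (Pg l))).
- by move=> l _; exact: (sa_mul hM (PM (Pc l)) (PM (Pg l))).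
rewrite !mulr_suml; apply: eq_bigr => l _.
rewrite !(morph_mul (alpha_morph S _ i) (PM (Pc l)) (PM (Pg l))) -!mulrA.
rewrite !(alphaN S _ i (coefN l Px)); congr (_ * _).
by apply: (h (fnu l)) => //; exact: (intermediate_intertwines alg_Sd (genP l)).
Qed.

(** Put t = w w'^† and let x be charged of label k. Then x t = alpha^s_k(t) x = eps^s(k, i)^† t
    eps^s(k, j) x, and eps^s(k, j) x = alpha^{-s}_j(x), past which t moves. Hence alpha^s_i(x) t =
    eps^s(k, i) x t = alpha^{-s}_i(x) t. *)
Lemma ambichiral_local tau i j w w' : is_morphism M M tau ->
  hom M M tau (al s i) w -> hom M M tau (al (~~ s) j) w' -> isometry w' ->
  local_at i w.
Proof.
move=> mt hw hw' iw'; apply: local_at_gen => k x Px ix.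
have ht := hom_mul hM (hom_adj hM hM mt (alpha_morph _ _ _) hw') hw.
rewrite (_ : w = w * w'^† * w'); last by rewrite -mulrA iw' mulr1.
rewrite !mulrA -!(mulrA _ w); congr (_ * _).
set t := w * w'^† in ht *; have it := hom_intertwines ht.
have [Mt tE] := ht; have [Mx hx] := charged_intertwiner alg_Sd Px ix.
have xt : x * t = (be s k i)^† * t * be s k j * x.
  by rewrite hx// (alpha_intertwiner s k it).
have xt' : x * t = (be s k i)^† * (al s i x * t).
  rewrite xt -tE//; have := alpha_intertwiner (~~ s) j ix.
  by rewrite signed_braiding0r mulr1 signed_braiding_adj negbK => ->; rewrite !mulrA.
have alE s' : al s' i x = (be s' i k)^† * x.
  by rewrite (alpha_intertwiner s' i ix) signed_braiding0r mulr1.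
rewrite [RHS](_ : _ = be s k i * (x * t)); last first.
  by rewrite alE signed_braiding_adj negbK mulrA.
by rewrite xt' mulrA signed_braidingK mul1r.
Qed.

Section LocalAmbichiral.
Variables (tau : B -> B) (i : NN X) (w : B).
Hypotheses (mt : is_morphism M M tau) (tau_irr : irreducible M M tau)
  (hw : hom M M tau (al s i) w) (iw : isometry w) (lw : local_at i w).

Local Notation F := (the_frame S).
Local Notation v := (fv F).
Local Notation t := (ft (f := F)).
Local Notation nu := (fnu (f := F)).
Local Notation g := (iotabar S).

Let Mv : M v := fvM F.
Implicit Types (k l m : 'I_(fn F)).

Let Mt k : M (t k) := NM S (ftN k).

Let W s' k : B := (al s' (nu k) v)^† * gen (S := S) k.

Let W_hom s' k : hom M M g (al s' (nu k)) (W s' k).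
Proof.
apply: average_hom; [exact: alpha_morph|exact: genM|].
by move=> a Na; rewrite genE// alphaN.
Qed.

Let alpha_v s' j : al s' j v = \sum_l lam j (t l) * (be s' j (nu l))^† * gen (S := S) l.
Proof.
rewrite -{1}sum_gen (morphism_sum (alpha_morph S s' j) hM) => [|l _].
  apply: eq_bigr => l _; rewrite (morph_mul (alpha_morph _ _ _) (Mt l) (genM l)).
  by rewrite (alphaN S s' j (ftN l)) alpha_gen mulrA.
exact: (sa_mul hM (Mt l) (genM l)).
Qed.

Let W_t s' k l : W s' k * t l = (gen (S := S) l)^† * be s' (nu k) (nu l) * gen (S := S) k.
Proof.
rewrite /W -mulrA (genE k (ftN l)) mulrA alpha_v adj_sum mulr_suml; congr (_ * _).
rewrite (bigD1 l)//= big1 ?addr0 => [|p /negPf pl].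
  by rewrite !adjM adjK -!mulrA lam_ft_orth eqxx mulr1.
by rewrite !adjM adjK -!mulrA lam_ft_orth pl !mulr0.
Qed.

(** Exchanging the labels reverses the sign of the braiding: averages of sign -s become averages of
    sign s, which puts T into M_s. *)
Let W_swap k l : (W (~~ s) k * t l)^† = W s l * t k.
Proof.
by rewrite !W_t !adjM adjK signed_braiding_adj negbK mulrA.
Qed.

Let T : B := \sum_k (W (~~ s) k)^† * W (~~ s) k.

Let T_comp l m : (t l)^† * T * t m = W s l * (W s m)^†.
Proof.
rewrite /T mulr_sumr mulr_suml.
transitivity (\sum_k W s l * (t k * (t k)^†) * (W s m)^†); last first.
  by rewrite -mulr_suml -mulr_sumr ft1 mulr1.
apply: eq_bigr => k _.
rewrite (_ : _ * _ * t m = (W (~~ s) k * t l)^† * (W (~~ s) k * t m)); last first.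
  by rewrite adjM !mulrA.
by rewrite -[W _ _ * t m]adjK !W_swap adjM !mulrA.
Qed.

Let T_comp_hom l m : hom M M (al s (nu m)) (al s (nu l)) ((t l)^† * T * t m).
Proof.
rewrite T_comp; apply: (hom_mul hM) (W_hom s l).
apply: (hom_adj hM hM) (W_hom s m); last exact: alpha_morph.
have mg := iotabar_morph S; split; try by case: mg.
by move=> x Mx; exact/(NM S)/(iotabarN Mx).
Qed.

Let T_expand : T = \sum_l \sum_m t l * ((t l)^† * T * t m) * (t m)^†.
Proof.
transitivity ((\sum_l t l * (t l)^†) * T * (\sum_m t m * (t m)^†)).
  by rewrite !ft1 mul1r mulr1.
rewrite !mulr_suml; apply: eq_bigr => l _; rewrite mulr_sumr.
by apply: eq_bigr => m _; rewrite !mulrA.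
Qed.

Let TP : P T.
Proof.
rewrite T_expand; apply: (sa_sum hP) => l _; apply: (sa_sum hP) => m _.
have Pt k := NM Sd (ftN (S := S) k).
apply: (sa_mul hP _ (sa_adj hP (Pt m))); apply: (sa_mul hP (Pt l)).
exact: (hom_intermediate alg_Sd (T_comp_hom l m)).
Qed.

Local Notation U := (theta_braiding S (~~ s) i).

(** The induction acts on each matrix entry of T by braiding operators, which assemble to U. *)
Let alpha_T : al (~~ s) i T = U^† * T * U.
Proof.
have MT l m : M ((t l)^† * T * t m) by have [] := T_comp_hom l m.
have MtT l m : M (t l * ((t l)^† * T * t m)) := sa_mul hM (Mt l) (MT l m).
have Mlm l m : M (t l * ((t l)^† * T * t m) * (t m)^†) := sa_mul hM (MtT l m) (sa_adj hM (Mt m)).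
have ma := alpha_morph S (~~ s) i.
rewrite {1}T_expand (morphism_sum ma hM); last first.
  by move=> l _; apply: (sa_sum hM) => m _; exact: Mlm.
have -> (V : B) : V^† * T * V =
    \sum_l \sum_m V^† * (t l * ((t l)^† * T * t m) * (t m)^†) * V.
  rewrite {1}T_expand mulr_sumr mulr_suml; apply: eq_bigr => l _.
  by rewrite mulr_sumr mulr_suml.
apply: eq_bigr => l _; rewrite (morphism_sum ma hM) => [|m _]; last exact: Mlm.
apply: eq_bigr => m _.
rewrite (morph_mul ma (MtT l m) (sa_adj hM (Mt m))) (morph_mul ma (Mt l) (MT l m)).
rewrite (alpha_intertwiner _ _ (hom_intertwines (T_comp_hom l m))).
rewrite (morph_adj ma (Mt m)) !(alphaN S _ i (ftN _)).
rewrite [RHS](_ : _ = ((t l)^† * U)^† * ((t l)^† * T * t m) * ((t m)^† * U)); last first.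
  by rewrite adjM adjK !mulrA.
by rewrite !ft_theta_braiding adjM adjK !mulrA.
Qed.

Let W_v_hom k : hom M M id (al (~~ s) (nu k)) (W (~~ s) k * v).
Proof.
apply: (hom_mul hM) (W_hom (~~ s) k).
by split=> // x Mx; rewrite (fvE F).
Qed.

(** If all vanished, so would v^† r^† v v, which is the nonzero constant [fc]. Here r^† t_k is a
    scalar, zero unless [nu k] is the label of id, and there the induction is the identity. *)
Let W_v_neq0 : exists k, W (~~ s) k * v <> 0.
Proof.
apply: contrapT => nex; have W0 k : W (~~ s) k * v = 0.
  by apply: contrapT => Wk; apply: nex; exists k.
have rt k : (fr F)^† * t k * (al (~~ s) (nu k) v)^† = v^† * ((fr F)^† * t k).
  have [|c rtE] := @lam_hom R H X (nu k) i0 ((fr F)^† * t k).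
    split=> [|a Na]; first exact: (sa_mul hN (sa_adj hN (frN F)) (ftN k)).
    rewrite lam0// -mulrA -ftE// !mulrA; congr (_ * _).
    apply: (@adj_inj R H); rewrite !adjM adjK (frE F); last exact: (sa_adj hN).
    by rewrite (morph_adj (iotabar_morph S))//; exact: NM.
  rewrite rtE; case: eqVneq => [->|_]; last by rewrite scale0r mul0r mulr0.
  by rewrite alpha0// bop_scaleAl mul1r bop_scaleAr mulr1.
have : v^† * ((fr F)^† * v) * v = 0.
  rewrite -{2}(sum_gen S) !mulr_sumr mulr_suml big1// => k _.
  have W0' : (al (~~ s) (nu k) v)^† * (gen k * v) = 0 by rewrite mulrA; exact: W0.
  rewrite (_ : _ * v = v^† * ((fr F)^† * t k) * (gen k * v)); last by rewrite !mulrA.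
  by rewrite -rt -mulrA W0' mulr0.
rewrite (frv F) bop_scaleAr mulr1 bop_scaleAl (fv_iso F) => /eqP.
rewrite scaler_eq0 (negPf (fc0 F)) /= => /eqP.
exact: (@bop_one_neq0 R H X).
Qed.

(** The average of [gen k] regarded as an N-intertwiner from lambda_i to the product of the
    endomorphism of label [nu k] with lambda_i. *)
Let q k : B := (al (~~ s) (nu k) (al (~~ s) i v))^† * gen k * al s i v.

Let qE k : q k = W (~~ s) k * U * al s i v.
Proof.
have aUv : al (~~ s) i v = U^† * v.
  rewrite alpha_v /theta_braiding adj_sum mulr_suml; apply: eq_bigr => l _.
  by rewrite gen_def !adjM adjK !mulrA.
have NU := theta_braidingN S (~~ s) i; have NU' := sa_adj hN NU.
rewrite /q aUv (morph_mul (alpha_morph S _ (nu k)) (NM S NU') Mv) adjM.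
rewrite (alphaN S _ _ NU') -(morph_adj (lam_morph _) NU') adjK.
by rewrite /W -!mulrA (mulrA (lam _ _)) -(genE k NU) !mulrA.
Qed.

(** The squares of the [q k * w] add up to w^† alpha^s_i(v)^† alpha^{-s}_i(T) alpha^s_i(v) w.
    Locality reverses the sign in the middle, and the sum becomes the scalar v^† T v, nonzero by
    [W_v_neq0]. Fusion then cuts a nonzero [q k * w] down to a single alpha^{-s}_j. *)
Lemma local_ambichiral : exists j, subsector M M tau (al (~~ s) j).
Proof.
have ma := alpha_morph S; have Mav := morph_in (ma s i) Mv.
have q_hom k : hom M M (al s i) (al (~~ s) (nu k) \o al (~~ s) i) (q k).
  apply: average_hom2; [exact: ma|exact: alpha_comp_morph|exact: genM|].
  by move=> a Na; rewrite (alphaN S s i Na) genE ?(alphaN S _ _ Na)//= ?alphaN//; exact: lam_in.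
have [k qkw] : exists k, q k * w <> 0.
  apply: contrapT => nex; have q0 k : q k * w = 0.
    by apply: contrapT => qk; apply: nex; exists k.
  have /choice[c cE] k : exists c : C, (W (~~ s) k * v)^† * (W (~~ s) k * v) = c *: (1 : B).
    have hWv := W_v_hom k; have mid : is_morphism M M id by split.
    have [Mz zE] := hom_mul hM hWv (hom_adj hM hM mid (ma _ _) hWv).
    by apply: factor_scalar Mz _ => y My; exact: zE.
  have sumW (V : B) : \sum_k (W (~~ s) k * V)^† * (W (~~ s) k * V) = V^† * T * V.
    by rewrite /T mulr_sumr mulr_suml; apply: eq_bigr => k _; rewrite adjM !mulrA.
  have vTv : v^† * T * v = (\sum_k c k) *: (1 : B).
    by rewrite -sumW scaler_suml; apply: eq_bigr => k _; rewrite cE.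
  have MT := PM TP; have wE := proj2 hw.
  (* Writing alpha^s_i(v) w as w tau(v) puts w next to the image of T, where locality applies. *)
  have alw : al (~~ s) i T * (al s i v * w) = al s i T * (al s i v * w).
    by rewrite -wE// mulrA -(proj1 (local_atE i w) lw T TP) -mulrA wE.
  have c0 : \sum_k c k = 0.
    apply: (scaler1_inj (@bop_one_neq0 R H X)); rewrite scale0r.
    transitivity (\sum_k (W (~~ s) k * (U * al s i v * w))^† *
                          (W (~~ s) k * (U * al s i v * w))); last first.
      rewrite big1// => k _.
      have -> : W (~~ s) k * (U * al s i v * w) = 0 by rewrite -(q0 k) qE !mulrA.
      by rewrite mulr0.
    rewrite sumW !adjM.
    transitivity (w^† * (al s i v)^† * (al (~~ s) i T * (al s i v * w))); last first.
      by rewrite alpha_T !mulrA.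
    rewrite alw -(morph_adj (ma s i) Mv) -vTv.
    have Mv' := sa_adj hM Mv; have MvT := sa_mul hM Mv' MT.
    transitivity (w^† * al s i (v^† * T * v) * w).
      rewrite vTv (morph_scale (ma s i)) ?(morph_one (ma s i)); last exact: sa_one.
      by rewrite bop_scaleAr bop_scaleAl mulr1 iw.
    by rewrite (morph_mul (ma s i) MvT Mv) (morph_mul (ma s i) Mv' MT) !mulrA.
  have [k Wk] := W_v_neq0; apply: Wk.
  have vT0 : \sum_k (W (~~ s) k * v)^† * (W (~~ s) k * v) = 0.
    by rewrite sumW vTv c0 scale0r.
  exact: (sum_adjM_eq0 vT0).
have [n [mu [u [_ uM u1]]]] := fusion_expand S (~~ s) (nu k) i.
have [p upq] : exists p, (u p)^† * (q k * w) <> 0.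
  apply: contrapT => nex; apply: qkw; rewrite -[LHS]mul1r -u1 mulr_suml big1// => p _.
  rewrite -mulrA; suff -> : (u p)^† * (q k * w) = 0 by rewrite mulr0.
  by apply: contrapT => upq; apply: nex; exists p.
have hz : hom M M tau (al (~~ s) (mu p)) ((u p)^† * (q k * w)).
  apply: (hom_mul hM (hom_mul hM hw (q_hom k))).
  by apply: (hom_adj hM hM) (uM p); [exact: ma|exact: alpha_comp_morph].
have [d [_ hd di]] := irreducible_isometry hM hM mt (ma _ _) tau_irr hz upq.
by exists (mu p); eexists; [exact: hd|].
Qed.

End LocalAmbichiral.

End Locality.

(** * Transfer of sectors between M and its intermediate subfactors *)

Section Transfer.
Context {R : realType} {H : hilbert R}.
Local Notation B := (bop H).

(* If [t t^* = t' t'^*], then [t'^* t] is a unitary of M carrying the sector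
   cut out of M by [t] to an extension of the one cut out of P by [t']. *)
Lemma transfer_hom (M P : set B) (t1 k1 A1 D1 t2 k2 A2 D2 : B -> B) w1 w1' w2 w2' :
  star_algebra M -> star_algebra P ->
  is_morphism M M t1 -> is_morphism M M A1 -> is_morphism M M t2 -> is_morphism M M A2 ->
  is_morphism P P k1 -> is_morphism P P D1 -> is_morphism P P k2 -> is_morphism P P D2 ->
  hom M M A1 A2 = hom P P D1 D2 ->
  hom M M t1 A1 w1 -> isometry w1 -> hom P P k1 D1 w1' -> isometry w1' ->
  w1 * w1^† = w1' * w1'^† ->
  hom M M t2 A2 w2 -> isometry w2 -> hom P P k2 D2 w2' -> isometry w2' ->
  w2 * w2^† = w2' * w2'^† ->
  exists a b, [/\ unitary a, unitary b
    & forall u, hom M M t1 t2 u <-> hom P P k1 k2 (a * u * b)].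
Proof.
move=> hM hP mt1 mA1 mt2 mA2 mk1 mD1 mk2 mD2 AD hw1 i1 hw1' i1' e1 hw2 i2 hw2' i2' e2.
have un (w w' : B) : isometry w -> isometry w' -> w * w^† = w' * w'^† -> unitary (w'^† * w).
  move=> iw iw' e; rewrite /unitary adjM adjK; split.
    by rewrite -mulrA (mulrA w') -e -!mulrA iw mulr1 iw.
  by rewrite -mulrA (mulrA w) e -!mulrA iw' mulr1 iw'.
exists (w2'^† * w2), (w1^† * w1'); split; [exact: un|exact: un|].
move=> u; split=> hu.
  have : hom M M A1 A2 (w2 * u * w1^†).
    apply: (hom_mul hM (hom_adj hM hM mt1 mA1 hw1)).
    exact: (hom_mul hM hu hw2).
  rewrite AD => h.
  have -> : w2'^† * w2 * u * (w1^† * w1') = w2'^† * (w2 * u * w1^†) * w1'.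
    by rewrite !mulrA.
  apply: (hom_mul hP hw1'); apply: (hom_mul hP h).
  exact: (hom_adj hP hP mk2 mD2 hw2').
have : hom P P D1 D2 (w2' * (w2'^† * w2 * u * (w1^† * w1')) * w1'^†).
  apply: (hom_mul hP (hom_adj hP hP mk1 mD1 hw1')).
  exact: (hom_mul hP hu hw2').
rewrite -AD => h.
have -> : u = w2^† * (w2' * (w2'^† * w2 * u * (w1^† * w1')) * w1'^†) * w1.
  rewrite !mulrA -(mulrA _ w2' _) -e2 -(mulrA _ w1' _) -e1 !mulrA i2 mul1r.
  by rewrite i2 mul1r (mulrE _ i1) mulr1 (mulrE _ i1) mulr1.
apply: (hom_mul hM hw1); apply: (hom_mul hM h).
exact: (hom_adj hM hM mt2 mA2 hw2).
Qed.

Lemma unitary_transfer_neq0 (a b : B) : (1 : B) <> 0 -> unitary a -> unitary b -> a * 1 * b <> 0.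
Proof.
move=> one0 [a1 a2] [b1 b2] ab; apply: one0.
have := congr1 (fun z => a^† * z * b^†) ab.
by rewrite mulr1 mulr0 mul0r !mulrA a1 mul1r b2.
Qed.

End Transfer.

(** * The bijections vartheta and the two coupling matrices *)

Section Chiral.
Context {R : realType} {H : hilbert R} {X : braided_system H}.
Local Notation C := R[i].
Local Notation B := (bop H).
Local Notation N := (algN X).
Local Notation lam := (lam (b := X)).
Local Notation i0 := (NN0 X).
Variables (S Sd : subfactor X) (s : bool) (XM : full_system S)
  (XMd : chiral_system Sd s).
Hypothesis alg_Sd : alg Sd = chiral_alg S s.
Implicit Types (i j : NN X) (x y a e u w : B).
Local Notation M := (alg S).
Local Notation P := (alg Sd).
Local Notation al s i := (alpha S s (lam i)).
Local Notation ald s i := (alpha Sd s (lam i)).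
Local Notation tau := (rep (s := XM)).
Local Notation kap := (rep (s := XMd)).
Local Notation X0 := (ambichiral S tau).
Local Notation rel := (@vartheta_rel _ _ _ _ XM Sd s XMd).

Let hN : star_algebra N := algN_star.
Let hM : star_algebra M := alg_star S.
Let hP : star_algebra P := alg_star Sd.
Let one0 : (1 : B) <> 0 := @bop_one_neq0 R H X.
Let PM x : P x -> M x. Proof. exact: (intermediate_sub alg_Sd). Qed.

Lemma in_chiral s' k : (k \in chiral S tau s') <->
  exists i, subsector M M (tau k) (al s' i).
Proof. by rewrite inE; split=> [/asboolP|h]; last exact/asboolP. Qed.

Lemma in_chiral_sub s' k' : (k' \in chiral Sd kap s') <->
  exists i, subsector P P (kap k') (ald s' i).
Proof. by rewrite inE; split=> [/asboolP|h]; last exact/asboolP. Qed.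

Lemma in_ambichiral k : (k \in X0) = (k \in chiral S tau s) && (k \in chiral S tau (~~ s)).
Proof. by rewrite finset.in_setI; case: s => //=; rewrite andbC. Qed.

Lemma in_ambichiral_sub k' : (k' \in ambichiral Sd kap) =
  (k' \in chiral Sd kap s) && (k' \in chiral Sd kap (~~ s)).
Proof.
have h (A : pred bool) b : A true && A false = A b && A (~~ b).
  by case: b => //=; rewrite andbC.
by rewrite finset.in_setI; exact: (h (fun b => k' \in chiral Sd kap b)).
Qed.

Lemma alphaPE s' i x : P x -> ald s' i x = al s' i x.
Proof. exact: (alpha_restrict alg_Sd). Qed.

Lemma hom_chiral2E i j k0 : hom M M (al s i) (al s j \o al s k0) =
  hom P P (ald s i) (ald s j \o ald s k0).
Proof.
apply/seteqP; split=> x hx.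
  have Px := hom2_intermediate alg_Sd hx; have [Mx xE] := hx.
  split=> // y Py; rewrite /= !alphaPE//; first by rewrite xE//; exact: PM.
  exact: (alpha_intermediate alg_Sd).
have [Px xE] := hx; apply: (intermediate_hom2 alg_Sd) => // a Na.
by have := xE _ (NM Sd Na); rewrite /= !alphaN//; exact: lam_in.
Qed.

Let rm k : is_morphism M M (tau k) := rep_morph k.
Let km k' : is_morphism P P (kap k') := rep_morph k'.
Let am i : is_morphism M M (al s i) := alpha_morph S s i.
Let dm i : is_morphism P P (ald s i) := alpha_morph Sd s i.

Lemma vartheta_rel_hom k k' l l' : rel k k' -> rel l l' ->
  exists a b, [/\ unitary a, unitary b
    & forall u, hom M M (tau k) (tau l) u <-> hom P P (kap k') (kap l') (a * u * b)].
Proof.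
move=> [i [t [t' [[ht it] [ht' it'] e]]]] [j [t2 [t2' [[ht2 it2] [ht2' it2'] e2]]]].
exact: (transfer_hom hM hP (rm k) (am i) (rm l) (am j) (km k') (dm i) (km l') (dm j)
  (hom_chiralE alg_Sd i j) ht it ht' it' e ht2 it2 ht2' it2' e2).
Qed.

(** [transfer_hom] with alpha_j as a subsector of itself, cut out by the isometry 1. *)
Lemma vartheta_rel_branching k k' j : rel k k' ->
  branching s k j = bracket P P (kap k') (ald s j).
Proof.
move=> [i [t [t' [[ht it] [ht' it'] e]]]].
have i1 : isometry (1 : B) by rewrite /isometry adj1 mul1r.
have [a [b [ua ub h]]] := transfer_hom hM hP (rm k) (am i) (am j) (am j)
  (km k') (dm i) (dm j) (dm j) (hom_chiralE alg_Sd i j) ht it ht' it' e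
  (hom_one _ _ hM) i1 (hom_one _ _ hP) i1 erefl.
exact: (dim_unitary_mul ua ub h).
Qed.

(** A product of sectors is cut out by alpha_i(t2) t, whose range projection alpha_i(t2 t2^†) t t^†
    depends only on the given range projections; it is therefore the same over M and over M_s. *)
Lemma vartheta_rel_fusion k k' l l' m m' : rel k k' -> rel l l' -> rel m m' ->
  bracket M M (tau m) (tau k \o tau l) = bracket P P (kap m') (kap k' \o kap l').
Proof.
move=> [i [t [t' [[ht it] [ht' it'] e]]]] [j [t2 [t2' [[ht2 it2] [ht2' it2'] e2]]]].
move=> [p [t3 [t3' [[ht3 it3] [ht3' it3'] e3]]]].
have [Mt tE] := ht; have [Mt2 t2E] := ht2; have [Pt' tE'] := ht'; have [Pt2' t2E'] := ht2'.
have hc : hom M M (tau k \o tau l) (al s i \o al s j) (al s i t2 * t).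
  split=> [|x Mx]; first exact: (sa_mul hM (morph_in (am i) Mt2) Mt).
  rewrite /= -mulrA tE; last exact: (morph_in (rm l)).
  rewrite !mulrA -(morph_mul (am i) Mt2); last exact: (morph_in (rm l)).
  by rewrite t2E// (morph_mul (am i)) ?mulrA//; exact: (morph_in (am j)).
have hc' : hom P P (kap k' \o kap l') (ald s i \o ald s j) (ald s i t2' * t').
  split=> [|x Px]; first exact: (sa_mul hP (morph_in (dm i) Pt2') Pt').
  rewrite /= -mulrA tE'; last exact: (morph_in (km l')).
  rewrite !mulrA -(morph_mul (dm i) Pt2'); last exact: (morph_in (km l')).
  by rewrite t2E'// (morph_mul (dm i)) ?mulrA//; exact: (morph_in (dm j)).
have ic : isometry (al s i t2 * t).
  rewrite /isometry adjM -(morph_adj (am i) Mt2) -mulrA (mulrA _ _ t).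
  by rewrite -(morph_mul (am i) (sa_adj hM Mt2) Mt2) it2 (morph_one (am i)) mul1r.
have ic' : isometry (ald s i t2' * t').
  rewrite /isometry adjM -(morph_adj (dm i) Pt2') -mulrA (mulrA _ _ t').
  by rewrite -(morph_mul (dm i) (sa_adj hP Pt2') Pt2') it2' (morph_one (dm i)) mul1r.
have ec : al s i t2 * t * (al s i t2 * t)^† = ald s i t2' * t' * (ald s i t2' * t')^†.
  have he := hom_mul hM (hom_adj hM hM (rm k) (am i) ht) ht.
  have he' := hom_mul hP (hom_adj hP hP (km k') (dm i) ht') ht'.
  rewrite !adjM !mulrA -(mulrA _ t) -(mulrA _ t').
  have Mt2' := sa_adj hM Mt2; have Pt2'' := sa_adj hP Pt2'.
  rewrite -(morph_adj (am i) Mt2) -(morph_adj (dm i) Pt2').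
  rewrite -mulrA (proj2 he _ Mt2') -mulrA (proj2 he' _ Pt2'').
  rewrite (mulrA (al s i t2)) (mulrA (ald s i t2')).
  rewrite -(morph_mul (am i) Mt2 Mt2') -(morph_mul (dm i) Pt2' Pt2'') -e.
  by rewrite -e2 alphaPE// e2; exact: (sa_mul hP).
have [a [b [ua ub h]]] := transfer_hom hM hP (rm m) (am p)
  (morphism_comp (rm l) (rm k)) (alpha_comp_morph S s i s j)
  (km m') (dm p) (morphism_comp (km l') (km k')) (alpha_comp_morph Sd s i s j)
  (hom_chiral2E p i j) ht3 it3 ht3' it3' e3 hc ic hc' ic' ec.
exact: (dim_unitary_mul ua ub h).
Qed.

Lemma vartheta_rel_unique k k' l' : rel k k' -> rel k l' -> k' = l'.
Proof.
move=> h1 h2; have [a [b [ua ub h]]] := vartheta_rel_hom h1 h2.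
apply: rep_inequiv.
apply: (irreducible_equivalent hP hP (km k') (km l') (rep_irr k') (rep_irr l') (t := a * 1 * b)).
  by apply/h; exact: hom_one.
exact: unitary_transfer_neq0.
Qed.

Lemma vartheta_rel_inj k l k' : rel k k' -> rel l k' -> k = l.
Proof.
move=> h1 h2; have [a [b [ua ub h]]] := vartheta_rel_hom h1 h2.
have [[a1 a2] [b1 b2]] := (ua, ub).
apply: rep_inequiv.
apply: (irreducible_equivalent hM hM (rm k) (rm l) (rep_irr k) (rep_irr l) (t := a^† * 1 * b^†)).
  apply/h; rewrite mulr1 mulrA a2 mul1r b1; exact: hom_one.
by apply: unitary_transfer_neq0; rewrite // /unitary adjK.
Qed.

Lemma vartheta_rel_chiral k k' : rel k k' -> k \in chiral S tau s.
Proof. by move=> [i [t [t' [[ht it] _ _]]]]; apply/in_chiral; exists i, t. Qed.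

(** The projection w w^† lies in M_s by [hom_intermediate], and [isometry_split] inside M_s gives an
    isometry with the same range. *)
Lemma vartheta_rel_total k : k \in chiral S tau s -> exists k', rel k k'.
Proof.
move=> /in_chiral[i [w hw iw]]; have [Mw wE] := hw.
have he := hom_mul hM (hom_adj hM hM (rm k) (am i) hw) hw.
have Pe := hom_intermediate alg_Sd he.
have eP : projection (w * w^†).
  by split; [rewrite adjM adjK|rewrite -mulrA (mulrA _ w) iw mul1r].
have e0 : w * w^† <> 0.
  move=> e0; apply: one0; have := congr1 (fun z => w^† * z * w) e0.
  by rewrite mulr0 mul0r mulrA iw mul1r iw.
have [t' [Pt' it' et']] := isometry_split (type_III_vn (alg_III Sd)) (@alg_sub _ _ _ Sd) Pe he eP e0.
have he' : hom P P (ald s i) (ald s i) (w * w^†) by rewrite -(hom_chiralE alg_Sd).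
have te a : P a -> t' * t'^† * ald s i a = ald s i a * (t' * t'^†).
  by rewrite et'; exact: (proj2 he').
have [mt ht] := isometry_compression hP hP (dm i) Pt' it' te.
have [||k' [u [Pu [u1 u2] hu]]] := @rep_all _ _ _ _ _ XMd _ i mt.
- apply: compression_irreducible => //; rewrite et' => x.
  rewrite -(hom_chiralE alg_Sd) => hx.
  have [c cE] := irreducible_hom_scalar (rep_irr k)
    (hom_mul hM hw (hom_mul hM hx (hom_adj hM hM (rm k) (am i) hw))).
  exists c; transitivity (w * (w^† * x * w) * w^†); first by rewrite !mulrA.
  by rewrite cE bop_scaleAr bop_scaleAl mulr1.
- by exists t'.
exists k', i, w, (t' * u); split=> //; first split.
- by apply: (hom_mul hP) ht; exact: (@equivalent_hom _ _ P P _ _ u).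
- by rewrite /isometry adjM -mulrA (mulrA t'^†) it' mul1r.
- by rewrite adjM -mulrA (mulrA u) u2 mul1r et'.
Qed.

(** An isometry of M_s also cuts a sector out of the induction on M, irreducible because the
    self-intertwiners are the same. *)
Lemma vartheta_rel_surj k' : exists k, rel k k'.
Proof.
have [i [w hw iw]] := rep_sub k'; have [Pw wE] := hw.
have he : hom M M (al s i) (al s i) (w * w^†).
  by rewrite (hom_chiralE alg_Sd); exact: (hom_mul hP (hom_adj hP hP (km k') (dm i) hw) hw).
have [mt ht] := isometry_compression hM hM (am i) (PM Pw) iw (proj2 he).
have [||k [u [Mu [u1 u2] hu]]] := @rep_all _ _ _ _ _ XM _ i mt.
- apply: compression_irreducible => //; first exact: PM.
    exact: (proj2 he).
  move=> x; rewrite (hom_chiralE alg_Sd) => hx.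
  have [c cE] := irreducible_hom_scalar (rep_irr k')
    (hom_mul hP hw (hom_mul hP hx (hom_adj hP hP (km k') (dm i) hw))).
  exists c; transitivity (w * (w^† * x * w) * w^†); first by rewrite !mulrA.
  by rewrite cE bop_scaleAr bop_scaleAl mulr1.
- exact: alpha_subsector iw ht.
exists k, i, (w * u), w; split=> //; first split.
- by apply: (hom_mul hM) ht; exact: (@equivalent_hom _ _ M M _ _ u).
- by rewrite /isometry adjM -mulrA (mulrA w^†) iw mul1r.
- by rewrite adjM -mulrA (mulrA u) u2 mul1r.
Qed.

Lemma varthetaP k : k \in chiral S tau s -> rel k (vartheta XMd k).
Proof.
move=> /vartheta_rel_total[k' kk']; rewrite /vartheta.
by case: pickP => [l' /asboolP//|/(_ k')/asboolP].
Qed.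

Lemma local_at_adj i w : local_at S Sd i w ->
  forall s' x, P x -> w^† * al s' i x = w^† * al (~~ s') i x.
Proof.
move=> lw s' x Px; apply: (@adj_inj R H); rewrite !adjM adjK.
have Mx := PM Px; rewrite -!(morph_adj (alpha_morph S _ i) Mx).
by case: s'; rewrite lw//; exact: (sa_adj hP).
Qed.

Lemma ambichiral_hom_sub k k' : rel k k' -> k \in X0 ->
  exists i t', isometry t' /\ forall s', hom P P (kap k') (ald s' i) t'.
Proof.
move=> kk'; have [i [t [t' [[ht it] [ht' it'] e]]]] := kk'.
rewrite in_ambichiral (vartheta_rel_chiral kk') => /in_chiral[j [w hw iw]].
have lt := ambichiral_local alg_Sd (rm k) ht hw iw.
have [Pt' tE'] := ht'.
exists i, t'; split=> // s'; split=> // x Px.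
rewrite tE'// !alphaPE// -[t' in LHS]mulr1 -it' (mulrA t') -e !mulrA.
have -> : al s i x * t = al s' i x * t.
  have lx := lt _ Px; case: (s); case: s' => //.
by rewrite -!mulrA (mulrA t) e -mulrA it' mulr1.
Qed.

(** The intertwiner t' serves both signs. For u of one sign, u t'^† intertwines inductions of that
    sign inside M_s, hence of either sign; multiplying by t' returns u. *)
Lemma ambichiral_hom_signs k k' j s1 s2 : rel k k' -> k \in X0 ->
  hom P P (kap k') (ald s1 j) `<=` hom P P (kap k') (ald s2 j).
Proof.
move=> kk' kX0 u hu; have [i [t' [it' ht']]] := ambichiral_hom_sub kk' kX0.
have hx := hom_mul hP (hom_adj hP hP (km k') (alpha_morph _ _ _) (ht' s1)) hu.
have [Px _] := hx.
have ix := intermediate_intertwines alg_Sd (hom_intertwines hx).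
have := hom_mul hP (ht' s2) (intermediate_hom_signs alg_Sd s2 Px ix).
by rewrite -mulrA it' mulr1.
Qed.

Lemma vartheta_rel_ambichiral k k' : rel k k' ->
  (k \in X0) = (k' \in ambichiral Sd kap).
Proof.
move=> kk'; have [i [t [t' [[ht it] [ht' it'] e]]]] := kk'.
rewrite in_ambichiral in_ambichiral_sub (vartheta_rel_chiral kk') /=.
have -> /= : k' \in chiral Sd kap s by apply/in_chiral_sub; exists i, t'.
have [Pt' tE'] := ht'.
apply/idP/idP => [kX|/in_chiral_sub[j [u hu iu]]].
  have [|j [u [iu hu]]] := ambichiral_hom_sub kk'; last by apply/in_chiral_sub; exists j, u.
  by rewrite in_ambichiral (vartheta_rel_chiral kk').
(* In M_s, x = u t'^† intertwines both inductions of lambda_i with the same induction of lambda_j,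
   so the two agree on the support of x, which is the range of t. *)
have hx := hom_mul hP (hom_adj hP hP (km k') (dm i) ht') hu.
have [Px xE] := hx; set x := u * t'^† in hx Px xE.
have ix : intertwines S i j x.
  split=> [|a Na]; first exact: PM.
  by have := xE _ (NM Sd Na); rewrite !alphaN.
have [_ xE'] := intermediate_hom_signs alg_Sd (~~ s) Px ix.
have lt : local_at S Sd i t.
  apply/(local_atE S Sd s) => y Py; have Py' := sa_adj hP Py.
  have : x * al s i y^† = x * al (~~ s) i y^†.
    by rewrite -!alphaPE// xE// xE'.
  move=> /(congr1 (fun z => (u^† * z)^†)).
  rewrite /x !mulrA iu !mul1r !adjM !adjK -!(morph_adj (alpha_morph S _ i)) ?adjK; try exact: PM.
  move=> /(congr1 (fun z => z * (t'^† * t))).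
  by rewrite -!mulrA !(mulrA t') -e -!mulrA it mulr1.
apply/in_chiral.
exact: (local_ambichiral alg_Sd (rm k) (rep_irr k) ht it lt).
Qed.

Lemma idx0_ambichiral : idx0 XM \in X0.
Proof.
rewrite in_ambichiral; apply/andP; split; apply/in_chiral; exists i0, 1;
  rewrite ?/isometry ?adj1 ?mul1r//; split=> [|x Mx]; try exact: sa_one;
  by rewrite mul1r mulr1 alpha0// rep_id.
Qed.

Lemma vartheta_rel0 : rel (idx0 XM) (idx0 XMd).
Proof.
exists i0, 1, 1; rewrite /isometry adj1 mul1r; split=> //; split=> //;
  (split=> [|x Mx]; first exact: sa_one);
  by rewrite mul1r mulr1 alpha0// rep_id.
Qed.

Let ri k : irreducible M M (tau k) := rep_irr k.
Let rn k l : equivalent M M (tau k) (tau l) -> k = l := @rep_inequiv _ _ _ _ _ XM k l.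

Lemma bracket_alpha s' k i n (nu : 'I_n -> idx XM) (ws : 'I_n -> B) :
  decomposition M tau (al s' i) nu ws ->
  branching s' k i = #|[set p | nu p == k]%SET|.
Proof.
by move=> d; rewrite /branching (bracket_decomposition hM one0 rm ri rn k _ d)//; exact: alpha_morph.
Qed.

Lemma branching0 s' k : branching s' k i0 = (k == idx0 XM).
Proof.
rewrite /branching /bracket (_ : hom _ _ _ _ = hom M M (tau k) (tau (idx0 XM))).
  have d := decomposition_irr hM tau (idx0 XM).
  rewrite -/(bracket _ _ _ _) (bracket_decomposition hM one0 rm ri rn k (rm _) d).
  by rewrite card_ord1 eq_sym.
by apply: hom_eq_on => // x Mx; rewrite alpha0// rep_id.
Qed.

(** An irreducible sector common to alpha^+_i and alpha^-_j is ambichiral, so no matrix unit has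
    another label. *)
Lemma coupling_branching i j :
  coupling S i j = (\sum_(k in X0) branching true k i * branching false k j)%N.
Proof.
have [n [nu [w dw]]] := alpha_decomposition XM true i.
have [m [nu' [w' dw']]] := alpha_decomposition XM false j.
have [wh wo w1] := dw; have [wh' wo' w1'] := dw'.
have ma := alpha_morph S.
under eq_bigr do rewrite (bracket_alpha _ dw) (bracket_alpha _ dw').
rewrite -(dim_decomposition hM one0 rm ri rn X0 (ma _ i) (ma _ j) dw dw').
congr (dim _); apply/seteqP; split=> x; last by case.
move=> hx; split=> // p q pX0; apply: contrapT => z0.
have hz := hom_mul hM (wh p) (hom_mul hM hx (hom_adj hM hM (rm _) (ma _ _) (wh' q))).
have [c zE] := tau_hom hM rm ri rn hz.
have pq : nu p = nu' q.
  by case: eqVneq zE => // _; rewrite scale0r => /z0.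
case/negP: pX0; rewrite finset.in_setI; apply/andP; split; apply/in_chiral.
  by exists i, (w p); [exact: wh|rewrite /isometry wo eqxx].
by rewrite pq; exists j, (w' q); [exact: wh'|rewrite /isometry wo' eqxx].
Qed.

Lemma coupling_intermediate i j :
  coupling Sd i j = (\sum_(k in X0) branching s k i * branching s k j)%N.
Proof.
have [n [nu [w dw]]] := alpha_decomposition XM s i.
have [m [nu' [w' dw']]] := alpha_decomposition XM s j.
have [wh wo w1] := dw; have [wh' wo' w1'] := dw'.
have iso p : isometry (w p) by rewrite /isometry wo eqxx.
under eq_bigr do rewrite (bracket_alpha _ dw) (bracket_alpha _ dw').
rewrite -(dim_decomposition hM one0 rm ri rn X0 (am i) (am j) dw dw').
congr (dim _); apply/seteqP; split=> x.
  move=> [Px xE].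
  have ix : intertwines S i j x.
    split=> [|a Na]; first exact: PM.
    by have := xE _ (NM Sd Na); rewrite !alphaN.
  have hx := intermediate_hom alg_Sd Px ix.
  have xs s' := proj2 (intermediate_hom_signs alg_Sd s' Px ix).
  split=> // p q pX0; apply: contrapT => z0.
  have hz := hom_mul hM (wh p) (hom_mul hM hx (hom_adj hM hM (rm _) (am _) (wh' q))).
  have [c] := tau_hom hM rm ri rn hz.
  set d := (if _ then _ else _) => zE.
  have d0 : d != 0 by apply/eqP => d0; apply: z0; rewrite zE d0 scale0r.
  (* The projection [w p * (w p)^†] lies in M_s and commutes there with both inductions; the nonzero
     component d then carries the equality of the signs from x over to [w p]. *)
  have he := hom_mul hM (hom_adj hM hM (rm _) (am i) (wh p)) (wh p).
  have Pe := hom_intermediate alg_Sd he.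
  have es s' := proj2 (intermediate_hom_signs alg_Sd s' Pe (hom_intertwines he)).
  have lw : local_at S Sd i (w p).
    move=> y Py; have Py' := sa_adj hP Py.
    have cw s' : d *: ((w p)^† * al s' i y^†) =
        (w' q)^† * (x * al s' i y^†) * (w p * (w p)^†).
      rewrite -bop_scaleAl -[(w p)^† in LHS]mul1r -bop_scaleAl -zE.
      have := es s' _ Py'; rewrite !alphaPE// => e.
      by rewrite -!mulrA -e !mulrA.
    have xx : x * al true i y^† = x * al false i y^†.
      by rewrite -!alphaPE// xE// xs.
    have /(scalerI d0) := etrans (cw true) (etrans (congr1 (fun z => (w' q)^† * z *
      (w p * (w p)^†)) xx) (esym (cw false))).
    move=> /(congr1 (@bop_adj R H)).
    by rewrite !adjM !adjK -!(morph_adj (alpha_morph S _ i)) ?adjK//; exact/PM.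
  case/negP: pX0; rewrite in_ambichiral; apply/andP; split; apply/in_chiral.
    by exists i, (w p).
  exact: (local_ambichiral alg_Sd (rm _) (ri _) (wh p) (iso p) lw).
move=> [hx hx0]; have Px := hom_intermediate alg_Sd hx.
have xs s' := proj2 (intermediate_hom_signs alg_Sd s' Px (hom_intertwines hx)).
split=> // y Py.
(* Since x intertwines equal signs, it suffices to change the sign to its right: an ambichiral [w p]
   allows this, and x vanishes on the others. *)
suff xx : x * al true i y = x * al false i y.
  by rewrite -xs// !alphaPE.
rewrite -[x]mulr1 -w1 mulr_sumr !mulr_suml; apply: eq_bigr => p _.
have [pX0|/hx0 xp0] := boolP (nu p \in X0).
  rewrite in_ambichiral in pX0; have /andP[_ /in_chiral[j' [u hu iu]]] := pX0.
  have lw := ambichiral_local alg_Sd (rm _) (wh p) hu iu.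
  by rewrite -!mulrA (local_at_adj lw true Py).
suff xw : x * w p = 0 by rewrite !mulrA xw !mul0r.
rewrite -[LHS]mul1r -w1' mulr_suml big1// => q _.
by rewrite -mulrA (mulrA _ x) xp0 mulr0.
Qed.

Lemma coupling_type_I : type_I (coupling Sd).
Proof.
(* Extending by 0 off the ambichiral labels lets the whole index type serve. *)
exists (idx XM), (idx0 XM), (fun k i => if k \in X0 then branching s k i else 0%N).
split=> [i j|k]; last first.
  case: ifPn => [_|kX0]; first exact: branching0.
  by case: eqVneq kX0 => // ->; rewrite idx0_ambichiral.
rewrite coupling_intermediate big_mkcond/=; apply: eq_bigr => k _.
by case: ifP.
Qed.

End Chiral.

(** * The automorphism omega when the two intermediate algebras coincide *)

Section Omega.
Context {R : realType} {H : hilbert R} {X : braided_system H}.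
Local Notation B := (bop H).
Local Notation lam := (lam (b := X)).
Variables (S : subfactor X) (XM : full_system S) (Sd : bool -> subfactor X)
  (XMd : forall s, chiral_system (Sd s) s).
Hypotheses (alg_Sd : forall s, alg (Sd s) = chiral_alg S s)
  (algE : alg (Sd true) = alg (Sd false)) (XMd_same : same_ambichiral XMd).
Local Notation M := (alg S).
Local Notation P := (alg (Sd true)).
Local Notation tau := (rep (s := XM)).
Local Notation X0 := (ambichiral S tau).
Local Notation th s k := (vartheta (XM := XM) (XMd s) k).
Local Notation kap s k := (rep (th s k)).
Local Notation rel s := (@vartheta_rel _ _ _ _ XM (Sd s) s (XMd s)).
Local Notation w := (omega (XM := XM) XMd).

Let algEs s : alg (Sd s) = P. Proof. by case: s. Qed.

Let one0 : (1 : B) <> 0 := @bop_one_neq0 R H X.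
Let hP : star_algebra P := alg_star (Sd true).

Let alpha_same s s' i : eq_on P (alpha (Sd s) s' (lam i)) (alpha S s' (lam i)).
Proof. by rewrite -(algEs s); exact: (alpha_restrict (alg_Sd s)). Qed.

Let hom_algE (f g : B -> B) : hom (alg (Sd false)) (alg (Sd false)) f g = hom P P f g.
Proof. by rewrite algE. Qed.

Let algPE x : alg (Sd false) x = P x. Proof. by rewrite algE. Qed.

Lemma coupling_same i j : coupling (Sd true) i j = coupling (Sd false) i j.
Proof.
rewrite /coupling /bracket hom_algE; congr (dim _).
by apply: hom_eq_on => x Px; rewrite !alpha_same.
Qed.

Let ambichiral_chiral s k : k \in X0 -> k \in chiral S tau s.
Proof. by rewrite (in_ambichiral s) => /andP[]. Qed.

Let relP s k : k \in X0 -> rel s k (th s k).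
Proof. by move=> kX0; apply: (varthetaP (XMd s) (alg_Sd s)); exact: ambichiral_chiral. Qed.

Let kapP s k : is_morphism P P (kap s k).
Proof. by move: (rep (th s k)) (rep_morph (th s k)) => f; rewrite algEs. Qed.



(** The image of k under vartheta_- is ambichiral, hence also a representative in the other system;
    its preimage under vartheta_+ keeps the search defining [omega] from its default. *)
Lemma omegaP k : k \in X0 -> w k \in X0 /\ eq_on P (kap true (w k)) (kap false k).
Proof.
move=> kX0; have kk' := relP false kX0.
have := kX0; rewrite (vartheta_rel_ambichiral (alg_Sd false) kk') => k'X0.
have [l' l'X0 ll'] := XMd_same k'X0; rewrite /= in l' l'X0 ll'.
have [l rl] := vartheta_rel_surj XM (alg_Sd true) l'.
have lc : l \in chiral S tau true := vartheta_rel_chiral rl.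
have thl : th true l = l' := vartheta_rel_unique (alg_Sd true) (varthetaP (XMd true) (alg_Sd true) lc) rl.
have [wc we] : w k \in chiral S tau true /\ eq_on P (kap true (w k)) (kap false k).
  rewrite /omega; case: pickP => [m /andP[mc /asboolP//]|/(_ l)].
  rewrite lc /= => /asboolP[]; rewrite thl => x Px; rewrite ll'//.
  by rewrite algPE.
split=> //.
have rw := varthetaP (XMd true) (alg_Sd true) wc.
rewrite (vartheta_rel_ambichiral (alg_Sd true) rw).
have sub s' : th true (w k) \in chiral (Sd true) (rep (s := XMd true)) s'.
  have /in_chiral_sub[i [t ht it]] : th false k \in chiral (Sd false) (rep (s := XMd false)) s'.
    by move: k'X0; rewrite finset.in_setI => /andP[]; case: s'.
  apply/in_chiral_sub; exists i, t => //; move: ht; rewrite hom_algE.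
  rewrite (@hom_eq_on R H P P _ (kap true (w k)) _ (alpha (Sd true) s' (lam i)))//.
    exact: eq_on_sym.
  by move=> x Px; rewrite !alpha_same.
by rewrite finset.in_setI !sub.
Qed.

Lemma omega_inj : {in X0 &, injective w}.
Proof.
move=> k l kX0 lX0 wkl; have [_ ek] := omegaP kX0; have [_ el] := omegaP lX0.
apply: (vartheta_rel_inj (alg_Sd false) (relP false kX0)).
have <- : th false l = th false k; last exact: relP.
apply: rep_inequiv; exists 1; split.
- exact: (sa_one (alg_star (Sd false))).
- by split; rewrite adj1 mul1r.
- by move=> x; rewrite algPE => Px; rewrite adj1 mul1r mulr1 -ek// wkl el.
Qed.

Lemma omega_image : [set w k | k in X0]%SET = X0.
Proof.
apply/eqP; rewrite eqEcard card_in_imset; last exact: omega_inj.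
rewrite leqnn andbT; apply/fintype.subsetP => l /imsetP[k kX0 ->].
by have [] := omegaP kX0.
Qed.

Lemma omega0 : w (idx0 XM) = idx0 XM.
Proof.
have X00 := idx0_ambichiral true XM; have [w0 we] := omegaP X00.
have th0 s : th s (idx0 XM) = idx0 (XMd s).
  exact: (vartheta_rel_unique (alg_Sd s) (relP s X00) (vartheta_rel0 _ _)).
apply: (vartheta_rel_inj (alg_Sd true) (relP true w0)).
have -> : th true (w (idx0 XM)) = th true (idx0 XM); last exact: relP.
apply: rep_inequiv; exists 1; split.
- exact: (sa_one hP).
- by split; rewrite adj1 mul1r.
- move=> x Px; rewrite adj1 mul1r mulr1 we// !th0 !rep_id//.
  by rewrite algPE.
Qed.

Lemma omega_fusion : {in X0 & &, forall k'' k k',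
  bracket M M (tau (w k'')) (tau (w k) \o tau (w k')) =
  bracket M M (tau k'') (tau k \o tau k')}.
Proof.
move=> m k l mX0 kX0 lX0.
have [wm em] := omegaP mX0; have [wk ek] := omegaP kX0; have [wl el] := omegaP lX0.
rewrite (vartheta_rel_fusion (alg_Sd true) (relP true wk) (relP true wl) (relP true wm)).
rewrite (vartheta_rel_fusion (alg_Sd false) (relP false kX0) (relP false lX0) (relP false mX0)).
rewrite /bracket hom_algE; congr (dim _); apply: hom_eq_on => // x Px /=.
by rewrite el// ek//; exact: (morph_in (kapP false l)).
Qed.

(** Both numbers are computed in the common algebra from the same endomorphism and inductions of
    opposite sign, which an ambichiral sector does not distinguish. *)
Lemma branching_omega k j : k \in X0 -> branching false k j = branching true (w k) j.
Proof.
move=> kX0; have [wX0 we] := omegaP kX0.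
rewrite (vartheta_rel_branching (alg_Sd true) j (relP true wX0)).
rewrite (vartheta_rel_branching (alg_Sd false) j (relP false kX0)).
rewrite /bracket hom_algE; congr (dim _).
rewrite (@hom_eq_on R H P P _ (kap true (w k)) _ (alpha (Sd true) false (lam j))); first last.
- by move=> x Px; rewrite !alpha_same.
- exact: eq_on_sym.
by apply/seteqP; split=> x;
  apply: (ambichiral_hom_signs (alg_Sd true) _ (relP true wX0) wX0).
Qed.

Lemma coupling_omega i j : coupling S i j =
  (\sum_(k in X0) branching true k i * branching true (w k) j)%N.
Proof.
rewrite (coupling_branching XM).
by apply: eq_bigr => k kX0; rewrite branching_omega.
Qed.

End Omega.

Theorem theorem5p5 (R : realType) (H : hilbert R) (X : braided_system H)
    (S : subfactor X) (XM : full_system S)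
    (Sd : bool -> subfactor X) (XMd : forall s, chiral_system (Sd s) s)
    (alg_Sd : forall s, alg (Sd s) = chiral_alg S s)
    (XMd_same : alg (Sd true) = alg (Sd false) -> same_ambichiral XMd) :
  let X0 := ambichiral S (rep (s := XM)) in
  (forall s, type_I (coupling (Sd s)) /\
     forall i j, coupling (Sd s) i j =
       (\sum_(k in X0) branching s k i * branching s k j)%N) /\
  (alg (Sd true) = alg (Sd false) ->
   let w := omega (XM := XM) XMd in
   [/\ forall i j, coupling (Sd true) i j = coupling (Sd false) i j,
       forall i j, coupling S i j =
         (\sum_(k in X0) branching true k i * branching true (w k) j)%N,
       [/\ {in X0 &, injective w}, [set w k | k in X0]%SET = X0
         & {in X0, forall k,
            eq_on (alg (Sd true)) (rep (vartheta (XMd true) (w k)))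
                                  (rep (vartheta (XMd false) k))}],
       w (idx0 XM) = idx0 XM
     & {in X0 & &, forall k'' k k',
        bracket (alg S) (alg S) (rep (w k'')) (rep (w k) \o rep (w k')) =
        bracket (alg S) (alg S) (rep k'') (rep k \o rep k')}]).
Proof.
move=> X0; split=> [s|algE w].
  by split; [exact: (coupling_type_I XM (alg_Sd s))|exact: (coupling_intermediate XM (alg_Sd s))].
have same := XMd_same algE; split.
- exact: (coupling_same alg_Sd algE).
- exact: (coupling_omega XM alg_Sd algE same).
- split; [exact: (omega_inj alg_Sd algE same)|exact: (omega_image XM alg_Sd algE same)|].
  by move=> k kX0; have [] := omegaP alg_Sd algE same kX0.
- exact: (omega0 XM alg_Sd algE same).
- exact: (omega_fusion alg_Sd algE same).
Qed.
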